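(* There exists a constant $c_T>0$, depending on $T$ but independent of $\varepsilon$, such that the following holds. Let $\varepsilon\in(0,\varepsilon_0)$ and $$\rho_0^\varepsilon\in C(\overline{\Omega_\varepsilon(0)}),\quad f^\varepsilon\in C(Q_{\varepsilon,T}),\quad \eta_0\in C(\Gamma(0)),\quad f\in C(S_T).$$ Let $\rho^\varepsilon$ be a classical solution to the thin domain problem $$\partial_t\rho^\varepsilon-k_d\Delta\rho^\varepsilon=f^\varepsilon \text{ in } Q_{\varepsilon,T},\qquad \partial_{\nu_\varepsilon}\rho^\varepsilon+k_d^{-1}V_\varepsilon\rho^\varepsilon=0 \text{ on } \partial_\ell Q_{\varepsilon,T},\qquad \rho^\varepsilon|_{t=0}=\rho_0^\varepsilon \text{ in } \Omega_\varepsilon(0),$$ and let $\eta$ be a classical solution to the limit problem $$\partial^\circ(g\eta)-gV_\Gamma H\eta-k_d\,\mathrm{div}_\Gamma(g\nabla_\Gamma\eta)=gf \text{ on } S_T,\qquad \eta|_{t=0}=\eta_0 \text{ on } \Gamma(0).$$ Suppose that $h_i=\nabla_\Gamma g_i\cdot\nabla_\Gamma\eta\in C(\overline{S_T})\cap C^{2,1}(S_T)$ for $i=0,1$ (where $h_i\in C(\overline{S_T})$ means that $h_i$ is continuous up to $t=0$, with values $h_i(\cdot,0)$ on $\Gamma(0)$). Then $$\begin{aligned}\|\rho^\varepsilon-\bar\eta\|_{C(\overline{Q_{\varepsilon,T}})}&\le c_T\Bigl(\|\rho_0^\varepsilon-\bar\eta_0\|_{C(\overline{\Omega_\varepsilon(0)})}+\|f^\varepsilon-\bar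 f\|_{C(Q_{\varepsilon,T})}\Bigr)+\varepsilon c_T\Bigl(\|\eta_0\|_{C(\Gamma(0))}+\|\eta\|_{C^{2,1}(S_T)}\Bigr)\\&\qquad+\varepsilon c_T\sum_{i=0,1}\Bigl(\|h_i(\cdot,0)\|_{C(\Gamma(0))}+\|h_i\|_{C^{2,1}(S_T)}\Bigr)\end{aligned}$$ provided that the right-hand side is finite.
   Context: Moving surface. Let $n\ge2$, $T>0$. For each $t\in[0,T]$, $\Gamma(t)\subset\mathbb{R}^n$ is a given closed (compact, without boundary), connected, oriented smooth hypersurface with unit outward normal vector field $\nu(\cdot,t)$. There is a smooth mapping $\Phi\colon\Gamma(0)\times[0,T]\to\mathbb{R}^n$ with $\Phi(\cdot,0)=\mathrm{Id}$ such that $\Phi(\cdot,t)$ is a diffeomorphism from $\Gamma(0)$ onto $\Gamma(t)$ for each $t$. Set $S_T=\bigcup_{t\in(0,T]}\Gamma(t)\times\{t\}$ and $\overline{S_T}=(\Gamma(0)\times\{0\})\cup S_T$. Let $d(\cdot,t)$ be the signed distance function from $\Gamma(t)$ increasing in the direction of $\nu(\cdot,t)$. Fix $\delta>0$ independent of $t$ such that, with $\overline{N(t)}=\{x\in\mathbb{R}^n: -\delta\le d(x,t)\le\delta\}$ and $\overline{N_T}=\bigcup_{t\in[0,T]}\overline{N(t)}\times\{t\}$, for each $(x,t)\in\overline{N_T}$ there is a unique $\pi(x,t)\in\Gamma(t)$ with $x=\pi(x,t)+d(x,t)\nu(\pi(x,t),t)$ and $\nabla d(x,t)=\nu(\pi(x,t),t)$,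 the maps $d,\pi$ are smooth on $\overline{N_T}$, and $c_0^{-1}\le1-r\kappa_\alpha(y,t)\le c_0$ for all $(y,t)\in\overline{S_T}$, $r\in[-\delta,\delta]$, $\alpha=1,\dots,n-1$ with some constant $c_0>0$, where $\kappa_1,\dots,\kappa_{n-1}$ are the principal curvatures of $\Gamma(t)$ (the eigenvalues of the Weingarten map $W=(-\underline{D}_i\nu_j)_{i,j}$ other than the eigenvalue $0$ in the direction $\nu$). For a function $\zeta$ on $\overline{S_T}$ (or on $S_T$, or on $\Gamma(0)$ at $t=0$), $\bar\zeta(x,t)=\zeta(\pi(x,t),t)$ denotes its constant extension in the normal direction of $\Gamma(t)$. Surface operators. $P=I_n-\nu\otimes\nu$; $\nabla_\Gamma\eta=P\nabla\tilde\eta=(\underline{D}_1\eta,\dots,\underline{D}_n\eta)^T$ on $\Gamma(t)$, i.e. $\underline{D}_i\eta=\sum_{j=1}^nP_{ij}\partial_j\tilde\eta$, for any extension $\tilde\eta$ of $\eta$ to a neighborhood (independent of the extension); $\mathrm{div}_\Gamma u=\sum_{i=1}^n\underline{D}_iu_i$; $H=-\mathrm{div}_\Gamma\nu$ (sum of principal curvatures). The scalar outer normal velocity $V_\Gamma$ of $\Gamma(t)$ is $V_\Gamma(\Phi(Y,t),t)=\partial_t\Phi(Y,t)\cdot\nu(\Phi(Y,t),t)$. Let $\Phi_\nu$ solve $\Phi_\nu(Y,0)=Y$, $\partial_t\Phi_\nu(Y,t)=(V_\Gamma\nu)(\Phi_\nu(Y,t),t)$ for $(Y,t)\in\Gamma(0)\times[0,T]$;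 $\Phi_\nu(\cdot,t)$ is a diffeomorphism from $\Gamma(0)$ onto $\Gamma(t)$. The normal time derivative is $\partial^\circ\eta(\Phi_\nu(Y,t),t)=\frac{\partial}{\partial t}\bigl(\eta(\Phi_\nu(Y,t),t)\bigr)$, equivalently $\partial^\circ\eta=\partial_t\tilde\eta+V_\Gamma\nu\cdot\nabla\tilde\eta$ for any extension $\tilde\eta$. Moving thin domain. $g_0,g_1$ are smooth functions on $\overline{S_T}$ such that $g=g_1-g_0\ge c$ on $\overline{S_T}$ for some constant $c>0$. Fix $\varepsilon_0\in(0,1)$ with $\varepsilon|g_i|\le\delta$ on $\overline{S_T}$ for all $\varepsilon\in(0,\varepsilon_0)$, $i=0,1$. For $t\in[0,T]$ let $\Omega_\varepsilon(t)=\{y+r\nu(y,t): y\in\Gamma(t),\ \varepsilon g_0(y,t)<r<\varepsilon g_1(y,t)\}$, $Q_{\varepsilon,T}=\bigcup_{t\in(0,T]}\Omega_\varepsilon(t)\times\{t\}$, $\partial_\ell Q_{\varepsilon,T}=\bigcup_{t\in(0,T]}\partial\Omega_\varepsilon(t)\times\{t\}$, $\overline{Q_{\varepsilon,T}}=\bigcup_{t\in[0,T]}\overline{\Omega_\varepsilon(t)}\times\{t\}$. $\nu_\varepsilon$ and $V_\varepsilon$ are the unit outward normal vector field and the scalar outer normal velocity of $\partial\Omega_\varepsilon(t)$, and $\partial_{\nu_\varepsilon}=\nu_\varepsilon\cdot\nabla$. The diffusion coefficient $k_d>0$ is a constant independent of $\varepsilon$. Classical solutions. $\rho^\varepsilon$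 is a classical solution to the thin domain problem if $\rho^\varepsilon\in C(\overline{Q_{\varepsilon,T}})$, $\partial_i\rho^\varepsilon\in C(Q_{\varepsilon,T}\cup\partial_\ell Q_{\varepsilon,T})$, $\partial_t\rho^\varepsilon,\partial_i\partial_j\rho^\varepsilon\in C(Q_{\varepsilon,T})$ for all $i,j=1,\dots,n$ and the problem is satisfied pointwise. $\eta$ is a classical solution to the limit problem if $\eta\in C(\overline{S_T})\cap C^{2,1}(S_T)$ and the problem is satisfied pointwise, where $C^{2,1}(S_T)=\{\zeta\in C(S_T): \partial^\circ\zeta,\underline{D}_i\zeta,\underline{D}_i\underline{D}_j\zeta\in C(S_T)\text{ for all }i,j\}$. Norms. $\|\cdot\|_{C(X)}$ is the supremum of the absolute value over $X$, and $\|\eta\|_{C^{2,1}(S_T)}=\|\eta\|_{C(S_T)}+\|\partial^\circ\eta\|_{C(S_T)}+\sum_i\|\underline{D}_i\eta\|_{C(S_T)}+\sum_{i,j}\|\underline{D}_i\underline{D}_j\eta\|_{C(S_T)}$. *)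

(* Defs.v *)
From HB Require Import structures.
From mathcomp Require Import all_boot all_order all_algebra.
From mathcomp Require Import all_classical all_reals all_analysis.

Set Implicit Arguments.
Unset Strict Implicit.
Unset Printing Implicit Defensive.

Import Order.TTheory GRing.Theory Num.Theory.
Import numFieldNormedType.Exports.

Local Open Scope classical_set_scope.
Local Open Scope ring_scope.

Section Euclidean.
Variables (R : realType) (n : nat).
Implicit Types (u v w x y : 'rV[R]_n) (A D M : set 'rV[R]_n).

(* The library norm on ['rV[R]_n] is the sup norm; it is used only for
   topological notions, and lengths and distances are measured by [enorm]. *)
Definition dotv u v : R := \sum_i u 0 i * v 0 i.

Definition enorm u : R := Num.sqrt (dotv u u).

Definition dist_to A x : R := inf [set enorm (x - y) | y in A].

Definition grad (f : 'rV[R]_n -> R) x : 'rV[R]_n :=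
  \row_i 'D_(delta_mx 0 i) f x.

Definition boundary A : set 'rV[R]_n := closure A `\` A°.

(* The union of the bounded components of the complement of [M]; when [M] is a
   closed connected hypersurface it is the region enclosed by [M]. *)
Definition inside M : set 'rV[R]_n :=
  [set x | (~` M) x /\ bounded_set (connected_component (~` M) x)].

Definition sdist M x : R :=
  if `[< inside M x >] then - dist_to M x else dist_to M x.

Definition tangent M x w : Prop :=
  exists gamma : R -> 'rV[R]_n, [/\ gamma 0 = x,
    \forall s \near (0 : R), M (gamma s) & is_derive (0 : R) 1 gamma w].

(* [v] is the unit normal of the hypersurface [M] at [x] that points out of the
   region [D] bounded by [M]. *)
Definition unit_outward_normal D M x v : Prop :=
  [/\ enorm v = 1, forall w, tangent M x w -> dotv v w = 0 &
      \forall r \near 0^'+, D (x - r *: v) /\ ~ closure D (x + r *: v)].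

End Euclidean.

Section Smoothness.
Variables (R : realType).

Fixpoint Ck_open (V W : normedModType R) (k : nat) (U : set V) (f : V -> W)
    : Prop :=
  match k with
  | 0 => forall x, U x -> {for x, continuous f}
  | k'.+1 => (forall x, U x -> differentiable f x) /\
             forall v, Ck_open k' U ('D_v f)
  end.

(* On a set that need not be open, smoothness means that near each point of the
   set there is a smooth extension. *)
Definition smooth_on (V W : normedModType R) (A : set V) (f : V -> W) : Prop :=
  forall x, A x -> exists U (F : V -> W),
    [/\ open_nbhs x U, forall k, Ck_open k U F &
        forall y, A y -> U y -> F y = f y].

Definition diffeomorphism (V W : normedModType R) (A : set V) (B : set W)
    (f : V -> W) : Prop :=
  [/\ set_bij A B f, smooth_on A f &
      exists h : W -> V, smooth_on B h /\ forall x, A x -> h (f x) = x].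

Definition hypersurface (n : nat) (M : set 'rV[R]_n) : Prop :=
  forall x, M x -> exists U (phi : 'rV[R]_n -> R),
    [/\ open_nbhs x U, forall k, Ck_open k U phi,
        forall y, U y -> grad phi y != 0 &
        forall y, U y -> (M y <-> phi y = 0)].

(* Time derivatives are taken within [0, T], so they are one-sided at the
   endpoints; this gives a meaning to them at t = T (and at t = 0). *)
Definition tquot (W : normedModType R) (f : R -> W) (t s : R) : W :=
  (s - t)^-1 *: (f s - f t).

Definition is_tderive (W : normedModType R) (T : R) (f : R -> W) (t : R)
    (l : W) : Prop :=
  tquot f t @ within `[0, T] t^' --> l.

Definition tderivable (W : normedModType R) (T : R) (f : R -> W) (t : R)
    : Prop := cvg (tquot f t @ within `[0, T] t^').

Definition tderive (W : normedModType R) (T : R) (f : R -> W) (t : R) : W :=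
  lim (tquot f t @ within `[0, T] t^').

End Smoothness.

Section SpaceTime.
Variables (R : realType) (n : nat).
Local Notation E := ('rV[R]_n * R)%type.
Implicit Types (f : E -> R) (p : E).

Definition slab (I : set R) (A : R -> set 'rV[R]_n) : set E :=
  [set p | I p.2 /\ A p.2 p.1].

Definition pderivable (i : 'I_n) f p : Prop :=
  derivable (fun x => f (x, p.2)) p.1 (delta_mx 0 i).

Definition pd (i : 'I_n) f p : R :=
  'D_(delta_mx 0 i) (fun x => f (x, p.2)) p.1.

Definition pt_derivable (T : R) f p : Prop :=
  tderivable T (fun s => f (p.1, s)) p.2.

Definition pt (T : R) f p : R := tderive T (fun s => f (p.1, s)) p.2.

Definition laplacian f p : R := \sum_i pd i (pd i f) p.

Definition supnorm (X : Type) (A : set X) (f : X -> R) : \bar R :=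
  ereal_sup [set (`|f x|)%:E | x in A].

(* [v] is the scalar normal velocity at [p] of the moving hypersurface [M],
   with respect to the unit normal [nu] of [M p.2] at [p.1]. *)
Definition normal_velocity (T : R) (M : R -> set 'rV[R]_n) (p : E)
    (nu : 'rV[R]_n) (v : R) : Prop :=
  let curve (gamma : R -> 'rV[R]_n) (w : 'rV[R]_n) :=
    [/\ gamma p.2 = p.1, forall s, s \in `[0, T] -> M s (gamma s) &
        is_tderive T gamma p.2 w] in
  (exists gamma w, curve gamma w) /\
  forall gamma w, curve gamma w -> v = dotv w nu.

End SpaceTime.

(* Functions on the space-time surface are represented by total functions on
   R^n x R, of which only the values on the surface matter. *)
Record surface_data (R : realType) (n : nat) := SurfaceData {
  Gam : R -> set 'rV[R]_n;
  nu : 'rV[R]_n * R -> 'rV[R]_n;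
  Phi : 'rV[R]_n * R -> 'rV[R]_n;
  VGam : 'rV[R]_n * R -> R;
  Phinu : 'rV[R]_n * R -> 'rV[R]_n;
  delta : R;
  foot : 'rV[R]_n * R -> 'rV[R]_n
}.

Section SurfaceOperators.
Variables (R : realType) (n : nat) (T : R) (S : surface_data R n).
Local Notation E := ('rV[R]_n * R)%type.
Implicit Types (zeta : E -> R) (u : E -> 'rV[R]_n) (p : E).

Definition ST : set E := slab `]0, T] (Gam S).
Definition STbar : set E := slab `[0, T] (Gam S).

Definition sd p : R := sdist (Gam S p.2) p.1.

Definition tube (t : R) : set 'rV[R]_n :=
  [set x | - delta S <= sd (x, t) <= delta S].

Definition NTbar : set E := slab `[0, T] tube.

(* The constant extension in the normal direction, with [foot] the closest-point
   projection onto the surface. *)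
Definition cext zeta : E -> R := fun p => zeta (foot S p, p.2).

Definition proj p : 'M[R]_n := 1%:M - (nu S p)^T *m nu S p.

(* The value P grad zeta~ does not depend on the extension zeta~ of zeta; the
   constant extension is used here. *)
Definition sdiff zeta p : Prop :=
  differentiable (fun x => cext zeta (x, p.2)) p.1.

Definition sD (i : 'I_n) zeta p : R := \sum_j proj p i j * pd j (cext zeta) p.

Definition sgrad zeta p : 'rV[R]_n := \row_i sD i zeta p.

Definition sdiv u p : R := \sum_i sD i (fun q => u q 0 i) p.

Definition weingarten p : 'M[R]_n :=
  \matrix_(i, j) - sD i (fun q => nu S q 0 j) p.

(* Eigenvalues of the Weingarten map on the tangent space, i.e. other than the
   eigenvalue 0 in the direction nu. *)
Definition principal_curvature p (kappa : R) : Prop :=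
  exists v : 'rV[R]_n, [/\ v != 0, dotv v (nu S p) = 0 &
    weingarten p *m v^T = kappa *: v^T].

Definition meancurv p : R := - sdiv (nu S) p.

(* The Y in [Gam S 0] with [Phinu S (Y, p.2) = p.1]. *)
Definition label p : 'rV[R]_n :=
  'pinv_(fun=> 0) (Gam S 0) (fun Y => Phinu S (Y, p.2)) p.1.

Definition along_normal zeta p : R -> R :=
  fun s => zeta (Phinu S (label p, s), s).

Definition normal_derivable zeta p : Prop :=
  tderivable T (along_normal zeta p) p.2.

Definition normal_dt zeta p : R := tderive T (along_normal zeta p) p.2.

Definition C21 zeta : Prop :=
  [/\ {within ST, continuous zeta},
      (forall p, ST p -> normal_derivable zeta p) /\
        {within ST, continuous (normal_dt zeta)},
      (forall p, ST p -> sdiff zeta p) /\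
        (forall i, {within ST, continuous (sD i zeta)}) &
      (forall j p, ST p -> sdiff (sD j zeta) p) /\
        (forall i j, {within ST, continuous (sD i (sD j zeta))})].

Definition C21norm zeta : \bar R :=
  (supnorm ST zeta + supnorm ST (normal_dt zeta)
   + \sum_(i < n) supnorm ST (sD i zeta)
   + \sum_(i < n) \sum_(j < n) supnorm ST (sD i (sD j zeta)))%E.

Record moving_surface : Prop := MovingSurface {
  Gam_closed_connected : forall t, t \in `[0, T] ->
    [/\ Gam S t !=set0, compact (Gam S t) & connected (Gam S t)];
  Gam_hypersurface : forall t, t \in `[0, T] -> hypersurface (Gam S t);
  nu_outward : forall p, STbar p ->
    unit_outward_normal (inside (Gam S p.2)) (Gam S p.2) p.1 (nu S p);
  Phi_smooth : smooth_on (Gam S 0 `*` `[0, T]) (Phi S);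
  Phi_init : forall Y, Gam S 0 Y -> Phi S (Y, 0) = Y;
  Phi_diffeo : forall t, t \in `[0, T] ->
    diffeomorphism (Gam S 0) (Gam S t) (fun Y => Phi S (Y, t));
  VGam_def : forall Y t, Gam S 0 Y -> t \in `[0, T] ->
    VGam S (Phi S (Y, t), t) =
    dotv (tderive T (fun s => Phi S (Y, s)) t) (nu S (Phi S (Y, t), t));
  Phinu_init : forall Y, Gam S 0 Y -> Phinu S (Y, 0) = Y;
  Phinu_ode : forall Y t, Gam S 0 Y -> t \in `[0, T] ->
    let q := (Phinu S (Y, t), t) in
    is_tderive T (fun s => Phinu S (Y, s)) t (VGam S q *: nu S q);
  Phinu_diffeo : forall t, t \in `[0, T] ->
    diffeomorphism (Gam S 0) (Gam S t) (fun Y => Phinu S (Y, t));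
  delta_gt0 : 0 < delta S;
  foot_unique : forall p, NTbar p ->
    unique (fun y => [/\ Gam S p.2 y, p.1 = y + sd p *: nu S (y, p.2),
                         differentiable (fun x => sd (x, p.2)) p.1 &
                         grad (fun x => sd (x, p.2)) p.1 = nu S (y, p.2)])
           (foot S p);
  sd_smooth : smooth_on NTbar sd;
  foot_smooth : smooth_on NTbar (foot S);
  curvature_bound : exists c0 : R, 0 < c0 /\
    forall p r kappa, STbar p -> r \in `[- delta S, delta S] ->
      principal_curvature p kappa -> c0^-1 <= 1 - r * kappa <= c0
}.

End SurfaceOperators.

Section ThinDomain.
Variables (R : realType) (n : nat) (T : R) (S : surface_data R n).
Variables (g0 g1 : 'rV[R]_n * R -> R) (eps : R).
Local Notation E := ('rV[R]_n * R)%type.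

Definition Omega (t : R) : set 'rV[R]_n :=
  [set x | exists y r, [/\ Gam S t y,
    eps * g0 (y, t) < r < eps * g1 (y, t) & x = y + r *: nu S (y, t)]].

Definition QT : set E := slab `]0, T] Omega.
Definition dQT : set E := slab `]0, T] (fun t => boundary (Omega t)).
Definition QTbar : set E := slab `[0, T] (fun t => closure (Omega t)).

(* [G] is the spatial gradient of [rho] in the domain, extended by continuity to
   the lateral boundary, where it enters the boundary condition. *)
Record thin_solution (kd : R) (nueps : E -> 'rV[R]_n) (Veps : E -> R)
    (rho0 : 'rV[R]_n -> R) (feps rho : E -> R) : Prop := ThinSolution {
  thin_continuous : {within QTbar, continuous rho};
  thin_dt : (forall p, QT p -> pt_derivable T rho p) /\
    {within QT, continuous (pt T rho)};
  thin_d2 : forall i j,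
    (forall p, QT p -> pderivable i (pd j rho) p) /\
    {within QT, continuous (pd i (pd j rho))};
  thin_gradient : exists G : E -> 'rV[R]_n,
    [/\ forall i p, QT p -> pderivable i rho p /\ G p 0 i = pd i rho p,
        {within QT `|` dQT, continuous G} &
        forall p, dQT p -> dotv (nueps p) (G p) + kd^-1 * Veps p * rho p = 0];
  thin_pde : forall p, QT p -> pt T rho p - kd * laplacian rho p = feps p;
  thin_init : forall x, Omega 0 x -> rho (x, 0) = rho0 x
}.

End ThinDomain.

Record limit_solution (R : realType) (n : nat) (T : R) (S : surface_data R n)
    (g0 g1 : 'rV[R]_n * R -> R) (kd : R) (eta0 : 'rV[R]_n -> R)
    (f eta : 'rV[R]_n * R -> R) : Prop := LimitSolution {
  limit_continuous : {within STbar T S, continuous eta};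
  limit_C21 : C21 T S eta;
  limit_pde : let g p := g1 p - g0 p in
    forall p, ST T S p ->
      normal_dt T S (fun q => g q * eta q) p
      - g p * VGam S p * meancurv S p * eta p
      - kd * sdiv S (fun q => g q *: sgrad S eta q) p = g p * f p;
  limit_init : forall y, Gam S 0 y -> eta (y, 0) = eta0 y
}.

(* Main.v *)
From HB Require Import structures.
Require Import Defs.
From mathcomp Require Import all_boot all_order all_algebra.
From mathcomp Require Import all_classical all_reals all_analysis.
From mathcomp Require Import ring lra.
Set Implicit Arguments.
Unset Strict Implicit.
Unset Printing Implicit Defensive.
Import Order.TTheory GRing.Theory Num.Theory.
Import numFieldNormedType.Exports.
Local Open Scope classical_set_scope.
Local Open Scope ring_scope.

(** The solution of the thin domain problem is compared with a function built from
the solution [eta] of the limit problem, by means of a maximum principle.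

Write d for the signed distance, w for its time derivative, k for [kd], and
g = g1 - g0; functions on the surface are extended constantly along the normals,
under the same names. The thin domain is the set where e1 = eps g1 - d and
e0 = d - eps g0 ([edge]) are positive, and on its closure d, e0 and e1 are O(eps).
On the part of the lateral boundary where one of them, say e, vanishes, the outer
normal is - grad e / |grad e| and the normal velocity is e_t / |grad e|, so that
the boundary condition reads
- k grad e . grad rho + e_t rho = 0 ([lateral_op]).

The approximate solution ([ansatz]) is
  v = (1 + d w / k) eta + q e0^2 H1 - q e1^2 H0,
  q = 1 / (2 g) ([inv_gap]),   Hi = hi + (gi w^2 / k^2 - (gi)_t / k) eta.
As grad d has length one and is orthogonal to the gradient of every constant
extension, the factor 1 + d w / k makes the boundary condition hold at order one,
and the quadratic terms make it hold at order eps: the term hi cancels the flux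
grad gi . grad eta of order eps, with which it agrees on the surface. Hence
[lateral_op] applied to v is O(eps^2) ([lateral_ansatz]). In the interior the
square of e0 or of e1 has Laplacian 2 up to O(eps), so that the quadratic terms
change the heat operator at order one; by the limit equation divided by g, the
terms of order one add up to f on the surface ([main_term_surface]). Smooth
coefficients vary by O(eps) between a point and its foot on the surface, so the
heat operator of v is f up to O(eps) ([heat_ansatz]). The constants in both
estimates are multiples of the C^{2,1} norms of [eta], h0 and h1: all derivatives
of constant extensions are expressed by surface derivatives through the chain rule
for the foot map ([cext_pd], [cext_laplacian], [cext_pt]), with coefficients that
are smooth on the tube around the surface and bounded because the closed tube is
compact in space-time ([smooth_tube_bounded]).

The maximum principle ([comparison]) is applied to (rho - v) / psi, where
psi = exp (lam t + 1 + d w / k - K e0 e1) is a [barrier]. The term d w / k again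
compensates the order one part of the boundary condition, whose coefficient e_t
has no sign; the term - K e0 e1 has a slope of order eps there, which makes
[lateral_op] of psi at least eps psi ([barrier_lateral]); and a large lam makes
its heat operator at least psi ([barrier_heat]). Thus a boundary residual eps^2
and an interior residual eps both cost only O(eps), and the errors in the initial
value and in the source enter linearly ([main_estimate]).

The geometric facts about the tube come down to two: the normal is constant along
the rays from the surface ([normal_ray]), and the time derivative of d is minus
the normal velocity at the foot ([pt_sd]). *)

(** * Euclidean norm and distance to a set *)

Section EuclideanNorm.
Variables (R : realType) (n : nat).
Implicit Types (u v w x y z : 'rV[R]_n).

Lemma dotvC u v : dotv u v = dotv v u.
Proof. by apply: eq_bigr => i _; rewrite mulrC. Qed.

Lemma dotvDl u v w : dotv (u + v) w = dotv u w + dotv v w.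
Proof.
by rewrite -big_split; apply: eq_bigr => i _; rewrite mxE mulrDl.
Qed.

Lemma dotvZl (a : R) u v : dotv (a *: u) v = a * dotv u v.
Proof. by rewrite mulr_sumr; apply: eq_bigr => i _; rewrite mxE mulrA. Qed.

Lemma dotvNl u v : dotv (- u) v = - dotv u v.
Proof. by rewrite -scaleN1r dotvZl mulN1r. Qed.

Lemma dotvDr u v w : dotv w (u + v) = dotv w u + dotv w v.
Proof. by rewrite dotvC dotvDl !(dotvC _ w). Qed.

Lemma dotvZr (a : R) u v : dotv u (a *: v) = a * dotv u v.
Proof. by rewrite dotvC dotvZl dotvC. Qed.

Lemma dotvNr u v : dotv u (- v) = - dotv u v.
Proof. by rewrite dotvC dotvNl dotvC. Qed.

Lemma dotv_ge0 u : 0 <= dotv u u.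
Proof. by apply: sumr_ge0 => i _; rewrite -expr2 sqr_ge0. Qed.

Lemma enorm_ge0 u : 0 <= enorm u.
Proof. exact: sqrtr_ge0. Qed.

Lemma enorm_sqr u : enorm u ^+ 2 = dotv u u.
Proof. by rewrite sqr_sqrtr ?dotv_ge0. Qed.

Lemma enormZ (a : R) u : enorm (a *: u) = `|a| * enorm u.
Proof.
rewrite /enorm dotvZl dotvZr mulrA -expr2 sqrtrM ?sqr_ge0 //.
by rewrite sqrtr_sqr.
Qed.

Lemma enormN u : enorm (- u) = enorm u.
Proof. by rewrite -scaleN1r enormZ normrN normr1 mul1r. Qed.

Lemma normr_coord_le_enorm u i : `|u 0 i| <= enorm u.
Proof.
rewrite -(@ler_pXn2r _ 2) ?nnegrE ?enorm_ge0 // enorm_sqr real_normK ?num_real //.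
rewrite /dotv (bigD1 i) //= -expr2 lerDl.
by apply: sumr_ge0 => j _; rewrite -expr2 sqr_ge0.
Qed.

Lemma enorm0 : enorm (0 : 'rV[R]_n) = 0.
Proof. by rewrite -(scale0r (0 : 'rV[R]_n)) enormZ normr0 mul0r. Qed.

Lemma enorm_eq0 u : (enorm u == 0) = (u == 0).
Proof.
apply/eqP/eqP => [u0|->]; last exact: enorm0.
apply/rowP => i; rewrite mxE; apply/eqP; rewrite -normr_eq0.
by rewrite eq_le normr_ge0 andbT -u0 normr_coord_le_enorm.
Qed.

Lemma dotv_le_enorm u v : dotv u v <= enorm u * enorm v.
Proof.
have [->|v0] := eqVneq v 0.
  by rewrite enorm0 mulr0 /dotv big1 // => i _; rewrite mxE mulr0.
have s0 : 0 < dotv v v.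
  by rewrite lt_neqAle dotv_ge0 andbT eq_sym -enorm_sqr sqrf_eq0 enorm_eq0.
set s := dotv v v in s0 *; set r := dotv u v.
have := dotv_ge0 (s *: u - r *: v).
rewrite !(dotvDl, dotvDr, dotvNl, dotvNr, dotvZl, dotvZr) (dotvC v u) -/r -/s => h.
have {}h : 0 <= s * (s * dotv u u - r ^+ 2) by apply: le_trans h _; lra.
have {}h : r ^+ 2 <= s * dotv u u by rewrite -subr_ge0 -(pmulr_rge0 _ s0).
rewrite /enorm -sqrtrM ?dotv_ge0 // mulrC -/s.
by apply: le_trans (ler_norm r) _; rewrite -sqrtr_sqr ler_wsqrtr.
Qed.

Lemma enormD u v : enorm (u + v) <= enorm u + enorm v.
Proof.
rewrite -(@ler_pXn2r _ 2) ?nnegrE ?addr_ge0 ?enorm_ge0 // enorm_sqr sqrrD !enorm_sqr.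
rewrite dotvDl !dotvDr (dotvC v u).
by have := dotv_le_enorm u v; lra.
Qed.

Lemma enormB_trans z x y : enorm (x - y) <= enorm (x - z) + enorm (z - y).
Proof.
by apply: le_trans (enormD _ _); rewrite addrA subrK.
Qed.

Lemma enormBC x y : enorm (x - y) = enorm (y - x).
Proof. by rewrite -enormN opprB. Qed.

Lemma coord_le_norm u i : `|u 0 i| <= `|u|.
Proof.
rewrite [X in _ <= X]/Num.Def.normr /= mx_normrE.
exact: (le_bigmax _ (fun ij => `|u ij.1 ij.2|) (0, i)).
Qed.

Lemma enorm_le_norm u : enorm u <= n.+1%:R * `|u|.
Proof.
rewrite -(@ler_pXn2r _ 2) ?nnegrE ?mulr_ge0 ?enorm_ge0 // enorm_sqr.
apply: (@le_trans _ _ (\sum_(i < n) `|u| ^+ 2)).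
  apply: ler_sum => i _; rewrite -expr2 -real_normK ?num_real //.
  by rewrite ler_pXn2r ?nnegrE // coord_le_norm.
rewrite sumr_const card_ord exprMn -[X in X <= _]mulr_natl ler_wpM2r ?sqr_ge0 //.
by rewrite -natrX ler_nat expnS expn1 (leq_trans (leqnSn n)) // leq_pmulr.
Qed.

Lemma enorm_near (x : 'rV[R]_n) (e : R) : 0 < e -> \forall y \near x, enorm (y - x) < e.
Proof.
move=> e0; have c0 : 0 < n.+1%:R :> R by rewrite ltr0n.
have : \forall y \near x, `|x - y| < e / n.+1%:R.
  by apply: (@cvgr_dist_lt _ _ _ (nbhs x)); [exact: cvg_id| rewrite divr_gt0].
apply: filterS => y; rewrite ltr_pdivlMr // mulrC distrC.
exact: le_lt_trans (enorm_le_norm _).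
Qed.

Lemma dist_to_le (A : set 'rV[R]_n) x y : A y -> dist_to A x <= enorm (x - y).
Proof.
move=> Ay; apply: ge_inf; last by exists y.
by exists 0 => _ [z _ <-]; exact: enorm_ge0.
Qed.

Lemma dist_to_ge (A : set 'rV[R]_n) x (c : R) : A !=set0 ->
  (forall y, A y -> c <= enorm (x - y)) -> c <= dist_to A x.
Proof.
move=> [y Ay] h; apply: lb_le_inf; first by exists (enorm (x - y)), y.
by move=> _ [z Az <-]; exact: h.
Qed.

Lemma dist_to_ge0 (A : set 'rV[R]_n) x : A !=set0 -> 0 <= dist_to A x.
Proof. by move=> A0; apply: dist_to_ge => // y _; exact: enorm_ge0. Qed.

Lemma dist_to_trans (A : set 'rV[R]_n) x z : A !=set0 ->
  dist_to A x <= enorm (x - z) + dist_to A z.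
Proof.
move=> A0; rewrite -lerBlDl; apply: dist_to_ge => // y Ay.
rewrite lerBlDl; apply: le_trans (dist_to_le _ Ay) _.
exact: enormB_trans.
Qed.

Lemma normr_sdist (A : set 'rV[R]_n) x : A !=set0 -> `|sdist A x| = dist_to A x.
Proof.
move=> A0; have d0 := dist_to_ge0 x A0; rewrite /sdist.
by case: asboolP => _; rewrite ?(normrN (dist_to A x)) (ger0_norm d0).
Qed.

End EuclideanNorm.

(** * One-sided difference quotients and time derivatives *)

(** Also for filters along which the function diverges: both sides are then the
default value, which is 0. Hence derivatives commute with negation unconditionally. *)
Lemma limN (R : realType) (T : Type) (F : set_system T) {FF : ProperFilter F} (f : T -> R) :
  lim (- f x @[x --> F]) = - lim (f x @[x --> F]).
Proof.
have [c|nc] := pselect (cvg (f x @[x --> F])).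
  exact (cvg_lim (@norm_hausdorff _ _) (cvgN c)).
have nc' : ~ cvg (- f x @[x --> F]).
  move=> c; apply: nc; have h := cvgN c _.
  have E : - (fun x => - f x) = f by apply/funext => x; exact: opprK.
  rewrite E in h; apply/cvg_ex; exists (- lim (- f x @[x --> F])); exact (h _).
rewrite (dvgP nc) (dvgP nc').
by rewrite -[LHS]/(0 : R) oppr0.
Qed.

Section DifferenceQuotients.
Variables (R : realType).

Lemma cvg_of_quot (V : normedModType R) (c : R -> V) (F : set_system R)
    {FF : Filter F} (t : R) (l : V) :
  s @[s --> F] --> t -> (s - t)^-1 *: (c s - c t) @[s --> F] --> l ->
  c s @[s --> F] --> c t.
Proof.
move=> Ft cl.
have -> : c = fun s => c t + (s - t) *: ((s - t)^-1 *: (c s - c t)).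
  apply/funext => s; have [->|st] := eqVneq s t; first by rewrite !subrr scale0r addr0.
  by rewrite scalerA mulfV ?subr_eq0 // scale1r addrC subrK.
rewrite [X in _ --> X]/= subrr scale0r addr0.
rewrite -[X in _ --> X](addr0 (c t)).
apply: cvgD; first exact: cvg_cst.
rewrite -[X in _ --> X](scale0r l); apply: cvgZ => //.
rewrite -(subrr t); apply: cvgB => //; exact: cvg_cst.
Qed.

(** The chain rule for difference quotients along an arbitrary filter: it serves at
once for two-sided derivatives and for those taken within a time interval. *)
Lemma quot_chain (V W : normedModType R) (G : V -> W) (c : R -> V)
    (F : set_system R) {FF : Filter F} (t : R) (l : V) :
  s @[s --> F] --> t -> differentiable G (c t) ->
  (s - t)^-1 *: (c s - c t) @[s --> F] --> l ->
  (s - t)^-1 *: (G (c s) - G (c t)) @[s --> F] --> 'd G (c t) l.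
Proof.
move=> Ft dG cl.
have cc : c s @[s --> F] --> c t by exact: cvg_of_quot Ft cl.
have dGc := diff_continuous dG.
have := diff_locally dG; set k := 'o_ _ _ => Gk.
have GE s : G (c s) - G (c t) = 'd G (c t) (c s - c t) + k (c s - c t).
  have := congr1 (@^~ (c s - c t)) Gk; rewrite /= subrK => ->.
  rewrite -[X in X - _]/(G (c t) + 'd G (c t) (c s - c t) + k (c s - c t)).
  by rewrite addrC !addrA addNr add0r.
have -> : (fun s => (s - t)^-1 *: (G (c s) - G (c t))) =
   fun s => 'd G (c t) ((s - t)^-1 *: (c s - c t)) + (s - t)^-1 *: k (c s - c t).
  by apply/funext => s; rewrite GE scalerDr linearZ.
rewrite -[X in _ --> X]addr0; apply: cvgD.
  exact: (continuous_cvg _ (dGc l) cl).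
apply/cvgr0Pnorm_lt => e e0.
have e'0 : 0 < e / (`|l| + 1) by rewrite divr_gt0 // ltr_wpDl.
have := littleoP [littleo of k] e'0 => hk.
have c0 : c s - c t @[s --> F] --> (0 : V).
  by rewrite -(subrr (c t)); apply: cvgB => //; exact: cvg_cst.
have hk' := c0 _ hk.
have hl : F (fun s => `|(s - t)^-1 *: (c s - c t)| < `|l| + 1).
  have := (cvgr_norm_lt _ cl) (`|l| + 1) ; apply; by rewrite ltrDl.
near=> s; rewrite normrZ.
have h1 : `|k (c s - c t)| <= e / (`|l| + 1) * `|c s - c t| by near: s.
have h2 : `|(s - t)^-1 *: (c s - c t)| < `|l| + 1 by near: s.
apply: (@le_lt_trans _ _ (e / (`|l| + 1) * `|(s - t)^-1 *: (c s - c t)|)).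
  by rewrite normrZ mulrCA ler_wpM2l.
rewrite mulrAC -mulrA gtr_pMr // ltr_pdivrMr ?mul1r // ltr_wpDl //.
Unshelve. all: by end_near. Qed.

End DifferenceQuotients.

Section TimeDerivative.
Variables (R : realType) (T : R).
Hypothesis T0 : 0 < T.
Local Notation tn t := (within `[0, T] t^').

Lemma tn_proper (t : R) : t \in `[0, T] -> ProperFilter (tn t).
Proof.
rewrite in_itv /= => /andP[t0 tT]; apply: Build_ProperFilter_ex => A.
rewrite /within /= => -[e /= e0 hA].
have [tlt|tge] := ltP t T.
  pose s := t + Num.min (e / 2) (T - t).
  have m0 : 0 < Num.min (e / 2) (T - t) by rewrite lt_min divr_gt0 // subr_gt0.
  exists s; apply: hA.
  - rewrite /ball /= /s opprD addNKr normrN gtr0_norm //.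
    by apply: (@le_lt_trans _ _ (e / 2)); [rewrite ge_min lexx|lra].
  - by rewrite /s gt_eqF // ltrDl.
  - rewrite /= in_itv /=; apply/andP; split; first by rewrite /s; lra.
    rewrite /s -lerBrDl; by rewrite ge_min lexx orbT.
have tE : t = T by apply/eqP; rewrite eq_le tT tge.
pose s := T - Num.min (e / 2) T.
have m0 : 0 < Num.min (e / 2) T by rewrite lt_min divr_gt0.
exists s; apply: hA.
- rewrite /ball /= /s tE opprB addrC subrK gtr0_norm //.
  by apply: (@le_lt_trans _ _ (e / 2)); [rewrite ge_min lexx|lra].
- by rewrite /s tE lt_eqF // ltrBlDr ltrDl.
- rewrite /= in_itv /=; apply/andP; split; last by rewrite /s; lra.
  by rewrite /s subr_ge0 ge_min lexx orbT.
Qed.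

Lemma tn_filter (t : R) : Filter (tn t).
Proof. exact: within_filter. Qed.

Lemma tn_cvg (t : R) : s @[s --> tn t] --> t.
Proof.
move=> A hA; apply: cvg_within; exact: (nbhs_dnbhs hA).
Qed.

Lemma tn_itv (t : R) : \forall s \near tn t, s \in `[0, T].
Proof. by rewrite near_withinE; near=> s. Unshelve. all: by end_near. Qed.

Section Rules.
Variables (W : normedModType R).
Implicit Types (f g : R -> W).

Lemma is_tderive_tderivable f t l : is_tderive T f t l -> tderivable T f t.
Proof. by move=> h; apply/cvg_ex; exists l. Qed.

Lemma is_tderiveE f t l : t \in `[0, T] -> is_tderive T f t l -> tderive T f t = l.
Proof.
move=> tT h; have := tn_proper tT => ?; exact: cvg_lim.
Qed.

Lemma tderivableP f t : t \in `[0, T] -> tderivable T f t ->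
  is_tderive T f t (tderive T f t).
Proof. by move=> tT /cvg_ex[l fl]; rewrite (is_tderiveE tT fl). Qed.

Lemma is_tderive_unique f t l l' : t \in `[0, T] ->
  is_tderive T f t l -> is_tderive T f t l' -> l = l'.
Proof. by move=> tT h h'; rewrite -(is_tderiveE tT h) (is_tderiveE tT h'). Qed.

Lemma is_tderive_cvg f t l : is_tderive T f t l -> f s @[s --> tn t] --> f t.
Proof.
by move=> h; have := @cvg_of_quot R W f (tn t) (tn_filter t) t l (@tn_cvg t) h.
Qed.

Lemma is_tderive_near f g t l : f t = g t ->
  (\forall s \near tn t, f s = g s) -> is_tderive T f t l -> is_tderive T g t l.
Proof.
move=> fgt fg; apply: cvg_trans; apply: near_eq_cvg.
by apply: filterS fg => s fgs; rewrite /tquot fgs fgt.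
Qed.

Lemma is_tderive_cst (a : W) t : is_tderive T (fun=> a) t 0.
Proof.
rewrite /is_tderive /tquot; under eq_fun do rewrite subrr scaler0.
exact: cvg_cst.
Qed.

Lemma is_tderiveD f g t l l' : is_tderive T f t l -> is_tderive T g t l' ->
  is_tderive T (fun s => f s + g s) t (l + l').
Proof.
move=> h h'; rewrite /is_tderive /tquot.
under eq_fun do rewrite opprD addrACA scalerDr.
exact: cvgD h h'.
Qed.

Lemma is_tderive_sum (I : Type) (r : seq I) (f : I -> R -> W) t (l : I -> W) :
  (forall i, is_tderive T (f i) t (l i)) ->
  is_tderive T (fun s => \sum_(i <- r) f i s) t (\sum_(i <- r) l i).
Proof.
move=> h; elim: r => [|i r IH].
  rewrite big_nil; under [X in is_tderive _ X]eq_fun do rewrite big_nil.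
  exact: is_tderive_cst.
rewrite big_cons; under [X in is_tderive _ X]eq_fun do rewrite big_cons.
exact: is_tderiveD.
Qed.

Lemma is_tderive_chain (V : normedModType R) (G : V -> W) (c : R -> V) t l :
  differentiable G (c t) -> is_tderive T c t l ->
  is_tderive T (fun s => G (c s)) t ('d G (c t) l).
Proof.
move=> dG h.
by have := @quot_chain R V W G c (tn t) (tn_filter t) t l (@tn_cvg t) dG h.
Qed.

Lemma is_tderive_id t : is_tderive T (fun s : R => s) t (1 : R).
Proof.
have FF := tn_filter t; apply: cvg_near_cst; rewrite near_withinE.
apply: filterS (@nbhs_dnbhs_neq _ t) => s st _.
by rewrite /tquot /GRing.scale /= mulVf // subr_eq0.
Qed.

Lemma is_tderive_graph f t l : is_tderive T f t l ->
  is_tderive T (fun s => (f s, s)) t (l, 1 : R).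
Proof.
move=> h; have FF := tn_filter t.
have := cvg_pair h (is_tderive_id t); exact.
Qed.

End Rules.

Lemma is_tderiveM (f g : R -> R) t (l l' : R) :
  is_tderive T f t l -> is_tderive T g t l' ->
  is_tderive T (fun s => f s * g s) t (l * g t + f t * l').
Proof.
move=> h h'; have := is_tderive_cvg h' => gc; rewrite /is_tderive.
have -> : tquot (fun s => f s * g s) t =
    fun s => tquot f t s * g s + f t * tquot g t s.
  apply/funext => s; rewrite /tquot /GRing.scale /=; ring.
apply: cvgD; first exact: cvgM.
by apply: cvgM => //; exact: cvg_cst.
Qed.

Lemma is_tderiveZ (f : R -> R) (a : R) t (l : R) :
  is_tderive T f t l -> is_tderive T (fun s => a * f s) t (a * l).
Proof.
move=> h; have := is_tderiveM (is_tderive_cst a t) h.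
by rewrite mul0r add0r.
Qed.

(** At a maximum in time only the quotients from the past are available when the
time is the final one; they already give the sign. *)
Lemma is_tderive_ge0 (f : R -> R) t (l : R) : t \in `]0, T] ->
  is_tderive T f t l ->
  (\forall s \near t, s \in `[0, T] -> f s <= f t) -> 0 <= l.
Proof.
rewrite in_itv /= => /andP[t0 tT] h fmax; rewrite leNgt; apply/negP => l0.
have := cvgr_lt l h => /(_ (tn_filter t) 0 l0); rewrite near_withinE => hlt.
have [e /= e0 he] : \forall s \near t, s != t -> s \in `[0, T] -> tquot f t s < 0 /\ f s <= f t.
  near=> s; move=> st sT; split; last by move: sT; near: s.
  by move: st sT; near: s; exact: hlt.
pose s := t - Num.min (e / 2) t.
have m0 : 0 < Num.min (e / 2) t by rewrite lt_min divr_gt0.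
have mt : Num.min (e / 2) t <= t by rewrite ge_min lexx orbT.
have st : s < t by rewrite /s; lra.
have [|||] := he s.
- rewrite /ball /= /s opprB addrC subrK gtr0_norm //.
  by apply: (@le_lt_trans _ _ (e / 2)); [rewrite ge_min lexx|lra].
- by rewrite lt_eqF.
- by rewrite in_itv /=; apply/andP; split; rewrite /s; lra.
rewrite /tquot /GRing.scale /= => h1 h2; move: h1.
rewrite ltNge; apply/negP; rewrite negbK.
by rewrite mulr_le0 ?invr_le0 ?subr_le0 // ltW.
Unshelve. all: by end_near. Qed.

Lemma is_tderive_mxP (n : nat) (c : R -> 'rV[R]_n) t (l : 'rV[R]_n) :
  is_tderive T c t l <-> forall i, is_tderive T (fun s => c s 0 i) t (l 0 i).
Proof.
split=> [h i|h].
  rewrite /is_tderive /tquot.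
  have -> : (fun s => (s - t)^-1 *: (c s 0 i - c t 0 i)) =
    fun s => ((s - t)^-1 *: (c s - c t)) 0 i.
    by apply/funext => s; rewrite !mxE.
  exact: (continuous_cvg _ (@coord_continuous _ _ _ 0 i l) h).
apply/cvgrPdist_lt => e e0.
have : \forall s \near tn t, forall i, `|l 0 i - tquot (fun s => c s 0 i) t s| < e / 2.
  have := tn_filter t => FF; apply: filter_forall => i.
  by have /cvgrPdist_lt := h i; apply; rewrite divr_gt0.
apply: filterS => s hs.
rewrite (@le_lt_trans _ _ (e / 2)) //; last by lra.
rewrite [X in X <= _]/Num.Def.normr /= mx_normrE.
apply/bigmax_leP; split=> [|[i j] _ /=]; first lra.
have := hs j; rewrite (ord1 i) /tquot !mxE => /ltW; exact.
Qed.
End TimeDerivative.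

(** * Gradients and partial derivatives *)

Section Gradient.
Variables (R : realType) (n : nat).
Implicit Types (f g : 'rV[R]_n -> R) (x v : 'rV[R]_n).

Lemma diff_dotv_grad f x v : differentiable f x -> 'd f x v = dotv v (grad f x).
Proof.
move=> df; rewrite {1}(row_sum_delta v) linear_sum; apply: eq_bigr => i _.
by rewrite linearZ /= mxE deriveE.
Qed.

Lemma differentiable_rV (V : normedModType R) (h : V -> 'rV[R]_n) (x : V) :
  (forall i, differentiable (fun y => h y 0 i) x) -> differentiable h x.
Proof.
move=> dh.
have -> : h = \sum_(i < n) (fun y => h y 0 i *: (delta_mx 0 i : 'rV[R]_n)).
  by apply/funext => y; rewrite fct_sumE -row_sum_delta.
by apply: differentiable_sum => i; apply: differentiableZl.
Qed.

Lemma is_derive_line f x v (s : R) : differentiable f (x + s *: v) ->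
  is_derive s 1 (fun r => f (x + r *: v)) (dotv v (grad f (x + s *: v))).
Proof.
move=> df; set c := fun r : R => x + r *: v.
have dc : is_diff s c ( *:%R ^~ v).
  have -> : *:%R ^~ v = 0 + ( *:%R ^~ v) :> (R -> _) by rewrite add0r.
  exact: is_diffD.
have dfc : is_diff s (f \o c) ('d f (c s) \o ( *:%R ^~ v)).
  by apply: is_diff_comp; exact: differentiableP.
apply: DeriveDef; first exact: diff_derivable.
by rewrite deriveE // diff_val /= scale1r diff_dotv_grad.
Qed.

Lemma differentiable_line_continuous f x v (s : R) : differentiable f (x + s *: v) ->
  {for s, continuous (fun r : R => f (x + r *: v))}.
Proof.
move=> df; apply: differentiable_continuous; apply/derivable1_diffP.
by case: (is_derive_line df).
Qed.

Lemma MVT_line f x v : (forall s, s \in `[0, 1] -> differentiable f (x + s *: v)) ->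
  exists2 s, s \in `[(0:R), 1] & f (x + v) - f x = dotv v (grad f (x + s *: v)).
Proof.
move=> df.
have := @MVT_segment R (fun r => f (x + r *: v))
    (fun r => dotv v (grad f (x + r *: v))) 0 1 ler01.
case=> [s s01||s s01].
- apply: is_derive_line; apply: df; exact: subset_itv_oo_cc s01.
- apply: continuous_in_subspaceT => s; rewrite inE /= => s01.
  exact: differentiable_line_continuous (df _ s01).
by rewrite scale1r scale0r addr0 subr0 mulr1 => ->; exists s.
Qed.

Lemma differentiable_lineE (V : normedModType R) f (h : V -> 'rV[R]_n) (x v : V) :
  differentiable f (h x) -> differentiable h x ->
  'D_v (f \o h) x = \sum_j 'D_v (fun y => h y 0 j) x * grad f (h x) 0 j.
Proof.
move=> df dh; have dfh := differentiable_comp dh df.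
rewrite deriveE // diff_comp //= diff_dotv_grad //; apply: eq_bigr => j _.
congr (_ * _).
have dhj : derivable h x v by exact: diff_derivable.
by rewrite -deriveE // derive_mx // mxE.
Qed.

Lemma gradD f g x : differentiable f x -> differentiable g x ->
  grad (fun y => f y + g y) x = grad f x + grad g x.
Proof.
move=> df dg; apply/rowP => i; rewrite !mxE.
by rewrite -[LHS]/('D_(delta_mx 0 i) (f + g) x) deriveD //; exact: diff_derivable.
Qed.

Lemma gradM f g x : differentiable f x -> differentiable g x ->
  grad (fun y => f y * g y) x = f x *: grad g x + g x *: grad f x.
Proof.
move=> df dg; apply/rowP => i; rewrite !mxE.
by rewrite -[LHS]/('D_(delta_mx 0 i) (f * g) x) deriveM //; exact: diff_derivable.
Qed.

Lemma gradC (a : R) x : grad (fun=> a) x = 0.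
Proof. by apply/rowP => i; rewrite !mxE derive_cst. Qed.

Lemma grad_near f g x : (\forall y \near x, f y = g y) -> grad f x = grad g x.
Proof.
move=> fg; apply/rowP => i; rewrite !mxE; have [->|n0] := eqVneq (delta_mx 0 i) (0 : 'rV[R]_n).
  by rewrite !derive0.
exact: near_eq_derive.
Qed.

Lemma differentiable_eps (V W : normedModType R) (f : V -> W)
    (L : {linear V -> W}) (x : V) : continuous L ->
  (forall e, 0 < e -> \forall h \near (0 : V),
     `|f (h + x) - f x - L h| <= e * `|h|) -> differentiable f x.
Proof.
move=> Lc h; have fo : f \o shift x = cst (f x) + L +o_ (0 : V) id.
  apply/eqaddoP => e e0; have := h _ e0; apply: filterS => y.
  by rewrite opprD addrA.
have dE := diff_unique Lc fo.
by apply/diff_locallyP; rewrite dE.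
Qed.

Lemma differentiable_near (V W : normedModType R) (f g : V -> W) (x : V) :
  (\forall y \near x, f y = g y) -> differentiable f x -> differentiable g x.
Proof.
move=> fg df; apply: (@differentiable_eps _ _ _ ('d f x)).
  exact: diff_continuous.
move=> e e0; have /eqaddoP/(_ _ e0) := diff_locally df.
have : \forall h \near (0 : V), f (h + x) = g (h + x).
  by move: fg; rewrite (near_shift 0) subr0.
apply: filterS2 => h fgh; rewrite -(nbhs_singleton fg) -fgh.
by rewrite -[X in `|X| <= _]/(f (h + x) - (f x + 'd f x h)) opprD addrA.
Qed.

End Gradient.

Section SpaceTimeGradient.
Variables (R : realType) (n : nat).
Local Notation E := ('rV[R]_n * R)%type.

Lemma diff_space_time (F : E -> R) (p : E) v (a : R) : differentiable F p ->
  'd F p (v, a) = \sum_i v 0 i * 'D_(delta_mx 0 i, 0) F p + a * 'D_(0, 1) F p.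
Proof.
move=> dF.
have -> : (v, a) = \sum_i v 0 i *: ((delta_mx 0 i, 0) : E) + a *: ((0, 1) : E).
  rewrite [RHS]surjective_pairing /=; congr pair.
    rewrite scaler0 addr0 {1}(row_sum_delta v).
    by elim/big_rec2: _ => //= i ? ? _ ->.
  rewrite [a *: 1]mulr1 -[X in X = _]add0r; congr (_ + _).
  by elim/big_rec: _ => //= i ? _ <-; rewrite scaler0 add0r.
rewrite linearD linear_sum linearZ /= deriveE //; congr (_ + _).
by apply: eq_bigr => i _; rewrite linearZ /= deriveE.
Qed.

Lemma diff_slice (F : E -> R) (p : E) : differentiable F p ->
  differentiable (fun x => F (x, p.2)) p.1 /\
  forall i, 'D_(delta_mx 0 i) (fun x => F (x, p.2)) p.1 = 'D_(delta_mx 0 i, 0) F p.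
Proof.
case: p => x t /= dF.
have dc : is_diff x (fun y : 'rV[R]_n => (y, t) : E) (fun v => (v, 0)).
  exact: is_diff_pair.
have dFc : is_diff x (F \o (fun y : 'rV[R]_n => (y, t) : E)) ('d F (x, t) \o (fun v => (v, 0))).
  by apply: is_diff_comp; exact: differentiableP.
case: dFc => dFd dFE; split=> [//|i].
by rewrite deriveE // dFE /= -deriveE.
Qed.

End SpaceTimeGradient.

Section PartialDerivatives.
Variables (R : realType).

Lemma is_derive_restrict (V W : normedModType R) (f : V -> W) (x v : V) (s : R) :
  derivable f (x + s *: v) v ->
  is_derive s 1 (fun r : R => f (x + r *: v)) ('D_v f (x + s *: v)).
Proof.
move=> df.
have E : (fun h : R => h^-1 *: (f (x + (h *: (1 : R) + s) *: v) - f (x + s *: v))) =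
         fun h => h^-1 *: (f (h *: v + (x + s *: v)) - f (x + s *: v)).
  apply/funext => h; congr (_ *: (f _ - _)).
  by rewrite [h%:A]mulr1 scalerDl addrCA.
apply: DeriveDef; last by rewrite /derive E.
by move: df; rewrite /derivable -E.
Qed.

Lemma derive_gt0_right (f : R -> R) (l : R) : is_derive (0 : R) 1 f l ->
  0 < l -> f 0 = 0 -> exists2 r, 0 < r & forall s, 0 < s -> s < r -> 0 < f s.
Proof.
move=> [df dfE] l0 f0.
have hq : s^-1 *: (f (s *: 1 + 0) - f 0) @[s --> 0^'] --> l by rewrite -dfE.
have [r /= r0 hr] : \forall s \near (0 : R), s != 0 ->
    0 < s^-1 *: (f (s *: (1 : R) + 0) - f 0).
  by have := cvgr_gt _ hq => /(_ _ 0 l0).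
exists r => // s s0 sr; have := hr s; rewrite /ball /= sub0r normrN gtr0_norm //.
move=> /(_ sr (lt0r_neq0 s0)); rewrite f0 subr0 addr0 /GRing.scale /= mulr1.
by rewrite pmulr_rgt0 // invr_gt0.
Qed.

(** The first derivative vanishes at the maximum; were the second one positive, the
first one would be positive shortly afterwards and the function would increase. *)
Lemma second_derivative_le0 (V : normedModType R) (h : V -> R) (x e : V) :
  (\forall y \near x, derivable h y e) -> derivable ('D_e h) x e ->
  (\forall y \near x, h y <= h x) -> 'D_e ('D_e h) x <= 0.
Proof.
move=> dh ddh hmax; rewrite leNgt; apply/negP => l0.
have xs : x + s *: e @[s --> (0 : R)] --> x.
  rewrite -[X in _ --> X]addr0 -(scale0r e); apply: cvgD; first exact: cvg_cst.
  by apply: cvgZr_tmp; exact: cvg_id.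
pose f (r : R) := h (x + r *: e); pose f' (r : R) := 'D_e h (x + r *: e).
have [r0 /= r00 hr0] : \forall s \near (0 : R), derivable h (x + s *: e) e /\ f s <= f 0.
  near=> s; split; first by near: s; exact: xs _ dh.
  by rewrite /f scale0r addr0; near: s; exact: xs _ hmax.
have B s : 0 <= s < r0 -> derivable h (x + s *: e) e /\ f s <= f 0.
  move=> /andP[s0 sr]; apply: hr0.
  by rewrite /ball /= sub0r normrN ger0_norm.
have dB s : 0 <= s < r0 -> is_derive s 1 f (f' s).
  by move=> /B [+ _]; exact: is_derive_restrict.
have df' : is_derive (0 : R) 1 f' ('D_e ('D_e h) x).
  rewrite -[X in is_derive _ _ _ ('D_e _ X)]addr0 -(scale0r e).
  by apply: is_derive_restrict; rewrite scale0r addr0.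
have f'0 : f' 0 = 0.
  have := @derive1_at_max R f (- r0) r0 0.
  case.
  - by rewrite ge0_cp // ltW.
  - move=> t /itvP tr.
    have [+ _] : derivable h (x + t *: e) e /\ f t <= f 0.
      by apply: hr0; rewrite /ball /= sub0r normrN ltr_norml !tr.
    by move/is_derive_restrict => [].
  - by rewrite in_itv /= r00 oppr_lt0 r00.
  - move=> t /itvP tr.
    have [] : derivable h (x + t *: e) e /\ f t <= f 0; last by [].
    by apply: hr0; rewrite /ball /= sub0r normrN ltr_norml !tr.
  have [_ <-] : is_derive (0 : R) 1 f (f' 0) by apply: dB; rewrite lexx.
  by [].
have [r1 r10 P] := derive_gt0_right df' l0 f'0.
have [b [b0 br0 br1]] : exists b, [/\ 0 < b, b < r0 & b < r1].
  have m0 : 0 < Num.min r0 r1 by rewrite lt_min r00.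
  exists (Num.min r0 r1 / 2); split; first by rewrite divr_gt0.
    by apply: (@lt_le_trans _ _ (Num.min r0 r1)); [lra|rewrite ge_min lexx].
  by apply: (@lt_le_trans _ _ (Num.min r0 r1)); [lra|rewrite ge_min lexx orbT].
have [c|s|c /itvP cb fb] := @MVT R f f' 0 b b0.
- move=> /itvP cb; apply: dB; rewrite !cb /=.
  by apply: lt_trans br0; rewrite cb.
- move: s; apply: continuous_in_subspaceT => s; rewrite inE /= => /itvP sb.
  apply: differentiable_continuous; apply/derivable1_diffP.
  by have [] : is_derive s 1 f (f' s) by apply: dB; rewrite sb (le_lt_trans _ br0) ?sb.
have /B[_] : 0 <= b < r0 by rewrite ltW.
apply/negP; rewrite -ltNge -subr_gt0 fb subr0 mulr_gt0 //.
by apply: P; rewrite ?cb //; apply: lt_trans br1; rewrite cb.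
Unshelve. all: by end_near. Qed.

Variable n : nat.

Definition dotvr (g v : 'rV[R]_n) : R := dotv v g.

Lemma dotvr_linear g : linear (dotvr g).
Proof. by move=> a u v; rewrite /dotvr dotvDl dotvZl. Qed.

HB.instance Definition _ g := GRing.isLinear.Build R 'rV[R]_n R _ (dotvr g) (dotvr_linear g).

Lemma cvg_sumr (I T : Type) (F : set_system T) {FF : Filter F}
    (W : normedModType R) (r : seq I) (f : I -> T -> W) (l : I -> W) :
  (forall i, f i s @[s --> F] --> l i) ->
  \sum_(i <- r) f i s @[s --> F] --> \sum_(i <- r) l i.
Proof.
move=> h; elim: r => [|i r IH].
  by rewrite big_nil; under eq_fun do rewrite big_nil; exact: cvg_cst.
rewrite big_cons; under eq_fun do rewrite big_cons.
exact: cvgD.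
Qed.

Lemma cvg_dotv (T : Type) (F : set_system T) {FF : Filter F} (u v : T -> 'rV[R]_n) a b :
  u @ F --> a -> v @ F --> b -> dotv (u s) (v s) @[s --> F] --> dotv a b.
Proof.
move=> ua vb; rewrite /dotv; apply: cvg_sumr => i.
by apply: cvgM; apply: (continuous_cvg _ (@coord_continuous _ _ _ 0 i _)).
Qed.

Lemma dotvr_continuous g : continuous (dotvr g).
Proof.
move=> x; apply: (@cvg_dotv _ (nbhs x) _ (fun y => y) (fun=> g) x g).
  exact: cvg_id.
exact: cvg_cst.
Qed.

(** Only the continuity of the gradient at the point itself is available, so the
increment is split coordinate by coordinate and the mean value theorem is applied
to each piece. *)
Lemma differentiable_of_partials (f : 'rV[R]_n -> R) (G : 'rV[R]_n -> 'rV[R]_n) x :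
  (\forall y \near x, forall i, is_derive y (delta_mx 0 i) f (G y 0 i)) ->
  {for x, continuous G} -> differentiable f x.
Proof.
move=> df Gc; apply: (@differentiable_eps _ _ _ _ (dotvr (G x))).
  exact: dotvr_continuous.
move=> e e0; have n0 : 0 < n.+1%:R :> R by rewrite ltr0n.
have e1 : 0 < e / n.+1%:R by rewrite divr_gt0.
have /cvgr_dist_le/(_ _ e1) Gx := Gc.
have /nbhs_ballP[d /= d0 hd] : \forall y \near x, (forall i, is_derive y (delta_mx 0 i) f (G y 0 i))
     /\ `|G x - G y| <= e / n.+1%:R by near=> y; split; near: y.
near=> h; have hle : `|h| < d.
  near: h; apply/nbhs_ballP; exists d => // y.
  by rewrite -ball_normE /ball_ /= sub0r normrN.
pose tr (k : nat) : 'rV[R]_n := \row_i (if (i < k)%N then h 0 i else 0).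
have trS (k : 'I_n) : tr k.+1 = tr k + h 0 k *: delta_mx 0 k.
  apply/rowP => i; rewrite !mxE /= ltnS leq_eqVlt.
  have [->|ik] := eqVneq i k; first by rewrite eqxx ltnn mulr1 add0r.
  by rewrite (negPf (_ : (i : nat) != k)) //= mulr0 addr0.
have step (k : 'I_n) : `|f (x + tr k.+1) - f (x + tr k) - h 0 k * G x 0 k| <= e / n.+1%:R * `|h|.
  have inb s : s \in `[(0:R), 1] -> ball x d (x + tr k + (s * h 0 k) *: delta_mx 0 k).
    rewrite in_itv /= => /andP[s0 s1]; rewrite -ball_normE /ball_ /= -addrA opprD addNKr normrN.
    apply: le_lt_trans hle; rewrite [X in X <= _]/Num.Def.normr /= mx_normrE.
    apply/bigmax_leP; split=> [//|[j i] _ /=]; rewrite (ord1 j) !mxE /=.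
    have [->|ik] := eqVneq i k.
      rewrite ltnn add0r mulr1 normrM ger0_norm //.
      apply: le_trans (coord_le_norm h k); exact: ler_piMl.
    rewrite mulr0 addr0; case: ifP => _; rewrite ?normr0 ?normr_ge0 //.
    exact: coord_le_norm.
  have dphi s : s \in `[(0:R), 1] -> is_derive s 1 (fun r => f (x + tr k + (r * h 0 k) *: delta_mx 0 k))
      (h 0 k * G (x + tr k + (s * h 0 k) *: delta_mx 0 k) 0 k).
    move=> s01; have [/(_ k) [dk dkE] _] := hd _ (inb _ s01).
    have := is_derive_restrict dk; rewrite dkE => dphi.
    have dm : is_derive s 1 (fun r : R => r * h 0 k) (h 0 k).
      by apply: is_derive_eq; rewrite /= scaler0 add0r /GRing.scale /= mulr1.
    rewrite mulrC; exact: (@is_derive1_comp _ (fun r => f (x + tr k + r *: delta_mx 0 k))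
      (fun r => r * h 0 k) s _ _ dphi dm).
  have := @MVT_segment R _ _ 0 1 ler01 (fun s s01 => dphi s (subset_itv_oo_cc s01)).
  case=> [|s s01].
    apply: continuous_in_subspaceT => s; rewrite inE /= => s01.
    by apply: differentiable_continuous; apply/derivable1_diffP; case: (dphi _ s01).
  rewrite mul1r mul0r scale0r addr0 subr0 mulr1 -addrA -trS => ->.
  rewrite -mulrBr normrM mulrC; apply: ler_pM => //; last exact: coord_le_norm.
  have [_] := hd _ (inb _ s01); apply: le_trans; rewrite distrC.
  by have := coord_le_norm (G x - G (x + tr k + (s * h 0 k) *: delta_mx 0 k)) k; rewrite !mxE.
have trn : tr n = h by apply/rowP => i; rewrite mxE ltn_ord.
have tr0 : tr 0%N = 0 by apply/rowP => i; rewrite !mxE.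
have -> : f (h + x) - f x - dotvr (G x) h =
   \sum_(k < n) (f (x + tr k.+1) - f (x + tr k) - h 0 k * G x 0 k).
  rewrite sumrB; congr (_ - _).
  rewrite -(big_mkord xpredT (fun k => f (x + tr k.+1) - f (x + tr k))).
  by rewrite telescope_sumr // trn tr0 addr0 (addrC x).
apply: le_trans (ler_norm_sum _ _ _) _.
apply: (@le_trans _ _ (\sum_(k < n) e / n.+1%:R * `|h|)); first exact: ler_sum.
rewrite sumr_const card_ord -[X in X <= _]mulr_natl mulrA ler_wpM2r //.
rewrite mulrCA ger_pMr // ler_pdivrMr // mul1r ler_nat //.
Unshelve. all: by end_near. Qed.

End PartialDerivatives.

(** * Closure properties of functions of class C^k *)

Section SmoothClosure.
Variables (R : realType).

Section General.
Variables (V W : normedModType R) (U : set V).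
Hypothesis Uo : open U.

Lemma Ck_open_eq k (f g : V -> W) : (forall x, U x -> f x = g x) ->
  Ck_open k U f -> Ck_open k U g.
Proof.
have near_eq (f' g' : V -> W) x : (forall x, U x -> f' x = g' x) -> U x ->
    \forall y \near x, f' y = g' y.
  by move=> fg Ux; apply: filterS (open_nbhs_nbhs (conj Uo Ux)) => y; exact: fg.
elim: k f g => [f g fg fc x Ux|k IH f g fg [df Df]] /=.
  rewrite /prop_for /continuous_at -(fg _ Ux); apply: cvg_trans (fc _ Ux).
  by apply: near_eq_cvg; apply: near_eq.
split=> [x Ux|v].
  by apply: differentiable_near (df _ Ux); exact: near_eq.
apply: IH (Df v) => x Ux; apply: near_eq_derive; exact: near_eq.
Qed.

Lemma Ck_open_pred k (f : V -> W) : Ck_open k.+1 U f -> Ck_open k U f.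
Proof.
elim: k f => [f [df _] x Ux|k IH f [df Df]] /=.
  exact: differentiable_continuous (df _ Ux).
by split=> // v; exact: IH (Df v).
Qed.

Lemma Ck_open_cst k (a : W) : Ck_open k U (fun=> a : W).
Proof.
elim: k a => [a x _|k IH a] /=; first exact: cvg_cst.
split=> // v; apply: Ck_open_eq (IH 0) => x _.
by rewrite derive_cst.
Qed.

Lemma Ck_openD k (f g : V -> W) : Ck_open k U f -> Ck_open k U g ->
  Ck_open k U (fun x => f x + g x).
Proof.
elim: k f g => [f g fc gc x Ux|k IH f g [df Df] [dg Dg]] /=.
  exact: cvgD (fc _ Ux) (gc _ Ux).
split=> [x Ux|v]; first exact: differentiableD (df _ Ux) (dg _ Ux).
apply: Ck_open_eq (IH _ _ (Df v) (Dg v)) => x Ux.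
rewrite -[RHS]/('D_v (f + g) x) deriveD //; apply: diff_derivable.
  exact: df.
exact: dg.
Qed.

Lemma Ck_open_sub k (U' : set V) (f : V -> W) : U' `<=` U -> Ck_open k U f -> Ck_open k U' f.
Proof.
move=> sU; elim: k f => [f fc x /sU/fc //|k IH f [df Df]] /=.
by split=> [x /sU/df //|v]; exact: IH (Df v).
Qed.

End General.

Section RealValued.
Variables (V : normedModType R) (U : set V).
Hypothesis Uo : open U.

Lemma Ck_openM k (f g : V -> R) : Ck_open k U f -> Ck_open k U g ->
  Ck_open k U (fun x => f x * g x).
Proof.
elim: k f g => [f g fc gc x Ux|k IH f g cf cg].
  exact: cvgM (fc _ Ux) (gc _ Ux).
have fk := Ck_open_pred cf; have gk := Ck_open_pred cg.
case: cf cg => [df Df] [dg Dg].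
split=> [x Ux|v]; first exact: differentiableM (df _ Ux) (dg _ Ux).
apply: (@Ck_open_eq _ _ _ Uo) (Ck_openD Uo (IH _ _ fk (Dg v)) (IH _ _ gk (Df v))) => x Ux.
rewrite -[RHS]/('D_v (f * g) x) deriveM //; apply: diff_derivable.
  exact: df.
exact: dg.
Qed.

Lemma Ck_openV k (f : V -> R) : (forall x, U x -> f x != 0) -> Ck_open k U f ->
  Ck_open k U (fun x => (f x)^-1).
Proof.
move=> f0; elim: k => [fc x Ux|k IH cf].
  by apply: cvgV (f0 _ Ux) (fc _ Ux).
have fk := Ck_open_pred cf; case: cf => [df Df].
split=> [x Ux|v]; first exact: differentiableV (df _ Ux) (f0 _ Ux).
apply: (@Ck_open_eq _ _ _ Uo) (Ck_openM (Ck_open_cst Uo k (-1 : R))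
  (Ck_openM (Ck_openM (IH fk) (IH fk)) (Df v))) => x Ux.
rewrite deriveV ?f0 //; last exact/diff_derivable/df.
by rewrite /GRing.scale /= expr2 invfM mulN1r mulNr.
Qed.

Lemma Ck_open_sum k (I : Type) (r : seq I) (f : I -> V -> R) :
  (forall i, Ck_open k U (f i)) -> Ck_open k U (fun x => \sum_(i <- r) f i x).
Proof.
move=> h; elim: r => [|i r IH].
  by under [X in Ck_open _ _ X]eq_fun do rewrite big_nil; exact: Ck_open_cst.
under [X in Ck_open _ _ X]eq_fun do rewrite big_cons.
exact: Ck_openD.
Qed.

Lemma Ck_open_coord n k (h : V -> 'rV[R]_n) i : Ck_open k U h ->
  Ck_open k U (fun x => h x 0 i).
Proof.
elim: k h => [h hc x Ux|k IH h [dh Dh]] /=.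
  exact: (continuous_cvg _ (@coord_continuous _ _ _ 0 i _) (hc _ Ux)).
split=> [x Ux|v].
  apply: (@differentiable_comp _ _ _ _ h (fun M : 'rV[R]_n => M 0 i)); first exact: dh.
  exact: differentiable_coord.
apply: Ck_open_eq (IH _ (Dh v)) => // x Ux.
rewrite derive_mx ?mxE //; exact/diff_derivable/dh.
Qed.

End RealValued.

Section Composition.
Variables (n : nat).
Local Notation E := ('rV[R]_n * R)%type.

Lemma diff_pair_snd (hx : E -> 'rV[R]_n) (p v : E) : differentiable hx p ->
  differentiable (fun q => (hx q, q.2) : E) p /\
  'd (fun q => (hx q, q.2) : E) p v = ('d hx p v, v.2).
Proof.
move=> dh.
have ds : is_diff p (snd : E -> R) snd.
  have sc : continuous (snd : E -> R) by move=> q; exact: cvg_snd.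
  apply: DiffDef; first exact: (@linear_differentiable _ _ _ (snd : {linear E -> R})).
  exact: (@diff_lin _ _ _ (snd : {linear E -> R})).
have dhx := differentiableP dh.
have [d1 d2] : is_diff p (fun q => (hx q, q.2) : E) (fun v => ('d hx p v, v.2)).
  exact: is_diff_pair.
by split; rewrite // d2.
Qed.

Lemma derive_space_time_comp (g : E -> R) (hx : E -> 'rV[R]_n) (p v : E) :
  differentiable g (hx p, p.2) -> differentiable hx p ->
  differentiable (fun q => g (hx q, q.2)) p /\
  'D_v (fun q => g (hx q, q.2)) p =
  \sum_j 'D_v (fun q => hx q 0 j) p * 'D_(delta_mx 0 j, 0) g (hx p, p.2)
    + v.2 * 'D_(0, 1) g (hx p, p.2).
Proof.
move=> dg dh; have [dp dpE] := diff_pair_snd v dh.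
have dc := differentiable_comp dp dg.
split=> //; rewrite -[LHS]/('D_v (g \o (fun q => (hx q, q.2))) p) deriveE //.
rewrite diff_comp //= dpE diff_space_time //; congr (_ + _).
apply: eq_bigr => j _; congr (_ * _).
by rewrite -deriveE // derive_mx ?mxE //; exact: diff_derivable.
Qed.

(** Composition with a map that keeps the time coordinate; this is what smoothness
of constant extensions needs. *)
Lemma Ck_open_comp k (U U' : set E) (g : E -> R) (hx : E -> 'rV[R]_n) :
  open U -> (forall k, Ck_open k U hx) -> (forall p, U p -> U' (hx p, p.2)) ->
  Ck_open k U' g -> Ck_open k U (fun p => g (hx p, p.2)).
Proof.
move=> Uo ch hU; elim: k g => [g gc p Up|k IH g [dg Dg]].
  have [dp _] := diff_pair_snd 0 ((ch 1%N).1 _ Up).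
  exact: (continuous_cvg _ (gc _ (hU _ Up)) (differentiable_continuous dp)).
split=> [p Up|v].
  by have [] := derive_space_time_comp 0 (dg _ (hU _ Up)) ((ch 1%N).1 _ Up).
apply: (@Ck_open_eq _ _ _ Uo _ (fun p =>
  \sum_j 'D_v (fun q => hx q 0 j) p * 'D_(delta_mx 0 j, 0) g (hx p, p.2)
    + v.2 * 'D_(0, 1) g (hx p, p.2))) => [p Up|].
  by have [_ ->] := derive_space_time_comp v (dg _ (hU _ Up)) ((ch 1%N).1 _ Up).
apply: Ck_openD => //; last first.
  by apply: Ck_openM => //; [exact: Ck_open_cst|exact: (IH _ (Dg (0, 1)))].
apply: Ck_open_sum => // j; apply: Ck_openM => //.
  by have [_ ] := Ck_open_coord Uo j (ch k.+1); apply.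
exact: (IH _ (Dg (delta_mx 0 j, 0))).
Qed.

End Composition.

End SmoothClosure.

(** * The tube around the moving surface *)

Lemma cvg_pair_to (I : Type) (U V : topologicalType) (F : set_system I) {FF : Filter F}
    (f : I -> U) (g : I -> V) (a : U) (b : V) :
  f @ F --> a -> g @ F --> b -> (f s, g s) @[s --> F] --> (a, b).
Proof.
move=> fa gb; exact (@cvg_pair I U V F (nbhs a) (nbhs b) _ _ _ f g fa gb).
Qed.

Section Tube.
Variables (R : realType) (n : nat) (T : R).
Hypothesis T0 : 0 < T.
Variable S : surface_data R n.
Hypothesis hS : moving_surface T S.
Local Notation E := ('rV[R]_n * R)%type.
Local Notation tn t := (within `[0, T] t^').
Implicit Types (p q : E) (f : E -> R).

Definition xgrad f p : 'rV[R]_n := grad (fun x => f (x, p.2)) p.1.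

(** The open tube, in which the foot map and the signed distance can be differentiated
in space; at the end points of the time interval time derivatives are one-sided. *)
Definition open_tube : set E := [set p | p.2 \in `[0, T] /\ `|sd S p| < delta S].

Definition normal p : 'rV[R]_n := nu S (foot S p, p.2).

Lemma tn_near (t : R) (P : set R) : (\forall s \near tn t, P s) -> P t ->
  \forall s \near t, s \in `[0, T] -> P s.
Proof.
rewrite near_withinE => h Pt.
have : \forall s \near t, s != t -> s \in `[0, T] -> P s by exact: h.
by apply: filterS => s hs sT; have [->//|st] := eqVneq s t; exact: hs.
Qed.

Lemma Gam_neq0 t : t \in `[0, T] -> Gam S t !=set0.
Proof. by move=> tT; have [] := Gam_closed_connected hS tT. Qed.

Lemma normr_sd p : p.2 \in `[0, T] -> `|sd S p| = dist_to (Gam S p.2) p.1.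
Proof. by move=> tT; rewrite normr_sdist //; exact: Gam_neq0. Qed.

Lemma normr_sd_le p y : p.2 \in `[0, T] -> Gam S p.2 y -> `|sd S p| <= enorm (p.1 - y).
Proof. by move=> tT Gy; rewrite normr_sd //; exact: dist_to_le. Qed.

Lemma open_tube_NTbar p : open_tube p -> NTbar T S p.
Proof.
by case: p => x t [tT /ltW]; rewrite ler_norml => h; split.
Qed.

Lemma NTbar_le p : NTbar T S p -> p.2 \in `[0, T] /\ `|sd S p| <= delta S.
Proof. by case: p => x t [tT]; rewrite /tube /= -ler_norml. Qed.

Lemma foot_spec p : NTbar T S p -> [/\ Gam S p.2 (foot S p),
  p.1 = foot S p + sd S p *: normal p,
  differentiable (fun x => sd S (x, p.2)) p.1 & xgrad (sd S) p = normal p].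
Proof. by move=> hp; have [] := foot_unique hS hp. Qed.

Lemma STbar_foot p : NTbar T S p -> STbar T S (foot S p, p.2).
Proof. by move=> hp; have [? _ _ _] := foot_spec hp; case: hp => tT _; split. Qed.

Lemma enorm_nu p : STbar T S p -> enorm (nu S p) = 1.
Proof. by move=> hp; have [] := nu_outward hS hp. Qed.

Lemma enorm_normal p : NTbar T S p -> enorm (normal p) = 1.
Proof. by move=> hp; apply: enorm_nu; exact: STbar_foot. Qed.

Lemma dotv_normal p : NTbar T S p -> dotv (normal p) (normal p) = 1.
Proof. by move=> hp; rewrite -enorm_sqr enorm_normal // expr1n. Qed.

Lemma STbar_tube p : STbar T S p -> [/\ open_tube p, sd S p = 0 & foot S p = p.1].
Proof.
move=> [tT Gp]; have s0 : sd S p = 0.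
  apply/eqP; rewrite -normr_le0; have := normr_sd_le tT Gp.
  by rewrite subrr enorm0.
have op : open_tube p by split; rewrite // s0 normr0 (delta_gt0 hS).
split=> //; have [_ + _ _] := foot_spec (open_tube_NTbar op).
by rewrite s0 scale0r addr0.
Qed.

Lemma Phinu_Gam Y t : Gam S 0 Y -> t \in `[0, T] -> Gam S t (Phinu S (Y, t)).
Proof. by move=> GY tT; have [[h _ _] _ _] := Phinu_diffeo hS tT; apply: h. Qed.

Lemma labelP p : STbar T S p -> Gam S 0 (label S p) /\ Phinu S (label S p, p.2) = p.1.
Proof.
case=> tT Gp; have [[_ inj surj] _ _] := Phinu_diffeo hS tT.
have /surj [Y GY Yp] := Gp.
have im : p.1 \in [set Phinu S (Y, p.2) | Y in Gam S 0] by rewrite inE; exists Y.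
split; last exact: pinvK im.
by have := surjpinv_image_sub (dflt := fun=> 0) surj; apply; exists p.1.
Qed.

Lemma open_tube_near p : open_tube p ->
  \forall q \near p, q.2 \in `[0, T] -> open_tube q.
Proof.
move=> op; have hp := open_tube_NTbar op; case: (op) => tT sdp.
have [Gy py _ _] := foot_spec hp.
have [GY Yy] := labelP (STbar_foot hp); rewrite /= in Yy GY.
set Y := label S _ in GY Yy.
pose e := (delta S - `|sd S p|) / 2.
have e0 : 0 < e by rewrite divr_gt0 // subr_gt0.
have ode := Phinu_ode hS GY tT.
have hs : \forall s \near p.2, s \in `[0, T] -> enorm (Phinu S (Y, s) - foot S p) < e.
  apply: tn_near; last by rewrite Yy subrr enorm0.
  have := is_tderive_cvg ode; rewrite Yy => cv.
  by have := cv _ (enorm_near (foot S p) e0).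
have hx := enorm_near p.1 e0.
near=> q => qT; split=> //.
apply: (le_lt_trans (normr_sd_le qT (Phinu_Gam GY qT))).
apply: le_lt_trans (enormB_trans p.1 _ _) _.
apply: le_lt_trans (lerD (lexx _) (enormB_trans (foot S p) _ _)) _.
have -> : enorm (p.1 - foot S p) = `|sd S p|.
  by rewrite {1}py addrC addKr enormZ enorm_normal // mulr1.
rewrite (enormBC (foot S p)).
have h1 : enorm (q.1 - p.1) < e.
  by near: q; exact: (cvg_fst (F := nbhs p.1) (G := nbhs p.2) hx).
have h2 : enorm (Phinu S (Y, q.2) - foot S p) < e.
  by move: qT; near: q; exact: (cvg_snd (F := nbhs p.1) (G := nbhs p.2) hs).
by rewrite /e in h1 h2 *; lra.
Unshelve. all: by end_near. Qed.

Lemma near_slice p (P : set E) : p.2 \in `[0, T] ->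
  (\forall q \near p, q.2 \in `[0, T] -> P q) -> \forall x \near p.1, P (x, p.2).
Proof.
move=> pT hP.
have c : (x, p.2) @[x --> p.1] --> p.
  have : (x, p.2) @[x --> p.1] --> (p.1, p.2).
    have FF := nbhs_filter p.1.
    exact (@cvg_pair_to _ _ _ (nbhs p.1) FF id (fun=> p.2) p.1 p.2 cvg_id
      (@cvg_cst _ p.2 _ (nbhs p.1) FF)).
  by rewrite -surjective_pairing.
by apply: (@filterS _ (nbhs p.1) (nbhs_filter _) _ _ _ (c _ hP)) => x; apply.
Qed.

Lemma near_curve p (P : set E) (gamma : R -> 'rV[R]_n) :
  gamma s @[s --> tn p.2] --> p.1 ->
  (\forall q \near p, q.2 \in `[0, T] -> P q) -> \forall s \near tn p.2, P (gamma s, s).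
Proof.
move=> gc hP; have FF := tn_filter T p.2.
have c : (gamma s, s) @[s --> tn p.2] --> p.
  have : (gamma s, s) @[s --> tn p.2] --> (p.1, p.2).
    by apply: cvg_pair_to => //; exact: tn_cvg.
  by rewrite -surjective_pairing.
have := c _ hP; apply: filterS2 (tn_itv T p.2) => s sT; exact.
Qed.

(** * Smooth functions on the tube *)

(** Local smooth extensions are required at all points of the closed tube, where
compactness gives uniform bounds, but have to agree with the function in the open
tube only, where derivatives are taken. *)
Definition smooth_tube f := forall p, NTbar T S p -> exists U (F : E -> R),
  [/\ open_nbhs p U, forall k, Ck_open k U F &
      forall q, open_tube q -> U q -> F q = f q].

(** The open tube is open in every time slice and, relative to the time interval, in
space-time, so the derivatives of the function in space and along curves are those
of the extension. *)
Lemma local_extension f F (U : set E) p : open_tube p -> open_nbhs p U ->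
  differentiable F p -> (forall q, open_tube q -> U q -> F q = f q) ->
  [/\ differentiable (fun x => f (x, p.2)) p.1,
      forall i, pd i f p = 'D_(delta_mx 0 i, 0) F p,
      forall (gamma : R -> 'rV[R]_n) l, gamma p.2 = p.1 -> is_tderive T gamma p.2 l ->
        is_tderive T (fun s => f (gamma s, s)) p.2 ('d F p (l, 1)) &
      pt_derivable T f p /\ pt T f p = 'D_(0, 1) F p].
Proof.
move=> op Up dF Ff; have pT : p.2 \in `[0, T] by case: op.
have nU : \forall q \near p, q.2 \in `[0, T] -> F q = f q.
  have := open_nbhs_nbhs Up.
  by apply: filterS2 (open_tube_near op) => q oq Uq qT; apply: Ff => //; exact: oq.
have [dFs dFi] := diff_slice dF.
have sl := near_slice pT nU.
have chain (gamma : R -> 'rV[R]_n) l : gamma p.2 = p.1 -> is_tderive T gamma p.2 l ->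
    is_tderive T (fun s => f (gamma s, s)) p.2 ('d F p (l, 1)).
  move=> gp gl; have gc := is_tderive_cvg gl; rewrite gp in gc.
  have := is_tderive_graph gl; set c := fun s => (gamma s, s).
  have cp : c p.2 = p by rewrite /c gp -surjective_pairing.
  have dFc : differentiable F (c p.2) by rewrite cp.
  move=> /(is_tderive_chain dFc); rewrite cp; apply: is_tderive_near.
    by rewrite -/(c p.2) cp; have := nbhs_singleton nU; exact.
  exact: near_curve gc nU.
split=> //.
- exact: differentiable_near sl dFs.
- move=> i; rewrite -dFi; apply/esym.
  have := grad_near sl => /rowP/(_ i); by rewrite !mxE.
- have := chain (fun=> p.1) 0 erefl (is_tderive_cst _ _ _) => h.
  split; first exact: is_tderive_tderivable h.
  rewrite /pt (is_tderiveE T0 pT h) diff_space_time // mul1r big1 ?add0r // => i _.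
  by rewrite mxE mul0r.
Qed.

Section SmoothTubeDerivatives.
Variables (f : E -> R).
Hypothesis sf : smooth_tube f.

Lemma smooth_tube_ext p : open_tube p -> exists U F,
  [/\ open_nbhs p U, forall k, Ck_open k U F, differentiable F p &
      forall q, open_tube q -> U q -> F q = f q].
Proof.
move=> op; have [U [F [Up CF Ff]]] := sf (open_tube_NTbar op).
exists U, F; split=> //; have [+ _] := CF 1%N; apply.
exact: nbhs_singleton (open_nbhs_nbhs Up).
Qed.

Lemma smooth_tube_differentiable p : open_tube p -> differentiable (fun x => f (x, p.2)) p.1.
Proof.
move=> op; have [U [F [Up CF dF Ff]]] := smooth_tube_ext op.
by have [] := local_extension op Up dF Ff.
Qed.

Lemma smooth_tube_pt_derivable p : open_tube p -> pt_derivable T f p.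
Proof.
move=> op; have [U [F [Up CF dF Ff]]] := smooth_tube_ext op.
by have [_ _ _ []] := local_extension op Up dF Ff.
Qed.

Lemma smooth_tube_chain p (gamma : R -> 'rV[R]_n) l : open_tube p ->
  gamma p.2 = p.1 -> is_tderive T gamma p.2 l ->
  is_tderive T (fun s => f (gamma s, s)) p.2 (dotv l (xgrad f p) + pt T f p).
Proof.
move=> op gp gl; have [U [F [Up CF dF Ff]]] := smooth_tube_ext op.
have [_ fi /(_ _ _ gp gl) + [_ ft]] := local_extension op Up dF Ff.
rewrite diff_space_time // mul1r -ft; congr (is_tderive _ _ _ (_ + _)).
by apply: eq_bigr => i _; rewrite mxE -fi.
Qed.

Lemma smooth_tube_near p : open_tube p ->
  f q @[q --> within open_tube (nbhs p)] --> f p.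
Proof.
move=> op; have [U [F [Up CF dF Ff]]] := smooth_tube_ext op.
have Upp := nbhs_singleton (open_nbhs_nbhs Up).
have FF : Filter (within open_tube (nbhs p)) by exact: within_filter.
have Fc : F q @[q --> within open_tube (nbhs p)] --> F p.
  by apply: cvg_within_filter; exact: differentiable_continuous dF.
rewrite -(Ff _ op Upp); apply: cvg_trans Fc.
apply: near_eq_cvg; rewrite near_withinE; apply: filterS (open_nbhs_nbhs Up) => q Uq oq.
exact: Ff.
Qed.

Lemma smooth_tube_pd i : smooth_tube (pd i f).
Proof.
move=> p hp; have [U [F [Up CF Ff]]] := sf hp.
exists U, ('D_(delta_mx 0 i, 0) F); split=> //.
  by move=> k; have [_ ] := CF k.+1; apply.
move=> q oq Uq; have Uo : open_nbhs q U by case: Up.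
have [+ _] := CF 1%N => /(_ _ Uq) dF.
by have [_ /(_ i) -> _ _] := local_extension oq Uo dF Ff.
Qed.

Lemma smooth_tube_pt : smooth_tube (pt T f).
Proof.
move=> p hp; have [U [F [Up CF Ff]]] := sf hp.
exists U, ('D_(0, 1) F); split=> //.
  by move=> k; have [_ ] := CF k.+1; apply.
move=> q oq Uq; have Uo : open_nbhs q U by case: Up.
have [+ _] := CF 1%N => /(_ _ Uq) dF.
by have [_ _ _ [_ ->]] := local_extension oq Uo dF Ff.
Qed.

End SmoothTubeDerivatives.

Lemma smooth_tube_eq f g : (forall p, open_tube p -> f p = g p) ->
  smooth_tube f -> smooth_tube g.
Proof.
move=> fg sf p hp; have [U [F [Up CF Ff]]] := sf p hp.
by exists U, F; split=> // q oq Uq; rewrite -fg // Ff.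
Qed.

Lemma smooth_tube_cst a : smooth_tube (fun=> a).
Proof.
move=> p hp; exists setT, (fun=> a); split=> //.
  by split=> //; exact: openT.
by move=> k; apply: Ck_open_cst; exact: openT.
Qed.

Lemma smooth_tube_binary (op : R -> R -> R) f g :
  (forall (U : set E) k F G, open U -> Ck_open k U F -> Ck_open k U G ->
     Ck_open k U (fun q => op (F q) (G q))) ->
  smooth_tube f -> smooth_tube g -> smooth_tube (fun q => op (f q) (g q)).
Proof.
move=> hop sf sg p hp; have [U [F [[Uo Up] CF Ff]]] := sf p hp.
have [V [G [[Vo Vp] CG Gg]]] := sg p hp.
have UVo : open (U `&` V) by exact: openI.
exists (U `&` V), (fun q => op (F q) (G q)); split=> //.
- by move=> k; apply: hop => //; [apply: Ck_open_sub (CF k)|apply: Ck_open_sub (CG k)] => q [].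
- by move=> q oq [Uq Vq]; rewrite Ff // Gg.
Qed.

Lemma smooth_tubeD f g : smooth_tube f -> smooth_tube g -> smooth_tube (fun q => f q + g q).
Proof.
apply: (@smooth_tube_binary (fun a b => a + b)) => U k F G Uo cF cG.
exact (Ck_openD Uo cF cG).
Qed.

Lemma smooth_tubeM f g : smooth_tube f -> smooth_tube g -> smooth_tube (fun q => f q * g q).
Proof.
apply: (@smooth_tube_binary (fun a b => a * b)) => U k F G Uo cF cG.
exact (Ck_openM Uo cF cG).
Qed.

Lemma smooth_tubeZ a f : smooth_tube f -> smooth_tube (fun q => a * f q).
Proof. exact: smooth_tubeM (smooth_tube_cst a). Qed.

Lemma smooth_tube_sum (I : Type) (r : seq I) (f : I -> E -> R) :
  (forall i, smooth_tube (f i)) -> smooth_tube (fun q => \sum_(i <- r) f i q).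
Proof.
move=> h; elim: r => [|i r IH].
  by under [X in smooth_tube X]eq_fun do rewrite big_nil; exact: smooth_tube_cst.
under [X in smooth_tube X]eq_fun do rewrite big_cons.
exact: smooth_tubeD.
Qed.

Lemma smooth_tube_sd : smooth_tube (sd S).
Proof.
move=> p hp; have [U [F [Up CF Ff]]] := sd_smooth hS hp.
by exists U, F; split=> // q oq Uq; apply: Ff => //; exact: open_tube_NTbar.
Qed.

Lemma smooth_tube_foot i : smooth_tube (fun q => foot S q 0 i).
Proof.
move=> p hp; have [U [F [Up CF Ff]]] := foot_smooth hS hp.
exists U, (fun q => F q 0 i); split=> //.
  by move=> k; apply: Ck_open_coord; [case: Up|exact: CF].
by move=> q oq Uq; rewrite Ff //; exact: open_tube_NTbar.
Qed.

Lemma smooth_tube_cext g : smooth_on (STbar T S) g -> smooth_tube (cext S g).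
Proof.
move=> sg p hp; have [U [F [[Uo Up] CF Ff]]] := foot_smooth hS hp.
have hq := STbar_foot hp; have [V [G [[Vo Vq] CG Gg]]] := sg _ hq.
have Fp : F p = foot S p by exact: Ff.
have := differentiable_continuous ((CF 1%N).1 _ Up) => Fc.
have cc : (F q, q.2) @[q --> p] --> (foot S p, p.2).
  by apply: cvg_pair_to; [rewrite -Fp; exact: Fc|exact: cvg_snd].
have : \forall q \near p, V (F q, q.2) by exact: cc (open_nbhs_nbhs (conj Vo Vq)).
move=> /filterI/(_ (open_nbhs_nbhs (conj Uo Up))).
rewrite nbhsE => -[U' [U'o U'p] U'V].
have sU : U' `<=` U by move=> q /U'V [].
exists U', (fun q => G (F q, q.2)); split=> //.
  move=> k; apply: (@Ck_open_comp _ _ _ _ V) => //.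
    by move=> k'; apply: Ck_open_sub (CF k').
  by move=> q /U'V [].
move=> q oq U'q; have hq' := open_tube_NTbar oq.
rewrite (Ff _ hq' (sU _ U'q)) Gg //; first exact: STbar_foot.
by have [] := U'V _ U'q; rewrite (Ff _ hq' (sU _ U'q)).
Qed.

(** * Compactness of the closed tube *)

Lemma nu_normal p : STbar T S p -> nu S p = normal p.
Proof. by move=> /STbar_tube[_ _ fp]; rewrite /normal fp -surjective_pairing. Qed.

Lemma normalE p i : open_tube p -> normal p 0 i = pd i (sd S) p.
Proof.
move=> /open_tube_NTbar/foot_spec[_ _ _ /rowP/(_ i)].
by rewrite mxE.
Qed.

Lemma cvg_rV (I : Type) (F : set_system I) {FF : Filter F} (u : I -> 'rV[R]_n) (l : 'rV[R]_n) :
  (forall i, u s 0 i @[s --> F] --> (l 0 i : R)) -> u @ F --> l.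
Proof.
move=> h; have -> : u = fun s => \sum_(i < n) u s 0 i *: delta_mx 0 i.
  by apply/funext => s; rewrite -row_sum_delta.
rewrite (row_sum_delta l); apply: cvg_sumr => i.
by apply: cvgZr_tmp; exact: h.
Qed.

(** The closed tube in Fermi coordinates; the flow map reduces all times to the
initial surface. *)
Definition tube_map (a : 'rV[R]_n * R * R) : E :=
  (Phi S a.1 + a.2 *: nu S (Phi S a.1, a.1.2), a.1.2).

Definition tube_domain : set ('rV[R]_n * R * R) :=
  (Gam S 0 `*` `[0, T]) `*` `[- delta S, delta S].

Lemma Phi_STbar a : (Gam S 0 `*` `[0, T]) a -> STbar T S (Phi S a, a.2).
Proof.
case: a => Y t [/= GY tT]; split=> //=.
by have [[h _ _] _ _] := Phi_diffeo hS tT; exact: h.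
Qed.

Lemma Phi_open_tube_cvg a : (Gam S 0 `*` `[0, T]) a ->
  (Phi S b, b.2) @[b --> within (Gam S 0 `*` `[0, T]) (nbhs a)] -->
    within open_tube (nbhs (Phi S a, a.2)).
Proof.
move=> ha; set D := Gam S 0 `*` `[0, T].
have FF : Filter (within D (nbhs a)) by exact: within_filter.
have ct : b.2 @[b --> within D (nbhs a)] --> a.2.
  by apply: cvg_within_filter; exact: cvg_snd.
have cP : Phi S b @[b --> within D (nbhs a)] --> Phi S a.
  have [U [F [[Uo Ua] CF FE]]] := Phi_smooth hS ha.
  rewrite -(FE _ ha Ua).
  have : F b @[b --> within D (nbhs a)] --> F a.
    by apply: cvg_within_filter; exact: (CF 0%N).
  apply: cvg_trans; apply: near_eq_cvg; rewrite near_withinE.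
  by apply: filterS (open_nbhs_nbhs (conj Uo Ua)) => b Ub hb; exact: FE.
have := cvg_pair_to cP ct => cq A /cq; rewrite !near_simpl /= !near_withinE.
apply: filterS => b hA hb; apply: hA => //.
by have [] := STbar_tube (Phi_STbar hb).
Qed.

Lemma tube_map_continuous : {within tube_domain, continuous tube_map}.
Proof.
apply/subspace_continuousP => -[a r] [/= ha hr].
set D := within tube_domain _.
have FF : Filter D by exact: within_filter.
have c1 : b.1 @[b --> D] --> within (Gam S 0 `*` `[0, T]) (nbhs a).
  have c : b.1 @[b --> D] --> a by apply: cvg_within_filter; exact: cvg_fst.
  move=> A hA; have := c _ hA; rewrite !near_simpl /= /D !near_withinE.
  by apply: filterS => -[b s] hb hd; apply: hb => //; case: hd.
have c2 : b.2 @[b --> D] --> r by apply: cvg_within_filter; exact: cvg_snd.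
have cq : (Phi S b.1, b.1.2) @[b --> D] --> within open_tube (nbhs (Phi S a, a.2)).
  exact: (cvg_comp _ _ c1 (Phi_open_tube_cvg ha)).
have cq' : (Phi S b.1, b.1.2) @[b --> D] --> (Phi S a, a.2).
  by apply: cvg_trans cq _; exact: cvg_within.
have cP : Phi S b.1 @[b --> D] --> Phi S a.
  exact: (cvg_comp _ _ cq' (cvg_fst (F := nbhs (Phi S a)) (G := nbhs a.2))).
have ct : b.1.2 @[b --> D] --> a.2.
  exact: (cvg_comp _ _ cq' (cvg_snd (F := nbhs (Phi S a)) (G := nbhs a.2))).
have cN : nu S (Phi S b.1, b.1.2) @[b --> D] --> nu S (Phi S a, a.2).
  apply: cvg_rV => i; have [oa _ _] := STbar_tube (Phi_STbar ha).
  rewrite nu_normal ?normalE //; last exact: Phi_STbar.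
  have sm := smooth_tube_near (smooth_tube_pd (smooth_tube_sd) i) oa.
  have := cvg_comp _ _ cq sm; apply: cvg_trans; apply: near_eq_cvg.
  rewrite /D near_withinE; near=> b => -[hb _] /=.
  have [ob _ _] := STbar_tube (Phi_STbar hb).
  rewrite nu_normal ?normalE //; exact: Phi_STbar.
apply: cvg_pair_to => //; apply: cvgD => //; exact: cvgZ.
Unshelve. all: by end_near. Qed.

Lemma NTbarE : NTbar T S = tube_map @` tube_domain.
Proof.
apply/seteqP; split=> [[x t] hp|_ [[[Y t] r] [/= [/= GY tT] hr] <-]].
  have [Gy py _ _] := foot_spec hp; have [tT sdp] := NTbar_le hp.
  have [[_ _ surj] _ _] := Phi_diffeo hS tT.
  have [Y GY Yy] := surj _ Gy; rewrite /= in Yy tT.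
  exists ((Y, t), sd S (x, t)); last by rewrite /tube_map /= Yy; congr pair; rewrite [RHS]py.
  split; first by split.
  by rewrite /= in_itv /= -ler_norml.
have hq := Phi_STbar (conj GY tT : (Gam S 0 `*` `[0, T]) (Y, t)).
split=> //=; rewrite /tube /= -ler_norml.
apply: (@le_trans _ _ `|r|); last by rewrite ler_norml; rewrite /= in_itv in hr.
have := @normr_sd_le (Phi S (Y, t) + r *: nu S (Phi S (Y, t), t), t) (Phi S (Y, t)) tT.
by case: hq => _ /= Gp /(_ Gp) /=; rewrite [X in _ <= enorm X]addrAC subrr add0r enormZ enorm_nu // mulr1.
Qed.

(** A continuous image of a product of compact sets. *)
Lemma NTbar_compact : compact (NTbar T S).
Proof.
rewrite NTbarE; apply: continuous_compact; first exact: tube_map_continuous.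
have [_ cG _] : [/\ Gam S 0 !=set0, compact (Gam S 0) & connected (Gam S 0)].
  by apply: (Gam_closed_connected hS); rewrite in_itv /= lexx ltW.
by apply: compact_setX; [apply: compact_setX => //|]; exact: segment_compact.
Qed.

Lemma smooth_tube_bounded f : smooth_tube f ->
  exists C : R, 0 < C /\ forall p, open_tube p -> `|f p| <= C.
Proof.
move=> sf; have /compact_near_coveringP := NTbar_compact.
move=> /(_ R (+oo%R) (fun (C : R) p => open_tube p -> `|f p| <= C)).
case=> [p hp|M [_ hM]].
  have [U [F [[Uo Up] CF Ff]]] := sf p hp.
  exists ([set q : E | U q /\ `|F q| <= `|F p| + 1], [set C : R | `|F p| + 1 <= C]) => /=.
    split; last by apply: nbhs_pinfty_ge; rewrite num_real.
    apply: filterI; first exact: open_nbhs_nbhs.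
    have /cvgr_norm_le := (CF 0%N : forall x, U x -> {for x, continuous F}) p Up.
    by apply; rewrite ltrDl.
  by move=> [q C] /= [[Uq Fq] CC] oq; rewrite -Ff //; exact: le_trans CC.
exists (`|M| + 1); split; first by rewrite ltr_wpDl.
move=> p op; apply: (hM (`|M| + 1)) (open_tube_NTbar op) op.
by apply: (le_lt_trans (ler_norm M)); rewrite ltrDl.
Qed.

(** * Rays along the normal *)

Lemma unit_dotv_eq (u v : 'rV[R]_n) : dotv u u = 1 -> dotv v v = 1 -> dotv u v = 1 -> u = v.
Proof.
move=> uu vv uv; apply/eqP; rewrite -subr_eq0 -enorm_eq0 -sqrf_eq0 enorm_sqr.
rewrite !(dotvDl, dotvDr, dotvNl, dotvNr) (dotvC v u) uu vv uv.
by apply/eqP; ring.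
Qed.

Lemma right_cst_derive0 (f : R -> R) (l e : R) : is_derive (0 : R) 1 f l -> 0 < e ->
  (forall s, 0 < s -> s < e -> f s = f 0) -> l = 0.
Proof.
move=> dl e0 fc.
have aux (g : R -> R) (m : R) : is_derive (0 : R) 1 g m ->
    (forall s, 0 < s -> s < e -> g s = 0) -> g 0 = 0 -> m <= 0.
  move=> dg gc g0; rewrite leNgt; apply/negP => m0.
  have [r r0 hr] := derive_gt0_right dg m0 g0.
  have h0 : 0 < Num.min r e by rewrite lt_min r0.
  pose s := Num.min r e / 2.
  have s0 : 0 < s by rewrite divr_gt0.
  have sm : s < Num.min r e by rewrite /s; lra.
  have se : s < e by apply: lt_le_trans sm _; rewrite ge_min lexx orbT.
  have sr : s < r by apply: lt_le_trans sm _; rewrite ge_min lexx.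
  by have := hr s s0 sr; rewrite gc // ltxx.
have dc (m : R) : is_derive (0 : R) 1 (fun=> m) 0 by exact: is_derive_cst.
apply/eqP; rewrite eq_le; apply/andP; split.
  apply: (aux (fun s => f s - f 0)); last by rewrite subrr.
    by rewrite -[l]subr0; exact: is_deriveB.
  by move=> s s0 se; rewrite fc // subrr.
rewrite -oppr_le0; apply: (aux (fun s => f 0 - f s)); last by rewrite subrr.
  by rewrite -[- l]add0r; exact: is_deriveB.
by move=> s s0 se; rewrite fc // subrr.
Qed.

(** The function exp (- C s) f(s) is nonincreasing. *)
Lemma gronwall_le0 (f f' : R -> R) (b C : R) : 0 < b ->
  (forall s, s \in `[0, b] -> is_derive s 1 f (f' s)) ->
  (forall s, s \in `[0, b] -> f' s <= C * f s) -> f 0 = 0 -> f b <= 0.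
Proof.
move=> b0 df fC f0.
pose g s := expR (- C * s) * f s.
have dg s : s \in `[0, b] -> is_derive s 1 g (expR (- C * s) * (f' s - C * f s)).
  move=> sb; have d1 := df _ sb.
  have d2 : is_derive s 1 (fun r : R => - C * r) (- C).
    by apply: is_derive_eq; rewrite /GRing.scale /= mulr1.
  have d3 := @is_derive1_comp _ expR (fun r => - C * r) s _ _ (is_derive_expR _) d2.
  have := is_deriveM d3 d1; rewrite /GRing.scale /= => d4.
  by apply: is_derive_eq d4 _; rewrite /=; ring.
have := @MVT R g _ 0 b b0 (fun s sb => dg s (subset_itv_oo_cc sb)).
case=> [|c cb gb].
  apply: continuous_in_subspaceT => s; rewrite inE /= => sb.
  by apply: differentiable_continuous; apply/derivable1_diffP; case: (dg _ sb).
have : g b <= 0.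
  rewrite -[g b]subr0 -[X in g b - X](_ : g 0 = 0); last by rewrite /g f0 mulr0.
  rewrite gb subr0; apply: mulr_le0_ge0; last exact: ltW.
  rewrite pmulr_rle0 ?expR_gt0 // subr_le0.
  exact/fC/subset_itv_oo_cc.
by rewrite pmulr_rle0 ?expR_gt0.
Qed.

Lemma smooth_tube_line f p v : smooth_tube f -> open_tube p ->
  is_derive (0 : R) 1 (fun r => f (p.1 + r *: v, p.2)) (dotv v (xgrad f p)).
Proof.
move=> sf op; have := @is_derive_line _ _ (fun x => f (x, p.2)) p.1 v 0.
rewrite scale0r addr0; apply; exact: smooth_tube_differentiable.
Qed.

Lemma smooth_tube_line_cvg f p v : smooth_tube f -> open_tube p ->
  f (p.1 + s *: v, p.2) @[s --> (0 : R)] --> f p.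
Proof.
move=> sf op; have [+ _] := smooth_tube_line v sf op.
move=> /derivable1_diffP/differentiable_continuous.
rewrite /prop_for /continuous_at scale0r addr0 -surjective_pairing; exact.
Qed.

Lemma near_line p v (P : set E) : p.2 \in `[0, T] ->
  (\forall q \near p, q.2 \in `[0, T] -> P q) ->
  \forall s \near (0 : R), P (p.1 + s *: v, p.2).
Proof.
move=> pT hP.
have c : p.1 + s *: v @[s --> (0 : R)] --> p.1.
  rewrite -[X in _ --> X]addr0 -(scale0r v); apply: cvgD; first exact: cvg_cst.
  by apply: cvgZr_tmp; exact: cvg_id.
exact: c (near_slice pT hP).
Qed.

(** Off the surface the foot point realizes the distance, so that on the segment
towards it the distance decreases at unit rate; a unit vector along which the
signed distance has slope one is its gradient, so the normal stays the same there. *)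
Lemma normal_inward p : open_tube p -> sd S p != 0 ->
  let a := - (Num.sg (sd S p) *: normal p) in
  exists2 e, 0 < e & forall s, 0 < s -> s < e ->
    open_tube (p.1 + s *: a, p.2) /\ normal (p.1 + s *: a, p.2) = normal p.
Proof.
move=> op d0 a; have hp := open_tube_NTbar op; have pT : p.2 \in `[0, T] by case: op.
set d := sd S p in d0 a *; set sg := Num.sg d in a *.
have sg2 : sg * sg = 1 by rewrite -expr2 sqr_sg d0.
have sgd : sg * d = `|d| by rewrite /sg [in RHS]normrEsg.
have sg0 : `|sg| = 1 by rewrite normr_sg d0.
have dpos : 0 < `|d| by rewrite normr_gt0.
have [Gy py _ gy] := foot_spec hp.
have h1 := near_line a pT (open_tube_near op).
have h2 : \forall s \near (0 : R), 0 < sg * sd S (p.1 + s *: a, p.2).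
  have c : sg * sd S (p.1 + s *: a, p.2) @[s --> (0 : R)] --> sg * d.
    apply: cvgM; first exact: cvg_cst.
    exact: smooth_tube_line_cvg smooth_tube_sd op.
  by apply: (cvgr_gt _ c); rewrite sgd.
have [e0 /= e00 he0] : \forall s \near (0 : R),
    open_tube (p.1 + s *: a, p.2) /\ 0 < sg * sd S (p.1 + s *: a, p.2).
  exact: filterI h1 h2.
have {}he0 s : 0 <= s -> s < e0 -> open_tube (p.1 + s *: a, p.2) /\
    0 < sg * sd S (p.1 + s *: a, p.2).
  by move=> s0 se; apply: he0; rewrite /ball /= sub0r normrN ger0_norm.
pose e := Num.min e0 `|d|.
have aE : dotv a a = 1.
  by rewrite /a dotvNl dotvNr opprK dotvZl dotvZr mulrA sg2 mul1r dotv_normal.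
have na : enorm a = 1 by rewrite /enorm aE sqrtr1.
have sdE s : 0 <= s -> s < e -> sd S (p.1 + s *: a, p.2) = sg * (`|d| - s).
  rewrite /e lt_min => s0 /andP[se sd']; have [oz zpos] := he0 _ s0 se.
  set z := (_, _) in oz zpos *.
  have zT : z.2 \in `[0, T] by [].
  have up : `|sd S z| <= `|d| - s.
    apply: le_trans (normr_sd_le zT (Gy : Gam S z.2 _)) _.
    have -> : z.1 - foot S p = (d - s * sg) *: normal p.
      apply/rowP => i; rewrite /z /a /= !mxE.
      have -> : p.1 0 i = foot S p 0 i + d * normal p 0 i by rewrite {1}py !mxE.
      ring.
    rewrite enormZ enorm_normal // mulr1.
    have -> : d - s * sg = sg * (`|d| - s).
      by rewrite mulrBr (mulrC s) -sgd mulrA sg2 mul1r.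
    by rewrite normrM sg0 mul1r ger0_norm // subr_ge0 ltW.
  have lo : `|d| - s <= `|sd S z|.
    rewrite /d !normr_sd // lerBlDl.
    apply: le_trans (dist_to_trans _ z.1 (Gam_neq0 pT)) _.
    by rewrite lerD2r /z /= opprD addNKr enormN enormZ na mulr1 ger0_norm.
  have : `|sd S z| = `|d| - s by apply/eqP; rewrite eq_le up lo.
  by rewrite -[`|sd S z|]mul1r -sg0 -normrM gtr0_norm // => <-; rewrite mulrA sg2 mul1r.
exists e; first by rewrite lt_min e00.
move=> s s0 se; have [oz _] : open_tube (p.1 + s *: a, p.2) /\
    0 < sg * sd S (p.1 + s *: a, p.2).
  by apply: he0; [exact: ltW|apply: lt_le_trans se _; rewrite ge_min lexx].
split=> //; set z := (_, _) in oz *; have hz := open_tube_NTbar oz.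
have d1 := is_derive_line (v := a) (s := s) (smooth_tube_differentiable smooth_tube_sd oz).
have d2 : is_derive s 1 (fun r => sg * (`|d| - r)) (- sg).
  by apply: is_derive_eq; rewrite /GRing.scale /=; ring.
have d3 : is_derive s 1 (fun r => sd S (p.1 + r *: a, p.2)) (- sg).
  apply: near_eq_is_derive d2.
  near=> r; rewrite sdE //; first by apply: ltW; near: r; exact: lt_nbhsr.
  by near: r; exact: lt_nbhsl.
have E : dotv a (normal z) = - sg.
  have [_ _ _ <-] := foot_spec hz.
  by rewrite -(@derive_val _ _ _ _ _ _ _ d3) (@derive_val _ _ _ _ _ _ _ d1).
apply/esym/unit_dotv_eq; [exact: dotv_normal|exact: dotv_normal|].
move: E; rewrite /a dotvNl dotvZl => /oppr_inj.
by rewrite -[RHS]mulr1 => /mulfI; apply; rewrite -normr_eq0 sg0 oner_neq0.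
Unshelve. all: by end_near. Qed.

(** The normal field does not change in its own direction. Off the surface this is
[normal_inward]; on the surface it follows by continuity, since the normal line
leaves the surface. *)
Lemma dotv_normal_xgrad_normal p i : open_tube p ->
  dotv (normal p) (xgrad (pd i (sd S)) p) = 0.
Proof.
have sN := smooth_tube_pd smooth_tube_sd i.
have off q : open_tube q -> sd S q != 0 -> dotv (normal q) (xgrad (pd i (sd S)) q) = 0.
  move=> oq dq; have [e e0 he] := normal_inward oq dq.
  set a := - _ in he; have := right_cst_derive0 (smooth_tube_line a sN oq) e0.
  rewrite scale0r addr0 -surjective_pairing => h.
  have {}h : dotv a (xgrad (pd i (sd S)) q) = 0.
    by apply: h => s s0 se; have [oz Nz] := he s s0 se; rewrite -!normalE ?Nz.
  move: h; rewrite /a dotvNl dotvZl => /eqP; rewrite oppr_eq0 mulf_eq0 sgr_eq0 (negPf dq) /=.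
  by move/eqP.
move=> op; have [d0|d0] := eqVneq (sd S p) 0; last exact: off.
have pT : p.2 \in `[0, T] by case: op.
pose Z q := \sum_j pd j (sd S) q * pd j (pd i (sd S)) q.
have ZE q : open_tube q -> dotv (normal q) (xgrad (pd i (sd S)) q) = Z q.
  by move=> oq; apply: eq_bigr => j _; rewrite normalE // mxE.
have sZ : smooth_tube Z.
  apply: smooth_tube_sum => j; apply: smooth_tubeM; apply: smooth_tube_pd => //.
  exact: smooth_tube_sd.
(* A nonzero value on the surface would persist nearby on the normal line, that is, at
   points off the surface. *)
rewrite ZE //; apply/eqP; apply/negPn/negP => Z0.
have hZ : \forall s \near (0 : R), Z (p.1 + s *: normal p, p.2) != 0.
  exact: cvgr_neq0 (smooth_tube_line_cvg (normal p) sZ op) Z0.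
have ho := near_line (normal p) pT (open_tube_near op).
have [e /= e0 he] : \forall s \near (0 : R), open_tube (p.1 + s *: normal p, p.2) /\
   Z (p.1 + s *: normal p, p.2) != 0 by exact: filterI ho hZ.
have hp := open_tube_NTbar op.
have dl := smooth_tube_line (normal p) smooth_tube_sd op.
have [_ _ _ gy] := foot_spec hp; rewrite gy dotv_normal // in dl.
have [r r0 hr] : exists2 r, 0 < r & forall s, 0 < s -> s < r ->
    0 < sd S (p.1 + s *: normal p, p.2).
  apply: derive_gt0_right dl _ _ => //.
  by rewrite scale0r addr0 -surjective_pairing.
have h0 : 0 < Num.min r e by rewrite lt_min r0.
pose s := Num.min r e / 2.
have s0 : 0 < s by rewrite divr_gt0.
have sm : s < Num.min r e by rewrite /s; lra.
have se : s < e by apply: lt_le_trans sm _; rewrite ge_min lexx orbT.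
have sr : s < r by apply: lt_le_trans sm _; rewrite ge_min lexx.
have [os] : open_tube (p.1 + s *: normal p, p.2) /\ Z (p.1 + s *: normal p, p.2) != 0.
  by apply: he; rewrite /ball /= sub0r normrN gtr0_norm.
by rewrite -ZE // off ?eqxx // gt_eqF // hr.
Qed.

Lemma dotv_sqr_le (u v : 'rV[R]_n) : dotv u v ^+ 2 <= dotv u u * dotv v v.
Proof.
rewrite -!enorm_sqr -exprMn -(@ler_sqrt _ _ (_ ^+ 2)) ?sqr_ge0 //.
rewrite !sqrtr_sqr [X in _ <= X]ger0_norm ?mulr_ge0 ?enorm_ge0 // ler_norml.
by rewrite lerNl -dotvNl -{1}enormN !dotv_le_enorm.
Qed.

Lemma open_tube_ray p r : STbar T S p -> `|r| < delta S ->
  open_tube (p.1 + r *: nu S p, p.2).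
Proof.
move=> hp rd; case: (hp) => pT Gp; split=> //; apply: le_lt_trans rd.
apply: (le_trans (@normr_sd_le (p.1 + r *: nu S p, p.2) p.1 pT Gp)) => /=.
by rewrite addrC addKr enormZ enorm_nu // mulr1.
Qed.

(** The square of the deviation of the normal from its initial value satisfies a
linear differential inequality along the ray, because the normal does not change
in its own direction; by Gronwall it stays zero. *)
Lemma normal_ray p r : STbar T S p -> `|r| < delta S ->
  normal (p.1 + r *: nu S p, p.2) = nu S p.
Proof.
move=> hp rd; pose N i := pd i (sd S).
have sN i : smooth_tube (N i) by apply: smooth_tube_pd; exact: smooth_tube_sd.
pose G q := \sum_i \sum_j pd j (N i) q * pd j (N i) q.
have [C [C0 hC]] : exists C : R, 0 < C /\ forall q, open_tube q -> `|G q| <= C.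
  apply: smooth_tube_bounded; apply: smooth_tube_sum => i; apply: smooth_tube_sum => j.
  by apply: smooth_tubeM; apply: smooth_tube_pd.
pose v := r *: nu S p; pose x (s : R) : E := (p.1 + s *: v, p.2).
have xE s : x s = (p.1 + (s * r) *: nu S p, p.2) by rewrite /x /v scalerA.
have ox (s : R) : s \in `[0, 1] -> open_tube (x s).
  rewrite in_itv /= => /andP[s0 s1]; rewrite xE; apply: open_tube_ray => //.
  by apply: le_lt_trans rd; rewrite normrM ger0_norm // ler_piMl.
pose u s : 'rV[R]_n := normal (x s) - nu S p.
pose f s := \sum_i (N i (x s) - nu S p 0 i) ^+ 2.
pose f' s := \sum_i 2 * (N i (x s) - nu S p 0 i) * dotv v (xgrad (N i) (x s)).
have fE (s : R) : s \in `[0, 1] -> f s = dotv (u s) (u s).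
  by move=> /ox os; apply: eq_bigr => i _; rewrite /u !mxE normalE // expr2.
have df (s : R) : s \in `[0, 1] -> is_derive s 1 f (f' s).
  move=> /ox os; have -> : f = \sum_i (fun s => (N i (x s) - nu S p 0 i) ^+ 2).
    by apply/funext => s'; rewrite fct_sumE.
  apply: is_derive_sum => i.
  have d1 := is_derive_line (v := v) (s := s) (smooth_tube_differentiable (sN i) os).
  have d2 : is_derive s 1 (fun r : R => N i (x r) - nu S p 0 i) (dotv v (xgrad (N i) (x s))).
    by rewrite -[X in is_derive _ _ _ X]subr0; apply: is_deriveB.
  under eq_fun do rewrite expr2.
  apply: is_derive_eq (is_deriveM d2 d2) _.
  by rewrite /GRing.scale /=; ring.
have fC (s : R) : s \in `[0, 1] -> f' s <= (1 + r ^+ 2 * C) * f s.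
  move=> s01; have os := ox _ s01; have := hC _ os.
  have -> : (1 + r ^+ 2 * C) * f s = f s + r ^+ 2 * dotv (u s) (u s) * C by rewrite fE //; ring.
  move=> /(le_trans (ler_norm _)) hG.
  have u0 : 0 <= r ^+ 2 * dotv (u s) (u s) by rewrite mulr_ge0 ?sqr_ge0 ?dotv_ge0.
  apply: le_trans (lerD (lexx _) (ler_wpM2l u0 hG)).
  rewrite /G mulr_sumr -big_split /=; apply: ler_sum => i _.
  have -> : dotv v (xgrad (N i) (x s)) = r * - dotv (u s) (xgrad (N i) (x s)).
    rewrite /u dotvDl dotvNl dotv_normal_xgrad_normal // sub0r opprK.
    by rewrite -dotvZl.
  set a := N i _ - _; set b := dotv _ _.
  have hb : b ^+ 2 <= dotv (u s) (u s) * \sum_j pd j (N i) (x s) * pd j (N i) (x s).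
    apply: le_trans (dotv_sqr_le _ _) _; rewrite ler_wpM2l ?dotv_ge0 //.
    by rewrite le_eqVlt; apply/orP; left; apply/eqP; apply: eq_bigr => j _; rewrite !mxE.
  have := ler_wpM2l (sqr_ge0 r) hb; move: (\sum_j _) => K.
  by have := sqr_ge0 (a + r * b); lra.
have f0 : f 0 = 0.
  have e01 : (0 : R) \in `[0, 1] by rewrite in_itv /= lexx ler01.
  have x0 : x 0 = p by rewrite /x scale0r addr0 -surjective_pairing.
  by rewrite fE // /u x0 nu_normal // subrr /dotv big1 // => i _; rewrite mxE mul0r.
have e11 : (1 : R) \in `[0, 1] by rewrite in_itv /= lexx ler01.
have := gronwall_le0 ltr01 df fC f0; rewrite fE // -enorm_sqr => h.
have : enorm (u 1) ^+ 2 == 0 by rewrite eq_le h sqr_ge0.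
by rewrite sqrf_eq0 enorm_eq0 /u subr_eq0 xE mul1r => /eqP.
Qed.

(** Along the ray the gradient of the signed distance is the direction of the ray. *)
Lemma sd_ray p r : STbar T S p -> `|r| < delta S -> sd S (p.1 + r *: nu S p, p.2) = r.
Proof.
move=> hp rd.
have in_tube (s : R) : s \in `[0, 1] -> `|s * r| < delta S.
  rewrite in_itv /= => /andP[s0 s1].
  by apply: le_lt_trans rd; rewrite normrM ger0_norm // ler_piMl.
have := @MVT_line _ _ (fun x => sd S (x, p.2)) p.1 (r *: nu S p).
case=> [s s01|s s01 /=].
  rewrite scalerA; have os := open_tube_ray hp (in_tube _ s01).
  exact: (smooth_tube_differentiable smooth_tube_sd os).
have os := open_tube_ray hp (in_tube _ s01).
have [_ sp _] := STbar_tube hp; rewrite -surjective_pairing sp subr0 => ->.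
have [_ _ _] := foot_spec (open_tube_NTbar os).
rewrite scalerA /xgrad /= => ->; rewrite normal_ray //; last exact: in_tube.
by rewrite dotvZl -enorm_sqr enorm_nu // expr1n mulr1.
Qed.

Lemma foot_ray p r : STbar T S p -> `|r| < delta S -> foot S (p.1 + r *: nu S p, p.2) = p.1.
Proof.
move=> hp rd; have op := open_tube_ray hp rd.
have [_ + _ _] := foot_spec (open_tube_NTbar op).
by rewrite normal_ray // sd_ray //= => /addIr.
Qed.

Lemma foot_foot p : open_tube p -> foot S (foot S p, p.2) = foot S p.
Proof. by move=> /open_tube_NTbar/STbar_foot/STbar_tube[]. Qed.

Lemma cext_foot zeta p : open_tube p -> cext S zeta (foot S p, p.2) = cext S zeta p.
Proof. by move=> op; rewrite /cext /= foot_foot. Qed.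

Lemma open_tube_foot p : open_tube p -> open_tube (foot S p, p.2).
Proof. by move=> /open_tube_NTbar/STbar_foot/STbar_tube[]. Qed.

Lemma foot_normal_line p : open_tube p ->
  \forall s \near (0 : R), open_tube (p.1 + s *: normal p, p.2) /\
    foot S (p.1 + s *: normal p, p.2) = foot S p.
Proof.
move=> op; case: (op) => pT sdp; have hp := open_tube_NTbar op; have hq := STbar_foot hp.
have h : \forall s \near (0 : R), `|sd S p + s| < delta S.
  have c : sd S p + s @[s --> (0 : R)] --> sd S p + 0.
    by apply: cvgD; [exact: cvg_cst|exact: cvg_id].
  by rewrite addr0 in c; exact: (cvgr_norm_lt _ c).
apply: filterS h => s hs.
have -> : p.1 + s *: normal p = foot S p + (sd S p + s) *: nu S (foot S p, p.2).
  have [_ py _ _] := foot_spec hp.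
  by rewrite {1}py -addrA -scalerDl.
split; first exact: (open_tube_ray hq).
exact: (foot_ray hq).
Qed.

Lemma normal_derive_eq0 f p : open_tube p ->
  (forall q, open_tube q -> f q = f (foot S q, q.2)) ->
  differentiable (fun x => f (x, p.2)) p.1 -> dotv (normal p) (xgrad f p) = 0.
Proof.
move=> op hf df.
have := @is_derive_line _ _ (fun x => f (x, p.2)) p.1 (normal p) 0.
rewrite scale0r addr0 => /(_ df) d1.
have d2 : is_derive (0 : R) 1 (fun r => f (p.1 + r *: normal p, p.2)) 0.
  apply: near_eq_is_derive (is_derive_cst (f p) (0 : R) 1).
  apply: filterS (foot_normal_line op) => s [os fs].
  by rewrite (hf _ os) fs -hf.
by rewrite -[LHS](@derive_val _ _ _ _ _ _ _ d1) (@derive_val _ _ _ _ _ _ _ d2).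
Qed.

(** Differentiate the identity of [sd_ray], sd (q + r nu) = r, in time along a normal
trajectory q: the normal moves orthogonally to itself, and q moves with velocity
[VGam] along the normal. *)
Lemma pt_sd p : open_tube p -> pt T (sd S) p = - VGam S (foot S p, p.2).
Proof.
move=> op; case: (op) => pT rd; have hp := open_tube_NTbar op; have hq := STbar_foot hp.
set r := sd S p in rd; set t := p.2 in pT *; set y := foot S p in hq *.
have [GY Yy] := labelP hq; set Y := label S _ in GY Yy; rewrite /= -/t in Yy.
pose q s := Phinu S (Y, s).
have Sq (s : R) : s \in `[0, T] -> STbar T S (q s, s).
  by move=> sT; split=> //=; exact: Phinu_Gam.
pose V := VGam S (y, t); pose v := nu S (y, t).
have dq : is_tderive T q t (V *: v) by have := Phinu_ode hS GY pT; rewrite Yy.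
have ot : open_tube (y, t) by exact: open_tube_foot.
have sN i : smooth_tube (pd i (sd S)) by apply: smooth_tube_pd; exact: smooth_tube_sd.
pose n' : 'rV[R]_n := \row_i (dotv (V *: v) (xgrad (pd i (sd S)) (y, t)) + pt T (pd i (sd S)) (y, t)).
have dn i : is_tderive T (fun s => pd i (sd S) (q s, s)) t (n' 0 i).
  by rewrite mxE; exact: (smooth_tube_chain (sN i) ot Yy dq).
have nE (s : R) i : s \in `[0, T] -> pd i (sd S) (q s, s) = nu S (q s, s) 0 i.
  by move=> /Sq Ss; have [os _ _] := STbar_tube Ss; rewrite nu_normal // normalE.
have qt : q t = y by [].
have dnu : is_tderive T (fun s => nu S (q s, s)) t n'.
  apply/is_tderive_mxP => i; apply: is_tderive_near (dn i); first exact: nE.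
  by apply: filterS (tn_itv T t) => s; exact: nE.
have n'v : dotv n' v = 0.
  have d1 : is_tderive T (fun s => \sum_i pd i (sd S) (q s, s) * pd i (sd S) (q s, s)) t
      (\sum_i (n' 0 i * v 0 i + v 0 i * n' 0 i)).
    apply: is_tderive_sum => i; have := is_tderiveM (dn i) (dn i).
    by rewrite !nE // qt.
  have d2 : is_tderive T (fun s => \sum_i pd i (sd S) (q s, s) * pd i (sd S) (q s, s)) t 0.
    have one (s : R) : s \in `[0, T] -> 1 = \sum_i pd i (sd S) (q s, s) * pd i (sd S) (q s, s).
      move=> sT; rewrite -[LHS](expr1n _ 2) -(enorm_nu (Sq _ sT)) enorm_sqr.
      by apply: eq_bigr => i _; rewrite !nE.
    apply: is_tderive_near (is_tderive_cst T (1 : R) t); first exact: one.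
    by apply: filterS (tn_itv T t) => s; exact: one.
  have := is_tderive_unique T0 pT d1 d2; rewrite big_split /= => h.
  have {h} : dotv n' v + dotv v n' = 0 by exact: h.
  by rewrite (dotvC v); lra.
pose gam s := q s + r *: nu S (q s, s).
have dgam : is_tderive T gam t (V *: v + r *: n').
  apply: is_tderiveD => //; apply/is_tderive_mxP => i.
  have /is_tderive_mxP/(_ i) di := dnu; rewrite mxE.
  have dri : is_tderive T (fun s => r * nu S (q s, s) 0 i) t (r * n' 0 i).
    exact: is_tderiveZ.
  apply: is_tderive_near dri; first by rewrite mxE.
  by near=> s; rewrite mxE.
have gt : gam t = p.1 by have [_ py _ _] := foot_spec hp; rewrite py /gam qt.
have d3 := smooth_tube_chain smooth_tube_sd op gt dgam.
have d4 : is_tderive T (fun s => sd S (gam s, s)) t 0.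
  have rE (s : R) : s \in `[0, T] -> r = sd S (gam s, s).
    by move=> sT; have := sd_ray (Sq _ sT) rd.
  apply: is_tderive_near (is_tderive_cst T (r : R) t); first exact: rE.
  by apply: filterS (tn_itv T t) => s; exact: rE.
have := is_tderive_unique T0 pT d3 d4.
have [_ _ _ ->] := foot_spec hp.
rewrite dotvDl !dotvZl -[normal p]/v n'v mulr0 addr0.
by rewrite -enorm_sqr (enorm_nu hq) expr1n mulr1 => /eqP; rewrite addrC addr_eq0 => /eqP.
Unshelve. all: by end_near. Qed.

(** * Derivatives of constant extensions *)

(** Derivatives of the solution of the limit problem exist for positive times only. *)
Definition pos_tube : set E := [set p | open_tube p /\ 0 < p.2].

Lemma ST_foot p : pos_tube p -> ST T S (foot S p, p.2).
Proof.
case=> op p0; have [pT Gp] := STbar_foot (open_tube_NTbar op).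
by split=> //; move: pT; rewrite /= !in_itv /= p0 => /andP[_ ->].
Qed.

Lemma ST_STbar p : ST T S p -> STbar T S p.
Proof. by case=> pT Gp; split=> //; move: pT; rewrite /= !in_itv /= => /andP[/ltW -> ->]. Qed.

Lemma ST_pos_tube p : ST T S p -> pos_tube p.
Proof.
move=> hp; have [op _ _] := STbar_tube (ST_STbar hp); split=> //.
by case: hp; rewrite /= in_itv /= => /andP[].
Qed.

Lemma pos_tube_near p : pos_tube p -> \forall q \near p, q.2 \in `[0, T] -> pos_tube q.
Proof.
move=> [op p0].
have h : \forall q \near p, 0 < q.2.
  exact: (cvg_snd (F := nbhs p.1) (G := nbhs p.2) (lt_nbhsr p0)).
by apply: filterS2 (open_tube_near op) h => q oq q0 qT; split=> //; exact: oq.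
Qed.

Definition foot_coord j p : R := foot S p 0 j.

Lemma smooth_foot_coord j : smooth_tube (foot_coord j).
Proof. exact: smooth_tube_foot. Qed.

(** The constant extension has no normal derivative, so the projection in the
definition of the surface derivative has no effect on its gradient. *)
Lemma sD_pd zeta j p : STbar T S p -> sdiff S zeta p -> sD S j zeta p = pd j (cext S zeta) p.
Proof.
move=> hp dz; have [op _ _] := STbar_tube hp.
have N0 : dotv (normal p) (xgrad (cext S zeta) p) = 0.
  by apply: normal_derive_eq0 => // q oq; rewrite -cext_foot.
rewrite /sD (eq_bigr (fun k => (j == k)%:R * pd k (cext S zeta) p
    - nu S p 0 j * (nu S p 0 k * pd k (cext S zeta) p))); last first.
  move=> k _; rewrite /proj !mxE mulrBl; congr (_ - _).
  by rewrite big_ord1 !mxE mulrA.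
rewrite sumrB -mulr_sumr -[X in _ - _ * X](_ : dotv (normal p) (xgrad (cext S zeta) p) = _); last first.
  by rewrite -nu_normal //; apply: eq_bigr => k _; rewrite mxE.
rewrite N0 mulr0 subr0 (bigD1 j) //= eqxx mul1r big1 ?addr0 // => k kj.
by rewrite eq_sym (negPf kj) mul0r.
Qed.

Lemma dotv_nu_sD zeta p : STbar T S p -> sdiff S zeta p ->
  \sum_j nu S p 0 j * sD S j zeta p = 0.
Proof.
move=> hp dz; have [op _ _] := STbar_tube hp.
have N0 : dotv (normal p) (xgrad (cext S zeta) p) = 0.
  by apply: normal_derive_eq0 => // q oq; rewrite -cext_foot.
by rewrite -[RHS]N0 -nu_normal //; apply: eq_bigr => j _; rewrite sD_pd // mxE.
Qed.

Lemma differentiable_foot_slice p : open_tube p ->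
  differentiable (fun x => foot S (x, p.2)) p.1.
Proof.
move=> op; apply: differentiable_rV => i.
exact: (smooth_tube_differentiable (smooth_foot_coord i) op).
Qed.

(** The constant extension is unchanged by replacing a point by its foot, so the
chain rule through the foot map applies. *)
Lemma cext_space zeta p : open_tube p -> sdiff S zeta (foot S p, p.2) ->
  differentiable (fun x => cext S zeta (x, p.2)) p.1 /\
  forall i, pd i (cext S zeta) p =
    \sum_j pd i (foot_coord j) p * cext S (sD S j zeta) p.
Proof.
move=> op dz; have pT : p.2 \in `[0, T] by case: op.
have E1 : \forall x \near p.1, cext S zeta (foot S (x, p.2), p.2) = cext S zeta (x, p.2).
  apply: filterS (near_slice pT (open_tube_near op)) => x ox.
  exact: (cext_foot zeta ox).
have dh := differentiable_foot_slice op.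
have df : differentiable (fun x => cext S zeta (x, p.2)) (foot S (p.1, p.2)).
  by rewrite -surjective_pairing.
split; first exact: differentiable_near E1 (differentiable_comp dh df).
move=> i; have := grad_near E1 => /rowP/(_ i); rewrite !mxE => E2.
rewrite /pd -E2.
have := differentiable_lineE (delta_mx 0 i) df dh; rewrite /= => ->.
apply: eq_bigr => j _; congr (_ * _); rewrite mxE -surjective_pairing.
by rewrite /cext sD_pd //; exact: STbar_foot (open_tube_NTbar op).
Qed.

Lemma cvg_foot p : open_tube p -> foot S q @[q --> within open_tube (nbhs p)] --> foot S p.
Proof.
move=> op; have FF : Filter (within open_tube (nbhs p)) by exact: within_filter.
by apply: cvg_rV => i; exact: (smooth_tube_near (smooth_foot_coord i) op).
Qed.

Lemma cext_near_pos h p : {within ST T S, continuous h} -> pos_tube p ->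
  cext S h q @[q --> within pos_tube (nbhs p)] --> cext S h p.
Proof.
move=> /subspace_continuousP hc pp; have := hc _ (ST_foot pp) => c.
have FF : Filter (within pos_tube (nbhs p)) by exact: within_filter.
have c1 : foot S q @[q --> within pos_tube (nbhs p)] --> foot S p.
  case: (pp) => op _; apply: cvg_trans (cvg_foot op).
  by move=> A; rewrite !near_simpl /= !near_withinE; apply: filterS => q hq [oq _]; exact: hq.
have c2 : q.2 @[q --> within pos_tube (nbhs p)] --> p.2.
  by apply: cvg_within_filter; exact: cvg_snd.
have c3 : (foot S q, q.2) @[q --> within pos_tube (nbhs p)] -->
    within (ST T S) (nbhs (foot S p, p.2)).
  have := cvg_pair_to c1 c2 => cq A /cq; rewrite !near_simpl /= !near_withinE.
  by apply: filterS => q hA pq; apply: hA => //; exact: ST_foot.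
exact: (cvg_comp _ _ c3 c).
Qed.

Lemma cext_STbar zeta p : STbar T S p -> cext S zeta p = zeta p.
Proof. by case: p => x t /STbar_tube[_ _ /= fp]; rewrite /cext fp. Qed.

Section TimeDerivativeOfExtension.
Variable zeta : E -> R.
Hypothesis zt : forall p, ST T S p -> normal_derivable T S zeta p.
Hypothesis zx : forall p, ST T S p -> sdiff S zeta p.
Hypothesis zxc : forall i, {within ST T S, continuous (sD S i zeta)}.

Lemma pd_cext_near j p : pos_tube p ->
  pd j (cext S zeta) q @[q --> within pos_tube (nbhs p)] --> pd j (cext S zeta) p.
Proof.
move=> pp; case: (pp) => op _.
have FF : Filter (within pos_tube (nbhs p)) by exact: within_filter.
have E1 q : pos_tube q -> pd j (cext S zeta) q =
    \sum_k pd j (foot_coord k) q * cext S (sD S k zeta) q.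
  by move=> pq; have [_ ->] := cext_space pq.1 (zx (ST_foot pq)).
rewrite E1 //; have c : \sum_k pd j (foot_coord k) q * cext S (sD S k zeta) q
    @[q --> within pos_tube (nbhs p)] --> \sum_k pd j (foot_coord k) p * cext S (sD S k zeta) p.
  apply: cvg_sumr => k; apply: cvgM; last exact: cext_near_pos.
  apply: cvg_trans (smooth_tube_near (smooth_tube_pd (smooth_foot_coord k) j) op).
  by move=> A; rewrite !near_simpl /= !near_withinE; apply: filterS => q hq [oq _]; exact: hq.
apply: cvg_trans c; apply: near_eq_cvg; rewrite near_withinE.
by near=> q => pq; rewrite E1.
Unshelve. all: by end_near. Qed.

(** Two curves on the moving surface issue from the foot: the foot of the fixed point
and the normal trajectory. Along the second the derivative is the normal time
derivative. The difference is controlled by the mean value theorem on the segment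
between the curves, using that the spatial gradient is continuous; the gradient is
orthogonal to the normal velocity, so that only the velocity of the foot remains. *)
Lemma cext_time p : pos_tube p ->
  is_tderive T (fun s => cext S zeta (p.1, s)) p.2
    (cext S (normal_dt T S zeta) p + \sum_j pt T (foot_coord j) p * cext S (sD S j zeta) p).
Proof.
move=> pp; case: (pp) => op t0; case: (op) => pT _.
have hq := ST_foot pp; have hq' := ST_STbar hq.
have pq : pos_tube (foot S p, p.2) by exact: ST_pos_tube.
have [GY Yy] := labelP hq'; set Y := label S _ in GY Yy.
set t := p.2 in pT t0 hq hq' pq Y GY Yy *; set y := foot S p in hq hq' pq Y GY Yy *.
pose q s := Phinu S (Y, s); pose z s := foot S (p.1, s).
have dq : is_tderive T q t (VGam S (y, t) *: nu S (y, t)).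
  by have := Phinu_ode hS GY pT; rewrite Yy.
have dz : is_tderive T z t (\row_j pt T (foot_coord j) p).
  apply/is_tderive_mxP => j; rewrite mxE.
  exact: (tderivableP T0 pT (smooth_tube_pt_derivable (smooth_foot_coord j) op)).
have dA : is_tderive T (fun s => zeta (q s, s)) t (normal_dt T S zeta (y, t)).
  exact: (tderivableP T0 pT (zt hq)).
have zt' : z t = y by rewrite /z /t -surjective_pairing.
have qt : q t = y by [].
have FF := tn_filter T t.
have zc := is_tderive_cvg dz; rewrite zt' in zc.
have qc := is_tderive_cvg dq; rewrite qt in qc.
pose G x s := xgrad (cext S zeta) (x, s).
pose B s := cext S zeta (z s, s) - cext S zeta (q s, s).
have conv (e : R) : 0 < e -> \forall s \near tn t, forall th, th \in `[(0 : R), 1] ->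
    `|y - (q s + th *: (z s - q s))| < e.
  move=> e0; have /cvgrPdist_lt/(_ _ e0) hz := zc; have /cvgrPdist_lt/(_ _ e0) hc := qc.
  apply: filterS2 hz hc => s hz hc th; rewrite in_itv /= => /andP[th0 th1].
  have -> : y - (q s + th *: (z s - q s)) = (1 - th) *: (y - q s) + th *: (y - z s).
    by apply/rowP => i; rewrite !mxE; ring.
  apply: le_lt_trans (ler_normD _ _) _; rewrite !normrZ.
  have th1' : 0 <= 1 - th by rewrite subr_ge0.
  rewrite (ger0_norm th0) (ger0_norm th1').
  have h1 := ler_wpM2l th0 (ltW hz); have h2 := ler_wpM2l th1' (ltW hc).
  have [th12|th12] := leP th (1 / 2).
    have : (1 - th) * `|y - q s| < (1 - th) * e by rewrite ltr_pM2l //; lra.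
    lra.
  have : th * `|y - z s| < th * e by rewrite ltr_pM2l //; lra.
  lra.
have seg : \forall s \near tn t, forall th, th \in `[(0 : R), 1] ->
    pos_tube (q s + th *: (z s - q s), s).
  have /nbhs_ballP[e /= e0 he] := pos_tube_near pq.
  have /cvgrPdist_lt/(_ _ e0) ht := @tn_cvg R T t.
  apply: filterS3 (conv _ e0) (tn_itv T t) ht => s hs sT ts th hth.
  by apply: he => //; split; [rewrite -ball_normE; exact: hs|rewrite -ball_normE; exact: ts].
have /choice[th hth] s : exists th, (forall th, th \in `[(0 : R), 1] ->
    pos_tube (q s + th *: (z s - q s), s)) -> th \in `[(0 : R), 1] /\
    B s = dotv (z s - q s) (G (q s + th *: (z s - q s)) s).
  have [h|h] := pselect (forall th, th \in `[(0 : R), 1] -> pos_tube (q s + th *: (z s - q s), s)).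
    have := @MVT_line _ _ (fun x => cext S zeta (x, s)) (q s) (z s - q s).
    case=> [r r01|r r01 Br].
      have pr := h r r01.
      by have [+ _] := cext_space pr.1 (zx (ST_foot pr)).
    exists r => _; split=> //; move: Br.
    by rewrite (addrC (q s) (z s - q s)) subrK.
  by exists 0 => /h.
pose xi s := q s + th s *: (z s - q s).
have xic : (xi s, s) @[s --> tn t] --> within pos_tube (nbhs (y, t)).
  have c1 : xi s @[s --> tn t] --> y.
    apply/cvgrPdist_lt => e e0; apply: filterS2 (conv _ e0) seg => s hs hseg.
    by have [th01 _] := hth s hseg; exact: hs.
  have := cvg_pair_to c1 (@tn_cvg R T t) => cq A /cq; rewrite !near_simpl /=.
  apply: filterS2 seg => s hseg hA; apply: hA.
  by have [th01 _] := hth s hseg; exact: hseg.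
have Gc : G (xi s) s @[s --> tn t] --> xgrad (cext S zeta) (y, t).
  apply: cvg_rV => j; rewrite mxE.
  have := cvg_comp _ _ xic (pd_cext_near (j := j) pq).
  by apply: cvg_trans; apply: near_eq_cvg; near=> s; rewrite /G mxE.
have dB : is_tderive T B t (dotv (\row_j pt T (foot_coord j) p - VGam S (y, t) *: nu S (y, t))
    (xgrad (cext S zeta) (y, t))).
  have cz : tquot z t s - tquot q t s @[s --> tn t] -->
      \row_j pt T (foot_coord j) p - VGam S (y, t) *: nu S (y, t) by exact: cvgB dz dq.
  apply: cvg_trans (cvg_dotv cz Gc); apply: near_eq_cvg.
  apply: filterS seg => s hseg; have [_ Bs] := hth s hseg.
  rewrite /tquot Bs /B zt' qt subrr subr0 -scalerBr dotvZl; congr (_ * dotv _ _).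
  by rewrite opprB addrA subrK.
have := is_tderiveD dA dB.
have -> : dotv (\row_j pt T (foot_coord j) p - VGam S (y, t) *: nu S (y, t))
    (xgrad (cext S zeta) (y, t)) = \sum_j pt T (foot_coord j) p * cext S (sD S j zeta) p.
  have nuE : dotv (nu S (y, t)) (xgrad (cext S zeta) (y, t)) = 0.
    rewrite -(dotv_nu_sD hq' (zx hq)); apply: eq_bigr => j _.
    by rewrite mxE sD_pd //; exact: zx.
  rewrite dotvDl dotvNl dotvZl nuE mulr0 oppr0 addr0.
  apply: eq_bigr => j _; rewrite !mxE /cext sD_pd //; exact: zx.
rewrite {1}/cext -/y -/t; apply: is_tderive_near.
  by rewrite /B zt' qt subrr addr0 /cext /= -/(z t) zt'.
have op' : \forall s \near tn t, open_tube (p.1, s).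
  exact: (near_curve (p := p) (cvg_cst p.1) (open_tube_near op)).
apply: filterS2 op' (tn_itv T t) => s os sT.
have Sq : STbar T S (q s, s) by split=> //; exact: Phinu_Gam.
have Sz : STbar T S (z s, s) by exact: STbar_foot (open_tube_NTbar os).
by rewrite /B (cext_STbar zeta Sq) (cext_STbar zeta Sz) addrC subrK.
Unshelve. all: by end_near. Qed.

End TimeDerivativeOfExtension.

(** * The heat operator and its product rules *)

Variable kd : R.

Definition gdot f g p : R := dotv (xgrad f p) (xgrad g p).

Definition heat f p : R := pt T f p - kd * laplacian f p.

(** The regularity which a constant extension of a function of class C^{2,1} has;
smoothness on the tube is too much to ask. *)
Record heat_regular f : Prop := HeatRegular {
  heat_regular_x : forall p, pos_tube p -> differentiable (fun x => f (x, p.2)) p.1;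
  heat_regular_xx : forall p i, pos_tube p ->
    differentiable (fun x => pd i f (x, p.2)) p.1;
  heat_regular_t : forall p, pos_tube p -> pt_derivable T f p }.

Lemma pos_slice p : pos_tube p -> \forall x \near p.1, pos_tube (x, p.2).
Proof. by move=> pp; have [[pT _] _] := pp; exact: near_slice (pos_tube_near pp). Qed.

Lemma pos_time p : pos_tube p -> \forall s \near tn p.2, pos_tube (p.1, s).
Proof. by move=> pp; exact: (near_curve (cvg_cst p.1) (pos_tube_near pp)). Qed.

Lemma pos_tube_itv p : pos_tube p -> p.2 \in `[0, T].
Proof. by case=> -[]. Qed.

Lemma pd_eq f g p i : (forall q, pos_tube q -> f q = g q) -> pos_tube p ->
  pd i f p = pd i g p.
Proof.
move=> fg pp; have h : \forall x \near p.1, f (x, p.2) = g (x, p.2).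
  by apply: filterS (pos_slice pp) => x; exact: fg.
by have := grad_near h => /rowP/(_ i); rewrite !mxE.
Qed.

Lemma differentiable_slice_eq f g p : (forall q, pos_tube q -> f q = g q) -> pos_tube p ->
  differentiable (fun x => f (x, p.2)) p.1 -> differentiable (fun x => g (x, p.2)) p.1.
Proof.
move=> fg pp; apply: differentiable_near.
by apply: filterS (pos_slice pp) => x; exact: fg.
Qed.

Lemma pt_eq f g p l : (forall q, pos_tube q -> f q = g q) -> pos_tube p ->
  is_tderive T (fun s => f (p.1, s)) p.2 l -> is_tderive T (fun s => g (p.1, s)) p.2 l.
Proof.
move=> fg pp; apply: is_tderive_near.
  by rewrite -surjective_pairing; exact: fg.
by apply: filterS (pos_time pp) => s; exact: fg.
Qed.

Lemma heat_eq f g p : (forall q, pos_tube q -> f q = g q) -> heat_regular f -> pos_tube p ->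
  heat f p = heat g p.
Proof.
move=> fg rf pp.
have e1 : pt T f p = pt T g p.
  have ft := tderivableP T0 (pos_tube_itv pp) (heat_regular_t rf pp).
  by rewrite /pt (is_tderiveE T0 (pos_tube_itv pp) (pt_eq fg pp ft)).
have e2 : laplacian f p = laplacian g p.
  by apply: eq_bigr => i _; apply: pd_eq => // q pq; exact: pd_eq.
by rewrite /heat e1 e2.
Qed.

Lemma xgradE f p i : xgrad f p 0 i = pd i f p.
Proof. by rewrite mxE. Qed.

Lemma pos_open p : pos_tube p -> open_tube p. Proof. by case. Qed.

Lemma smooth_heat_regular f : smooth_tube f -> heat_regular f.
Proof.
move=> sf; split=> [p /pos_open op|p i /pos_open op|p /pos_open op].
- exact: smooth_tube_differentiable.
- exact: (smooth_tube_differentiable (smooth_tube_pd sf i)).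
- exact: smooth_tube_pt_derivable.
Qed.

Lemma heat_regular_is_pt f p : heat_regular f -> pos_tube p ->
  is_tderive T (fun s => f (p.1, s)) p.2 (pt T f p).
Proof.
by move=> rf pp; exact: (tderivableP T0 (pos_tube_itv pp) (heat_regular_t rf pp)).
Qed.

Lemma pd_sliceD f g p i : differentiable (fun x => f (x, p.2)) p.1 ->
  differentiable (fun x => g (x, p.2)) p.1 ->
  pd i (fun q => f q + g q) p = pd i f p + pd i g p.
Proof. by move=> df dg; have /rowP/(_ i) := gradD df dg; rewrite !mxE. Qed.

Lemma pd_sliceM f g p i : differentiable (fun x => f (x, p.2)) p.1 ->
  differentiable (fun x => g (x, p.2)) p.1 ->
  pd i (fun q => f q * g q) p = f p * pd i g p + g p * pd i f p.
Proof.
by move=> df dg; have /rowP/(_ i) := gradM df dg; rewrite !mxE -surjective_pairing.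
Qed.

Section Algebra.
Variables (f g : E -> R).
Hypothesis (rf : heat_regular f) (rg : heat_regular g).
Let fx := heat_regular_x rf.
Let gx := heat_regular_x rg.
Let fxx := heat_regular_xx rf.
Let gxx := heat_regular_xx rg.

Lemma pdD p i : pos_tube p -> pd i (fun q => f q + g q) p = pd i f p + pd i g p.
Proof. by move=> pp; apply: pd_sliceD; [exact: fx|exact: gx]. Qed.

Lemma pdM p i : pos_tube p -> pd i (fun q => f q * g q) p = f p * pd i g p + g p * pd i f p.
Proof. by move=> pp; apply: pd_sliceM; [exact: fx|exact: gx]. Qed.

Lemma xgradD p : pos_tube p -> xgrad (fun q => f q + g q) p = xgrad f p + xgrad g p.
Proof. by move=> pp; apply/rowP => i; rewrite !mxE; exact: pdD. Qed.

Lemma xgradM p : pos_tube p ->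
  xgrad (fun q => f q * g q) p = f p *: xgrad g p + g p *: xgrad f p.
Proof. by move=> pp; apply/rowP => i; rewrite !mxE; exact: pdM. Qed.

Lemma heat_regularD : heat_regular (fun q => f q + g q).
Proof.
split=> [p pp|p i pp|p pp].
- apply: differentiableD; [exact: fx|exact: gx].
- apply: (@differentiable_slice_eq (fun q => pd i f q + pd i g q)) => // [q pq|].
    by rewrite pdD.
  apply: differentiableD; [exact: fxx|exact: gxx].
- exact: is_tderive_tderivable (is_tderiveD (heat_regular_is_pt rf pp) (heat_regular_is_pt rg pp)).
Qed.

Lemma heat_regularM : heat_regular (fun q => f q * g q).
Proof.
split=> [p pp|p i pp|p pp].
- apply: differentiableM; [exact: fx|exact: gx].
- apply: (@differentiable_slice_eq (fun q => f q * pd i g q + g q * pd i f q)) => // [q pq|].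
    by rewrite pdM.
  apply: differentiableD; apply: differentiableM.
  + exact: fx.
  + exact: gxx.
  + exact: gx.
  + exact: fxx.
- exact: is_tderive_tderivable (is_tderiveM (heat_regular_is_pt rf pp) (heat_regular_is_pt rg pp)).
Qed.

Lemma ptM p : pos_tube p -> pt T (fun q => f q * g q) p = f p * pt T g p + g p * pt T f p.
Proof.
move=> pp; have pT := pos_tube_itv pp.
have := is_tderiveE T0 pT (is_tderiveM (heat_regular_is_pt rf pp) (heat_regular_is_pt rg pp)).
by rewrite -[X in _ = X -> _]/(_ + _) -!surjective_pairing /pt => ->; ring.
Qed.

Lemma ptD p : pos_tube p -> pt T (fun q => f q + g q) p = pt T f p + pt T g p.
Proof.
move=> pp; have pT := pos_tube_itv pp.
exact: (is_tderiveE T0 pT (is_tderiveD (heat_regular_is_pt rf pp) (heat_regular_is_pt rg pp))).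
Qed.

Lemma heatD p : pos_tube p -> heat (fun q => f q + g q) p = heat f p + heat g p.
Proof.
move=> pp.
have e2 : laplacian (fun q => f q + g q) p = laplacian f p + laplacian g p.
  rewrite /laplacian -big_split /=; apply: eq_bigr => i _.
  rewrite (@pd_eq _ (fun q => pd i f q + pd i g q)) //; last by move=> q pq; exact: pdD.
  by apply: pd_sliceD; [exact: fxx|exact: gxx].
rewrite /heat e2 ptD //; move: (pt T f p) (pt T g p) (laplacian f p) (laplacian g p).
by move=> a b c d; ring.
Qed.

Lemma heatM p : pos_tube p ->
  heat (fun q => f q * g q) p = f p * heat g p + g p * heat f p - 2 * kd * gdot f g p.
Proof.
move=> pp.
have e2 : laplacian (fun q => f q * g q) p =
    f p * laplacian g p + g p * laplacian f p + 2 * gdot f g p.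
  rewrite /laplacian /gdot /dotv !mulr_sumr -!big_split /=; apply: eq_bigr => i _.
  rewrite (@pd_eq _ (fun q => f q * pd i g q + g q * pd i f q)) //; last by move=> q pq; exact: pdM.
  rewrite pd_sliceD; last 2 first.
  - by apply: differentiableM; [exact: fx|exact: gxx].
  - by apply: differentiableM; [exact: gx|exact: fxx].
  rewrite !pd_sliceM; [|exact: gx|exact: fxx|exact: fx|exact: gxx].
  rewrite !xgradE; move: (pd i (pd i f) p) (pd i (pd i g) p) (pd i f p) (pd i g p) (f p) (g p).
  by move=> a b c d u v; ring.
rewrite /heat e2 ptM //.
move: (pt T f p) (pt T g p) (laplacian f p) (laplacian g p) (gdot f g p) (f p) (g p).
by move=> a b c d e u v; ring.
Qed.

End Algebra.

Lemma gdotC f g p : gdot f g p = gdot g f p.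
Proof. exact: dotvC. Qed.

Lemma gdotDl f g h p : heat_regular f -> heat_regular g -> pos_tube p ->
  gdot (fun q => f q + g q) h p = gdot f h p + gdot g h p.
Proof. by move=> rf rg pp; rewrite /gdot xgradD // dotvDl. Qed.

Lemma gdotMl f g h p : heat_regular f -> heat_regular g -> pos_tube p ->
  gdot (fun q => f q * g q) h p = f p * gdot g h p + g p * gdot f h p.
Proof. by move=> rf rg pp; rewrite /gdot xgradM // dotvDl !dotvZl. Qed.

Lemma heat_regular_cst a : heat_regular (fun=> a).
Proof. exact: smooth_heat_regular (smooth_tube_cst a). Qed.

Lemma xgrad_cst a p : xgrad (fun=> a) p = 0.
Proof. exact: gradC. Qed.

Lemma heat_cst a p : pos_tube p -> heat (fun=> a) p = 0.
Proof.
move=> pp; rewrite /heat /pt (is_tderiveE T0 (pos_tube_itv pp) (is_tderive_cst T a p.2)).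
rewrite /laplacian big1 ?mulr0 ?subr0 // => i _.
rewrite (_ : pd i (fun=> a) = fun=> 0); last first.
  by apply/funext => q; rewrite /pd derive_cst.
by rewrite /pd derive_cst.
Qed.

Lemma gdotZl a f h p : heat_regular f -> pos_tube p ->
  gdot (fun q => a * f q) h p = a * gdot f h p.
Proof.
move=> rf pp; rewrite gdotMl //; last exact: heat_regular_cst.
by rewrite {2}/gdot xgrad_cst -(scale0r (0 : 'rV[R]_n)) dotvZl mul0r mulr0 addr0.
Qed.

Lemma heatZ a f p : heat_regular f -> pos_tube p -> heat (fun q => a * f q) p = a * heat f p.
Proof.
move=> rf pp; rewrite heatM //; last exact: heat_regular_cst.
rewrite heat_cst // /gdot xgrad_cst -(scale0r (0 : 'rV[R]_n)) dotvZl; ring.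
Qed.

Lemma heat_regularZ a f : heat_regular f -> heat_regular (fun q => a * f q).
Proof. exact: heat_regularM (heat_regular_cst a). Qed.

Lemma diff_expR (a l : R) : differentiable expR a /\ 'd expR a l = expR a * l.
Proof.
have [de dE] := is_derive_expR a; have de' : differentiable expR a by exact/derivable1_diffP.
split=> //; rewrite -{1}[l]mulr1 -[l * 1]/(l *: 1) linearZ /= -deriveE // dE.
by rewrite /GRing.scale /= mulrC.
Qed.

Section Exponential.
Variable f : E -> R.
Hypothesis rf : heat_regular f.

Lemma differentiable_exp p : pos_tube p -> differentiable (fun x => expR (f (x, p.2))) p.1 /\
  forall i, pd i (fun q => expR (f q)) p = expR (f p) * pd i f p.
Proof.
move=> pp; have fx := heat_regular_x rf pp.
have [de _] := diff_expR (f (p.1, p.2)) 0.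
have dc := differentiable_comp fx de; split=> // i.
rewrite /pd -[LHS]/('D_(delta_mx 0 i) (expR \o (fun x => f (x, p.2))) p.1) deriveE //.
rewrite diff_comp //=.
have [_ ->] := diff_expR (f (p.1, p.2)) ('d (fun x => f (x, p.2)) (p.1) (delta_mx 0 i)).
by rewrite -deriveE // -surjective_pairing.
Qed.

Lemma pt_exp p : pos_tube p ->
  is_tderive T (fun s => expR (f (p.1, s))) p.2 (expR (f p) * pt T f p).
Proof.
move=> pp; have [de dE] := diff_expR (f (p.1, p.2)) (pt T f p).
have := is_tderive_chain de (heat_regular_is_pt rf pp).
by rewrite dE -surjective_pairing.
Qed.

Lemma xgrad_exp p : pos_tube p -> xgrad (fun q => expR (f q)) p = expR (f p) *: xgrad f p.
Proof.
by move=> pp; apply/rowP => i; rewrite !mxE; have [_] := differentiable_exp pp; exact.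
Qed.

Lemma heat_regular_exp : heat_regular (fun q => expR (f q)).
Proof.
split=> [p pp|p i pp|p pp].
- by have [] := differentiable_exp pp.
- apply: (@differentiable_slice_eq (fun q => expR (f q) * pd i f q)) => // [q pq|].
    by have [_ ->] := differentiable_exp pq.
  by apply: differentiableM; [have [] := differentiable_exp pp|exact: heat_regular_xx].
- exact: is_tderive_tderivable (pt_exp pp).
Qed.

Lemma heat_exp p : pos_tube p ->
  heat (fun q => expR (f q)) p = expR (f p) * (heat f p - kd * gdot f f p).
Proof.
move=> pp.
have e1 : pt T (fun q => expR (f q)) p = expR (f p) * pt T f p.
  exact: (is_tderiveE T0 (pos_tube_itv pp) (pt_exp pp)).
have e2 : laplacian (fun q => expR (f q)) p = expR (f p) * (laplacian f p + gdot f f p).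
  rewrite /laplacian /gdot /dotv -big_split /= mulr_sumr; apply: eq_bigr => i _.
  rewrite (@pd_eq _ (fun q => expR (f q) * pd i f q)) //; last first.
    by move=> q pq; have [_ ->] := differentiable_exp pq.
  rewrite pd_sliceM; [|by have [] := differentiable_exp pp|exact: heat_regular_xx].
  have [_ ->] := differentiable_exp pp; rewrite !xgradE.
  move: (pd i (pd i f) p) (pd i f p) (expR (f p)) => a b c; ring.
rewrite /heat e1 e2; move: (pt T f p) (laplacian f p) (gdot f f p) (expR (f p)).
by move=> a b c d; ring.
Qed.

End Exponential.

Section Extension.
Variable zeta : E -> R.
Hypothesis cz : C21 T S zeta.

Lemma C21_sdiff p : ST T S p -> sdiff S zeta p.
Proof. by case: cz => _ _ [h _] _; exact: h. Qed.

Lemma C21_sdiff2 j p : ST T S p -> sdiff S (sD S j zeta) p.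
Proof. by case: cz => _ _ _ [h _]; exact: h. Qed.

Lemma cext_pd p i : pos_tube p -> pd i (cext S zeta) p =
  \sum_j pd i (foot_coord j) p * cext S (sD S j zeta) p.
Proof.
move=> pp; have [_] := cext_space (pos_open pp) (C21_sdiff (ST_foot pp)); exact.
Qed.

Lemma cext_pd2 p i j : pos_tube p -> pd i (cext S (sD S j zeta)) p =
  \sum_l pd i (foot_coord l) p * cext S (sD S l (sD S j zeta)) p.
Proof.
move=> pp; have [_] := cext_space (pos_open pp) (C21_sdiff2 j (ST_foot pp)); exact.
Qed.

Lemma cext_pt p : pos_tube p ->
  is_tderive T (fun s => cext S zeta (p.1, s)) p.2
    (cext S (normal_dt T S zeta) p + \sum_j pt T (foot_coord j) p * cext S (sD S j zeta) p).
Proof. by case: cz => _ [zt _] [zx zxc] _; exact: cext_time. Qed.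

Lemma differentiable_cext_sD j p : pos_tube p ->
  differentiable (fun x => cext S (sD S j zeta) (x, p.2)) p.1.
Proof.
by move=> pp; have [] := cext_space (pos_open pp) (C21_sdiff2 j (ST_foot pp)).
Qed.

Lemma differentiable_pd_foot i j p : pos_tube p ->
  differentiable (fun x => pd i (foot_coord j) (x, p.2)) p.1.
Proof.
move=> /pos_open op.
exact: (smooth_tube_differentiable (smooth_tube_pd (smooth_foot_coord j) i) op).
Qed.

Lemma differentiable_slice_sum (I : Type) (r : seq I) (F : I -> E -> R) p :
  (forall j, differentiable (fun x => F j (x, p.2)) p.1) ->
  differentiable (fun x => \sum_(j <- r) F j (x, p.2)) p.1 /\
  forall i, pd i (fun q => \sum_(j <- r) F j q) p = \sum_(j <- r) pd i (F j) p.
Proof.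
move=> dF; elim: r => [|j r [IH1 IH2]].
  split=> [|i]; first by under eq_fun do rewrite big_nil.
  by under [X in pd i X]eq_fun do rewrite big_nil; rewrite big_nil /pd derive_cst.
split=> [|i]; first by under eq_fun do rewrite big_cons; exact: differentiableD.
under [X in pd i X]eq_fun do rewrite big_cons.
by rewrite big_cons -IH2; apply: pd_sliceD.
Qed.

Lemma heat_regular_cext : heat_regular (cext S zeta).
Proof.
split=> [p pp|p i pp|p pp].
- by have [] := cext_space (pos_open pp) (C21_sdiff (ST_foot pp)).
- apply: (@differentiable_slice_eq (fun q =>
    \sum_j pd i (foot_coord j) q * cext S (sD S j zeta) q)) => // [q pq|].
    by rewrite cext_pd.
  apply: (differentiable_slice_sum _ (F := fun j q => pd i (foot_coord j) q * cext S (sD S j zeta) q) _).1 => j.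
  apply: differentiableM; first exact: differentiable_pd_foot.
  exact: differentiable_cext_sD.
- exact: is_tderive_tderivable (cext_pt pp).
Qed.

(** The second derivatives of the foot map are the coefficients of the first surface
derivatives, and the products of its gradients those of the second ones. *)
Lemma cext_laplacian p : pos_tube p -> laplacian (cext S zeta) p =
  \sum_j laplacian (foot_coord j) p * cext S (sD S j zeta) p
  + \sum_j \sum_l gdot (foot_coord j) (foot_coord l) p * cext S (sD S l (sD S j zeta)) p.
Proof.
move=> pp; rewrite /laplacian.
have E1 i : pd i (pd i (cext S zeta)) p = \sum_j pd i (pd i (foot_coord j)) p * cext S (sD S j zeta) p
    + \sum_j pd i (foot_coord j) p * \sum_l pd i (foot_coord l) p * cext S (sD S l (sD S j zeta)) p.
  rewrite (@pd_eq _ (fun q => \sum_j pd i (foot_coord j) q * cext S (sD S j zeta) q)) //; last first.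
    by move=> q pq; exact: cext_pd.
  rewrite (differentiable_slice_sum _ (F := fun j q => pd i (foot_coord j) q * cext S (sD S j zeta) q) _).2.
    rewrite -big_split /=.
    apply: eq_bigr => j _; rewrite pd_sliceM; [|exact: differentiable_pd_foot|exact: differentiable_cext_sD].
    by rewrite cext_pd2 // addrC; congr (_ + _); exact: mulrC.
  move=> j; apply: differentiableM; first exact: differentiable_pd_foot.
  exact: differentiable_cext_sD.
transitivity (\sum_i (\sum_j pd i (pd i (foot_coord j)) p * cext S (sD S j zeta) p
    + \sum_j pd i (foot_coord j) p * \sum_l pd i (foot_coord l) p * cext S (sD S l (sD S j zeta)) p)).
  by apply: eq_bigr => i _; exact: E1.
rewrite big_split /=; congr (_ + _).
  by rewrite exchange_big /=; apply: eq_bigr => j _; rewrite mulr_suml.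
rewrite exchange_big /=; apply: eq_bigr => j _.
under eq_bigr do rewrite mulr_sumr.
rewrite exchange_big /=; apply: eq_bigr => l _.
rewrite /gdot /dotv mulr_suml; apply: eq_bigr => i _.
by rewrite !mxE mulrA.
Qed.

End Extension.

(** * The thin domain *)

Variables (g0 g1 : E -> R).
Hypothesis hg0 : smooth_on (STbar T S) g0.
Hypothesis hg1 : smooth_on (STbar T S) g1.
Variable gmin : R.
Hypothesis gmin0 : 0 < gmin.
Hypothesis hgmin : forall p, STbar T S p -> gmin <= g1 p - g0 p.
Variable eps0 : R.
Hypothesis heps0 : 0 < eps0 < 1.
Hypothesis hdelta : forall (eps : R) p, 0 < eps < eps0 -> STbar T S p ->
  eps * `|g0 p| <= delta S /\ eps * `|g1 p| <= delta S.

Definition gfun (b : bool) : E -> R := if b then g1 else g0.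
Definition side (b : bool) : R := if b then 1 else -1.
Definition gbar (b : bool) : E -> R := cext S (gfun b).

(** The two functions whose positivity defines the thin domain; on either part of the
lateral boundary one of them vanishes. *)
Definition edge (eps : R) (b : bool) (p : E) : R := side b * (eps * gbar b p - sd S p).

Lemma side2 b : side b * side b = 1.
Proof. by case: b; rewrite /side; ring. Qed.

Lemma smooth_gbar b : smooth_tube (gbar b).
Proof. by case: b; exact: smooth_tube_cext. Qed.

Lemma smooth_edge eps b : smooth_tube (edge eps b).
Proof.
apply: smooth_tubeZ; apply: smooth_tubeD; first exact: smooth_tubeZ (smooth_gbar b).
apply: smooth_tube_eq (smooth_tubeZ (-1) smooth_tube_sd) => p _; exact: mulN1r.
Qed.

Lemma gbarE b p : gbar b p = gfun b (foot S p, p.2).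
Proof. by []. Qed.

Lemma edge_add eps p : edge eps true p + edge eps false p = eps * (gbar true p - gbar false p).
Proof. by rewrite /edge /side; ring. Qed.

Lemma gap_ge p : open_tube p -> gmin <= gbar true p - gbar false p.
Proof. by move=> /open_tube_NTbar/STbar_foot; exact: hgmin. Qed.

Section FixedThickness.
Variable eps : R.
Hypothesis heps : 0 < eps < eps0.

Let eps_gt0 : 0 < eps. Proof. by case/andP: heps. Qed.

(** The strict inequality comes from the room between [eps] and [eps0]; it keeps the
closed thin domain inside the open tube. *)
Lemma thin_radius : exists2 d, d < delta S &
  forall b p, STbar T S p -> eps * `|gfun b p| <= d.
Proof.
pose e' := (eps + eps0) / 2.
have [e1 e2] : eps < e' /\ e' < eps0.
  by case/andP: heps => h1 h2; rewrite /e'; split; lra.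
have e'0 : 0 < e' by exact: lt_trans e1.
exists (eps / e' * delta S).
  by rewrite gtr_pMl ?(delta_gt0 hS) // ltr_pdivrMr // mul1r.
move=> b p hp; have he' : 0 < e' < eps0 by rewrite e'0.
have h : e' * `|gfun b p| <= delta S by case: b; have [] := hdelta he' hp.
have -> : eps * `|gfun b p| = eps / e' * (e' * `|gfun b p|).
  by rewrite mulrA divfK // gt_eqF.
by rewrite ler_pM2l // divr_gt0.
Qed.

Lemma ray_edge p r b : STbar T S p -> `|r| < delta S ->
  edge eps b (p.1 + r *: nu S p, p.2) = side b * (eps * gfun b p - r).
Proof.
move=> hp hr; rewrite /edge sd_ray // gbarE foot_ray //=.
by rewrite -surjective_pairing.
Qed.

Lemma edge_sign_sd p : open_tube p ->
  (forall b, 0 <= edge eps b p) <-> eps * gbar false p <= sd S p <= eps * gbar true p.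
Proof.
move=> op; rewrite /edge; split.
  move=> h; have := h true; have := h false; rewrite /side => h1 h2.
  by apply/andP; split; lra.
by move=> /andP[h1 h2] []; rewrite /side; lra.
Qed.

Lemma thin_between (d r a b : R) : `|a| <= d -> `|b| <= d -> a <= r <= b -> `|r| <= d.
Proof. by rewrite !ler_norml => /andP[? ?] /andP[? ?] /andP[? ?]; lra. Qed.

Lemma OmegaE t : t \in `[0, T] -> forall x, Omega S g0 g1 eps t x <->
  open_tube (x, t) /\ forall b, 0 < edge eps b (x, t).
Proof.
move=> tT x; split=> [[y [r [Gy /andP[r0 r1] ->]]]|[ox hx]].
  have hy : STbar T S (y, t) by [].
  have rd : `|r| < delta S.
    have [d dd hd] := thin_radius; apply: le_lt_trans dd.
    apply: (@thin_between _ _ (eps * g0 (y, t)) (eps * g1 (y, t))).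
    - by have := hd false _ hy; rewrite normrM (gtr0_norm eps_gt0).
    - by have := hd true _ hy; rewrite normrM (gtr0_norm eps_gt0).
    - by rewrite !ltW.
  split; first exact: (open_tube_ray hy rd).
  move=> b; rewrite (ray_edge b hy rd).
  by case: b; rewrite /side /gfun; lra.
have [Gy py _ _] := foot_spec (open_tube_NTbar ox).
exists (foot S (x, t)), (sd S (x, t)); split=> //.
have := hx true; have := hx false; rewrite /edge /side !gbarE /gfun /= => h1 h2.
by apply/andP; split; lra.
Qed.

Lemma edge_near p b : open_tube p -> 0 < edge eps b p ->
  \forall q \near p, q.2 \in `[0, T] -> 0 < edge eps b q.
Proof.
move=> op hp; have c := smooth_tube_near (smooth_edge eps b) op.
have FF : Filter (within open_tube (nbhs p)) by exact: within_filter.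
have := cvgr_gt _ c _ hp; rewrite near_withinE => /(_ FF).
apply: filterS2 (open_tube_near op) => q oq hq qT; apply: hq; exact: oq.
Qed.

Lemma Omega_near p : p.2 \in `[0, T] -> Omega S g0 g1 eps p.2 p.1 ->
  \forall q \near p, q.2 \in `[0, T] -> Omega S g0 g1 eps q.2 q.1.
Proof.
move=> pT /(OmegaE pT); rewrite -surjective_pairing => -[op hp].
apply: filterS3 (open_tube_near op) (edge_near op (hp true)) (edge_near op (hp false)).
move=> q oq h1 h0 qT; apply/(OmegaE qT); rewrite -surjective_pairing.
by split; [exact: oq|case; [exact: h1|exact: h0]].
Qed.

Lemma Omega_slice_near t x : t \in `[0, T] -> Omega S g0 g1 eps t x ->
  \forall z \near x, Omega S g0 g1 eps t z.
Proof. by move=> tT hx; exact: (@near_slice (x, t) _ tT (@Omega_near (x, t) tT hx)). Qed.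

Lemma closure_OmegaE t : t \in `[0, T] -> forall x, closure (Omega S g0 g1 eps t) x <->
  open_tube (x, t) /\ forall b, 0 <= edge eps b (x, t).
Proof.
move=> tT x; split=> [cx|[ox hx]].
  have [d dd hd] := thin_radius.
  have ox : open_tube (x, t).
    have e0 : 0 < delta S - d by rewrite subr_gt0.
    have [z [Oz xz]] := cx _ (enorm_near x e0).
    have [oz hz] := (OmegaE tT z).1 Oz.
    have [Gy zy _ _] := foot_spec (open_tube_NTbar oz).
    have hy := STbar_foot (open_tube_NTbar oz).
    split=> //; apply: (le_lt_trans (@normr_sd_le (x, t) (foot S (z, t)) tT Gy)) => /=.
    apply: le_lt_trans (enormB_trans z _ _) _.
    have -> : enorm (z - foot S (z, t)) = `|sd S (z, t)|.
      rewrite -[X in enorm (X - _)]/((z, t).1) zy addrC addKr enormZ.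
      by rewrite (enorm_normal (open_tube_NTbar oz)) mulr1.
    have : `|sd S (z, t)| <= d.
      apply: (@thin_between _ _ (eps * gbar false (z, t)) (eps * gbar true (z, t))).
      - by have := hd false _ hy; rewrite normrM (gtr0_norm eps_gt0).
      - by have := hd true _ hy; rewrite normrM (gtr0_norm eps_gt0).
      - by apply/(edge_sign_sd oz) => b; exact: ltW.
    by rewrite enormBC; lra.
  split=> // b; rewrite leNgt; apply/negP => hb.
  have c : edge eps b (z, t) @[z --> x] --> edge eps b (x, t).
    exact: (differentiable_continuous (smooth_tube_differentiable (smooth_edge eps b) ox)).
  have hn := @cvgr_lt _ _ _ (nbhs_filter x) _ _ c _ hb.
  have [z [Oz hz]] := cx _ hn.
  have [_ /(_ b)] := (OmegaE tT z).1 Oz.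
  by move=> /lt_trans/(_ hz); rewrite ltxx.
move=> A hA.
have [Gy xy _ _] := foot_spec (open_tube_NTbar ox).
have hy := STbar_foot (open_tube_NTbar ox).
set y := foot S (x, t) in Gy xy hy; set r := sd S (x, t) in xy.
pose m := eps * (g0 (y, t) + g1 (y, t)) / 2.
have c : x + th *: ((m - r) *: nu S (y, t)) @[th --> (0 : R)] --> x.
  rewrite -[X in _ --> X]addr0 -(scale0r ((m - r) *: nu S (y, t))).
  apply: cvgD; first exact: cvg_cst.
  by apply: cvgZr_tmp; exact: cvg_id.
have [e /= e0 he] := c _ hA.
pose th : R := Num.min (e / 2) (1 / 2).
have th0 : 0 < th by rewrite lt_min !divr_gt0.
have th1 : th <= 1 / 2 by rewrite ge_min lexx orbT.
have the : th < e.
  by apply: (@le_lt_trans _ _ (e / 2)); [rewrite ge_min lexx|lra].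
exists (x + th *: ((m - r) *: nu S (y, t))); split; last first.
  by apply: he; rewrite /ball /= sub0r normrN gtr0_norm.
exists y, (r + th * (m - r)); split=> //; last first.
  by rewrite [in LHS](xy : x = _) scalerA scalerDl addrA.
have /(edge_sign_sd ox) := hx; rewrite -/r !gbarE /= -/y => /andP[h1 h2].
have hgap : 0 < eps * (g1 (y, t) - g0 (y, t)).
  by rewrite mulr_gt0 //; exact: lt_le_trans (hgmin hy).
have e1 : 0 <= (1 - th) * (r - eps * g0 (y, t)) by apply: mulr_ge0; [lra|rewrite subr_ge0].
have e2 : 0 <= (1 - th) * (eps * g1 (y, t) - r) by apply: mulr_ge0; [lra|rewrite subr_ge0].
have e3 : 0 < th * (eps * (g1 (y, t) - g0 (y, t))) by rewrite mulr_gt0.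
by apply/andP; split; rewrite /m; lra.
Qed.

Lemma boundary_OmegaE t : t \in `[0, T] -> forall x, boundary (Omega S g0 g1 eps t) x <->
  [/\ open_tube (x, t), forall b, 0 <= edge eps b (x, t) & exists b, edge eps b (x, t) = 0].
Proof.
move=> tT x; split=> [[/(closure_OmegaE tT)[ox hx] hn]|[ox hx [b hb]]].
  split=> //; apply: contrapT => hne; apply: hn.
  apply: Omega_slice_near => //; apply/OmegaE => //; split=> // b.
  rewrite lt_neqAle hx andbT eq_sym; apply/negP => /eqP hb; apply: hne; by exists b.
split; first by apply/closure_OmegaE.
move=> /interior_subset/(OmegaE tT)[_ /(_ b)].
by rewrite hb ltxx.
Qed.

Local Notation Q := (QT T S g0 g1 eps).
Local Notation dQ := (dQT T S g0 g1 eps).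
Local Notation Qbar := (QTbar T S g0 g1 eps).

Lemma QTbarE p : Qbar p <-> open_tube p /\ forall b, 0 <= edge eps b p.
Proof.
case: p => x t; split=> [[tT cx]|[op hp]]; first exact/(closure_OmegaE tT x).
have tT : t \in `[0, T] by case: op.
by split=> //; apply/(closure_OmegaE tT x).
Qed.

Lemma QTE p : Q p <-> pos_tube p /\ forall b, 0 < edge eps b p.
Proof.
case: p => x t; split=> [[tT Ox]|[[op t0] hp]].
  have tT' : t \in `[0, T] by apply: subset_itvr tT; rewrite bnd_simp.
  have [op hp] := (OmegaE tT' x).1 Ox; split=> //; split=> //.
  by move: tT; rewrite /= in_itv /= => /andP[].
have tT : t \in `[0, T] by case: op.
split; last by apply/(OmegaE tT x).
by move: tT; rewrite /= !in_itv /= t0 => /andP[_ ->].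
Qed.

Lemma dQTE p : dQ p <-> [/\ pos_tube p, forall b, 0 <= edge eps b p & exists b, edge eps b p = 0].
Proof.
case: p => x t; split=> [[tT Ox]|[[op t0] hp hb]].
  have tT' : t \in `[0, T] by apply: subset_itvr tT; rewrite bnd_simp.
  have [op hp hb] := (boundary_OmegaE tT' x).1 Ox; split=> //; split=> //.
  by move: tT; rewrite /= in_itv /= => /andP[].
have tT : t \in `[0, T] by case: op.
split; last by apply/(boundary_OmegaE tT x).
by move: tT; rewrite /= !in_itv /= t0 => /andP[_ ->].
Qed.

Lemma edge_le p b : open_tube p -> (forall b, 0 <= edge eps b p) ->
  edge eps b p <= eps * (gbar true p - gbar false p).
Proof.
move=> op h; rewrite -edge_add; have := h true; have := h false.
by case: b; lra.
Qed.

Lemma edge_flip p b : edge eps b p + edge eps (~~ b) p = eps * (gbar true p - gbar false p).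
Proof. by rewrite -edge_add; case: b => //=; rewrite addrC. Qed.

Lemma edge_flip_gt0 p b : open_tube p -> edge eps b p = 0 -> 0 < edge eps (~~ b) p.
Proof.
move=> op b0; have := edge_flip p b; rewrite b0 add0r => ->.
by rewrite mulr_gt0 // (lt_le_trans gmin0) // gap_ge.
Qed.

Lemma QTbar_compact : compact Qbar.
Proof.
pose dom : set ('rV[R]_n * R * R) := (Gam S 0 `*` `[0, T]) `*` `[0, 1].
pose rho (a : 'rV[R]_n * R * R) := eps * ((1 - a.2) * gbar false (Phi S a.1, a.1.2)
   + a.2 * gbar true (Phi S a.1, a.1.2)).
pose M (a : 'rV[R]_n * R * R) := tube_map (a.1, rho a).
have [d dd hd] := thin_radius.
have rho_le a : dom a -> `|rho a| <= d.
  move=> [ha]; rewrite /= in_itv /= => /andP[h0 h1]; have hp := Phi_STbar ha.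
  have gE b : gfun b (Phi S a.1, a.1.2) = gbar b (Phi S a.1, a.1.2).
    by rewrite /gbar cext_STbar.
  have := hd true _ hp; have := hd false _ hp; rewrite !gE => hf ht.
  have -> : rho a = (1 - a.2) * (eps * gbar false (Phi S a.1, a.1.2))
    + a.2 * (eps * gbar true (Phi S a.1, a.1.2)) by rewrite /rho; ring.
  apply: le_trans (ler_normD _ _) _; rewrite !normrM (ger0_norm h0) (ger0_norm (_ : 0 <= 1 - a.2)) ?subr_ge0 //.
  rewrite (gtr0_norm eps_gt0); have e1 := ler_wpM2l h0 ht.
  have e2 : (1 - a.2) * (eps * `|gbar false (Phi S a.1, a.1.2)|) <= (1 - a.2) * d.
    by apply: ler_wpM2l; rewrite ?subr_ge0.
  lra.
have -> : Qbar = M @` dom.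
  apply/seteqP; split=> [p /QTbarE[op hp]|_ [a ha <-]]; last first.
    have [ha1 ha2] := ha; have hp := Phi_STbar ha1.
    have hr : `|rho a| < delta S by apply: le_lt_trans dd; exact: rho_le.
    have ME : M a = ((Phi S a.1, a.1.2).1 + rho a *: nu S (Phi S a.1, a.1.2), (Phi S a.1, a.1.2).2) by [].
    apply/QTbarE; rewrite ME; split; first exact: open_tube_ray.
    move=> b; rewrite ray_edge // -[gfun b _](cext_STbar (gfun b) hp) -/(gbar b _).
    have hgap := mulr_gt0 eps_gt0 (lt_le_trans gmin0 (gap_ge (let: And3 o _ _ := STbar_tube hp in o))).
    move: ha2; rewrite /= in_itv /= => /andP[h0 h1].
    have h1' : 0 <= 1 - a.2 by rewrite subr_ge0.
    have e0 := mulr_ge0 h0 (ltW hgap); have e1 := mulr_ge0 h1' (ltW hgap).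
    by case: b; rewrite /side /rho; lra.
  have hN := open_tube_NTbar op; have [Gy py _ _] := foot_spec hN; have [pT _] := NTbar_le hN.
  have [[_ _ surj] _ _] := Phi_diffeo hS pT; have [Y GY Yy] := surj _ Gy; rewrite /= in Yy.
  have hgap := mulr_gt0 eps_gt0 (lt_le_trans gmin0 (gap_ge op)).
  have gne : eps * (gbar true p - gbar false p) != 0 by rewrite gt_eqF.
  pose th := edge eps false p / (eps * (gbar true p - gbar false p)).
  have thE : th * (eps * (gbar true p - gbar false p)) = edge eps false p by rewrite /th divfK.
  have hE b : gbar b (Phi S (Y, p.2), p.2) = gbar b p.
    by rewrite Yy /gbar cext_foot.
  exists ((Y, p.2), th).
    split; first by split.
    rewrite /= in_itv /=; apply/andP; split; first by rewrite /th divr_ge0 // ltW.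
    by rewrite /th ler_pdivrMr // mul1r; exact: edge_le.
  have rE : rho ((Y, p.2), th) = sd S p.
    transitivity (eps * ((1 - th) * gbar false p + th * gbar true p)); first by rewrite -!hE.
    have -> : eps * ((1 - th) * gbar false p + th * gbar true p) =
      eps * gbar false p + th * (eps * (gbar true p - gbar false p)) by ring.
    by rewrite thE /edge /side; ring.
  rewrite /M /tube_map /= rE Yy [RHS]surjective_pairing; congr pair.
  by rewrite [RHS]py.
apply: continuous_compact; last first.
  have [_ cG _] : [/\ Gam S 0 !=set0, compact (Gam S 0) & connected (Gam S 0)].
    by apply: (Gam_closed_connected hS); rewrite in_itv /= lexx ltW.
  by apply: compact_setX; [apply: compact_setX => //|]; exact: segment_compact.
apply/subspace_continuousP => -[a th] [/= ha hth].
have FF : Filter (within dom (nbhs (a, th))) by exact: within_filter.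
have c1 : b.1 @[b --> within dom (nbhs (a, th))] --> a.
  by apply: cvg_within_filter; exact: cvg_fst.
have c2 : b.2 @[b --> within dom (nbhs (a, th))] --> th.
  by apply: cvg_within_filter; exact: cvg_snd.
have cPhi : (Phi S b.1, b.1.2) @[b --> within dom (nbhs (a, th))] -->
    within open_tube (nbhs (Phi S a, a.2)).
  have c1' : b.1 @[b --> within dom (nbhs (a, th))] --> within (Gam S 0 `*` `[0, T]) (nbhs a).
    move=> A hA; have := c1 _ hA; rewrite !near_simpl /= !near_withinE.
    by apply: filterS => -[b s] hb hbs; apply: hb => //; case: hbs.
  exact: (cvg_comp _ _ c1' (Phi_open_tube_cvg ha)).
have cg b : gbar b (Phi S c.1, c.1.2) @[c --> within dom (nbhs (a, th))] --> gbar b (Phi S a, a.2).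
  have [oa _ _] := STbar_tube (Phi_STbar ha).
  exact: (cvg_comp _ _ cPhi (smooth_tube_near (smooth_gbar b) oa)).
have crho : rho c @[c --> within dom (nbhs (a, th))] --> rho (a, th).
  apply: cvgM; first exact: cvg_cst.
  apply: cvgD; apply: cvgM; [|exact: cg|exact: c2|exact: cg].
  by apply: cvgB; [exact: cvg_cst|exact: c2].
have hin c : dom c -> tube_domain (c.1, rho c).
  move=> hc; split; first by case: hc.
  rewrite /= in_itv /= -ler_norml; exact: le_trans (rho_le _ hc) (ltW dd).
have c3 : (c.1, rho c) @[c --> within dom (nbhs (a, th))] --> within tube_domain (nbhs (a, rho (a, th))).
  have := cvg_pair_to c1 crho => cq A /cq; rewrite !near_simpl /= !near_withinE.
  by apply: filterS => c hA hc; apply: hA => //; exact: hin.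
have /subspace_continuousP tc := tube_map_continuous.
exact: (cvg_comp _ _ c3 (tc _ (hin (a, th) (conj ha hth)))).
Qed.

(** * Normal and normal velocity of the lateral boundary *)

Lemma xgrad_edge b p : open_tube p ->
  xgrad (edge eps b) p = side b *: (eps *: xgrad (gbar b) p - normal p).
Proof.
move=> op; have dg := smooth_tube_differentiable (smooth_gbar b) op.
have ds := smooth_tube_differentiable smooth_tube_sd op.
have [_ _ _ <-] := foot_spec (open_tube_NTbar op).
apply/rowP => i; rewrite !mxE.
have dZ : differentiable (fun x => eps * gbar b (x, p.2)) p.1.
  by apply: differentiableM.
rewrite -[LHS]/(pd i (fun q => side b * (eps * gbar b q + - sd S q)) p).
rewrite pd_sliceM; last 2 first.
- exact: differentiable_cst.
- by apply: differentiableD => //; exact: differentiableN.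
rewrite pd_sliceD //; last exact: differentiableN.
rewrite pd_sliceM // [pd i (fun=> side b) p]derive_cst [pd i (fun=> eps) p]derive_cst !mulr0 !addr0.
congr (_ * (_ + _)).
by rewrite /pd -[LHS]/('D_(delta_mx 0 i) (- (fun x => sd S (x, p.2))) p.1) deriveN //; exact: diff_derivable.
Qed.

Lemma dotv_normal_gbar b p : open_tube p -> dotv (normal p) (xgrad (gbar b) p) = 0.
Proof.
move=> op; apply: normal_derive_eq0 => //; last exact: (smooth_tube_differentiable (smooth_gbar b)).
by move=> q oq; rewrite /gbar -[LHS]cext_foot.
Qed.

Lemma gdot_edge b p : open_tube p ->
  gdot (edge eps b) (edge eps b) p = 1 + eps ^+ 2 * gdot (gbar b) (gbar b) p.
Proof.
move=> op; rewrite /gdot xgrad_edge // dotvZl dotvZr mulrA side2 mul1r.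
rewrite !(dotvDl, dotvDr, dotvNl, dotvNr, dotvZl, dotvZr) dotv_normal_gbar // (dotvC _ (normal p)) dotv_normal_gbar //.
by rewrite dotv_normal //; [ring|exact: open_tube_NTbar].
Qed.

Lemma gdot_edge_gt0 b p : open_tube p -> 1 <= gdot (edge eps b) (edge eps b) p.
Proof.
by move=> op; rewrite gdot_edge // lerDl mulr_ge0 ?sqr_ge0 // dotv_ge0.
Qed.

(** The curve is the straight line pushed back to the boundary along the normal; the
correction is of higher order because v is orthogonal to the gradient. *)
Lemma boundary_tangent b p v : pos_tube p -> edge eps b p = 0 ->
  dotv v (xgrad (edge eps b) p) = 0 -> tangent (boundary (Omega S g0 g1 eps p.2)) p.1 v.
Proof.
move=> [op _] b0 v0; have pT : p.2 \in `[0, T] by case: op.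
pose x (s : R) : E := (p.1 + s *: v, p.2).
have x0 : x 0 = p by rewrite /x scale0r addr0 -surjective_pairing.
pose gam s : 'rV[R]_n := p.1 + s *: v + (side b * edge eps b (x s)) *: (\row_i pd i (sd S) (x s)).
exists gam; split.
- by rewrite /gam x0 b0 mulr0 scale0r scale0r !addr0.
- apply: filterS (near_line v pT (open_tube_near op)) => s; rewrite -/(x s) => os.
  have hN := open_tube_NTbar os; have hq := STbar_foot hN.
  have [d dd hd] := thin_radius.
  have rd : `|eps * gbar b (x s)| < delta S.
    by apply: le_lt_trans dd; rewrite normrM (gtr0_norm eps_gt0); exact: hd.
  have gE : gam s = foot S (x s) + (eps * gbar b (x s)) *: nu S (foot S (x s), p.2).
    rewrite /gam; have -> : \row_i pd i (sd S) (x s) = normal (x s).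
      by apply/rowP => i; rewrite mxE normalE.
    have [_ xE _ _] := foot_spec hN; rewrite -[p.1 + s *: v]/((x s).1) {1}xE -addrA -scalerDl.
    have -> // : sd S (x s) + side b * edge eps b (x s) = eps * gbar b (x s).
    by rewrite /edge mulrA side2 mul1r addrC subrK.
  apply/boundary_OmegaE => //; rewrite gE; split.
  + exact: (open_tube_ray hq rd).
  + move=> b'; rewrite (ray_edge _ hq rd) /= -gbarE.
    have hgap := mulr_gt0 eps_gt0 (lt_le_trans gmin0 (gap_ge os)).
    by rewrite -/(x s); move: hgap; case: (b); case: b'; rewrite /side; lra.
  + by exists b; rewrite (ray_edge _ hq rd) /= -gbarE subrr mulr0.
- have di i : is_derive (0 : R) 1 (fun s => gam s 0 i) (v 0 i).
    have d1 : is_derive (0 : R) 1 (fun s : R => p.1 0 i + s * v 0 i) (v 0 i).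
      by apply: is_derive_eq; rewrite /GRing.scale /=; ring.
    have d2 := smooth_tube_line v (smooth_edge eps b) op; rewrite v0 in d2.
    have d3 := smooth_tube_line v (smooth_tube_pd smooth_tube_sd i) op.
    have d4 : is_derive (0 : R) 1 (fun s : R => side b) 0 by exact: is_derive_cst.
    have d5 := is_deriveD d1 (is_deriveM (is_deriveM d4 d2) d3).
    have -> : (fun s => gam s 0 i) = (fun s : R => p.1 0 i + s * v 0 i) +
       ((fun s : R => side b) * (fun s : R => edge eps b (x s))) * (fun s : R => pd i (sd S) (x s)).
      by apply/funext => s; rewrite /gam !mxE.
    apply: is_derive_eq d5 _.
    rewrite [X in X *: dotv _ _](_ : _ = 0); last first.
      by rewrite -[LHS]/(side b * edge eps b (x 0)) x0 b0 mulr0.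
    by rewrite !scaler0 scale0r addr0 scaler0 !addr0.
  have dg : derivable gam 0 1.
    by apply/derivable_mxP => j i; rewrite (ord1 j); case: (di i).
  apply: DeriveDef => //; apply/rowP => i; rewrite derive_mx // mxE.
  by case: (di i).
Qed.

(** All vectors orthogonal to the gradient of [edge] are tangent vectors, so the
normal is a multiple of this gradient; the sign is determined by the side on which
[edge] is positive. *)
Lemma lateral_normal b p ne : pos_tube p -> (forall b', 0 <= edge eps b' p) ->
  edge eps b p = 0 ->
  unit_outward_normal (Omega S g0 g1 eps p.2) (boundary (Omega S g0 g1 eps p.2)) p.1 ne ->
  exists2 m, 0 < m & m *: ne = - xgrad (edge eps b) p.
Proof.
move=> pp hp b0 [ne1 neT neS]; have op := pos_open pp.
have pT : p.2 \in `[0, T] by case: op.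
set g := xgrad (edge eps b) p; have gg : 1 <= dotv g g by exact: gdot_edge_gt0.
have gg0 : 0 < dotv g g by exact: lt_le_trans gg.
pose lam := dotv ne g / dotv g g.
have v0 : dotv (ne - lam *: g) g = 0.
  by rewrite dotvDl dotvNl dotvZl /lam divfK ?subrr // gt_eqF.
have neE : ne = lam *: g.
  apply/eqP; rewrite -subr_eq0 -enorm_eq0 -sqrf_eq0 enorm_sqr dotvDr dotvNr dotvZr v0 mulr0 subr0.
  by rewrite dotvC neT //; exact: boundary_tangent b0 v0.
have lam0 : lam != 0.
  apply/eqP => l0; move: ne1; rewrite neE l0 scale0r enorm0 => /eqP.
  by rewrite eq_sym oner_eq0.
have lamneg : lam < 0.
  rewrite lt_neqAle lam0 /= leNgt; apply/negP => lpos.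
  have d1 := smooth_tube_line (- ne) (smooth_edge eps b) op.
  have d2 := is_deriveN d1.
  have d2E : is_derive (0 : R) 1 (- (fun r : R => edge eps b (p.1 + r *: - ne, p.2))) (lam * dotv g g).
    by apply: is_derive_eq d2 _; rewrite dotvNl opprK neE dotvZl.
  have [|r r0 hr] := derive_gt0_right d2E (mulr_gt0 lpos gg0).
    by rewrite /= -[LHS]/(- (edge eps b (p.1 + 0 *: - ne, p.2))) scale0r addr0 -surjective_pairing b0 oppr0.
  have [e /= e0 he] := neS.
  pose s := Num.min r e / 2.
  have m0 : 0 < Num.min r e by rewrite lt_min r0.
  have s0 : 0 < s by rewrite divr_gt0.
  have sm : s < Num.min r e by rewrite /s; lra.
  have se : s < e by apply: lt_le_trans sm _; rewrite ge_min lexx orbT.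
  have sr : s < r by apply: lt_le_trans sm _; rewrite ge_min lexx.
  have [||Os _] := he s; [by rewrite /ball /= sub0r normrN gtr0_norm|by []|].
  have [_ /(_ b)] := (OmegaE pT _).1 Os.
  have := hr s s0 sr; rewrite -[X in 0 < X -> _]/(- (edge eps b (p.1 + s *: - ne, p.2))).
  by rewrite scalerN; lra.
exists (- lam^-1); first by rewrite oppr_gt0 invr_lt0.
by rewrite neE scalerA mulNr mulVf // scaleN1r.
Qed.

(** Any curve on the boundary gives the velocity: differentiate [edge = 0] along it. *)
Lemma lateral_velocity b p ne m V : pos_tube p -> (forall b', 0 <= edge eps b' p) ->
  edge eps b p = 0 -> m *: ne = - xgrad (edge eps b) p ->
  normal_velocity T (fun t => boundary (Omega S g0 g1 eps t)) p ne V ->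
  m * V = pt T (edge eps b) p.
Proof.
move=> pp hp b0 mne [[gam [w [gp gB gw]]] hV]; have op := pos_open pp.
have pT : p.2 \in `[0, T] by case: op.
rewrite (hV gam w) //.
have d1 := smooth_tube_chain (smooth_edge eps b) op gp gw.
have gc := is_tderive_cvg gw; rewrite gp in gc.
have other : \forall s \near tn p.2, 0 < edge eps (~~ b) (gam s, s).
  by apply: near_curve gc (edge_near op (edge_flip_gt0 op b0)).
have d2 : is_tderive T (fun s => edge eps b (gam s, s)) p.2 0.
  apply: is_tderive_near (is_tderive_cst T (0 : R) p.2).
    by rewrite gp -surjective_pairing b0.
  apply: filterS2 other (tn_itv T p.2) => s hs sT.
  have [_ _ [b' hb']] := (boundary_OmegaE sT _).1 (gB s sT).
  have [<-//|bb] := eqVneq b' b.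
  have bE : b' = ~~ b by clear -bb; case: b bb; case: b'.
  by move: hs; rewrite -bE hb' ltxx.
have := is_tderive_unique T0 pT d1 d2.
rewrite -dotvZr mne dotvNr => /eqP; rewrite addr_eq0 => /eqP ->.
by rewrite opprK.
Qed.

(** * The maximum principle *)

Lemma QT_near p : Q p -> \forall q \near p, q.2 \in `[0, T] -> Q q.
Proof.
move=> /QTE[pp hp].
apply: filterS3 (pos_tube_near pp) (edge_near (pos_open pp) (hp true)) (edge_near (pos_open pp) (hp false)).
move=> q pq h1 h0 qT; apply/QTE; split; first exact: pq.
by case; [exact: h1|exact: h0].
Qed.

Lemma QT_QTbar p : Q p -> Qbar p.
Proof. by move=> /QTE[/pos_open op hp]; apply/QTbarE; split=> // b; exact: ltW. Qed.

Lemma dQT_QTbar p : dQ p -> Qbar p.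
Proof. by move=> /dQTE[/pos_open op hp _]; apply/QTbarE; split. Qed.

Lemma QTbar_cases p : Qbar p -> [\/ p.2 = 0, Q p | dQ p].
Proof.
move=> /QTbarE[op hp]; have pT : p.2 \in `[0, T] by case: op.
have [p0|p0] := leP p.2 0.
  by apply: Or31; apply/eqP; rewrite eq_le p0; move: pT; rewrite in_itv /= => /andP[].
have pp : pos_tube p by split.
have [hb|hb] := pselect (exists b, edge eps b p = 0).
  by apply: Or33; apply/dQTE; split.
apply: Or32; apply/QTE; split=> // b; rewrite lt_neqAle hp andbT eq_sym.
by apply/eqP => b0; apply: hb; exists b.
Qed.

Section Comparison.
Hypothesis kd0 : 0 < kd.
Variables (nueps : E -> 'rV[R]_n) (Veps : E -> R).
Hypothesis hnu : forall p, dQ p ->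
  unit_outward_normal (Omega S g0 g1 eps p.2) (boundary (Omega S g0 g1 eps p.2)) p.1 (nueps p).
Hypothesis hV : forall p, dQ p ->
  normal_velocity T (fun t => boundary (Omega S g0 g1 eps t)) p (nueps p) (Veps p).

Variables (rho : E -> R) (G : E -> 'rV[R]_n).
Hypothesis rhoc : {within Qbar, continuous rho}.
Hypothesis rhot : forall p, Q p -> pt_derivable T rho p.
Hypothesis rhoxx : forall i p, Q p -> pderivable i (pd i rho) p.
Hypothesis rhox : forall i p, Q p -> pderivable i rho p /\ G p 0 i = pd i rho p.
Hypothesis Gc : {within Q `|` dQ, continuous G}.
Hypothesis rhoBC : forall p, dQ p -> dotv (nueps p) (G p) + kd^-1 * Veps p * rho p = 0.

(** The boundary operator multiplied by [kd] times the length of the gradient of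
[edge], see [lateral_normal] and [lateral_velocity]. *)
Definition lateral_op b f p : R :=
  - kd * gdot (edge eps b) f p + pt T (edge eps b) p * f p.

(** Only partial derivatives are given; that they are continuous is part of the
hypothesis on the extended gradient. *)
Lemma rho_differentiable p : Q p ->
  differentiable (fun x => rho (x, p.2)) p.1 /\ xgrad rho p = G p.
Proof.
move=> Qp; have pT : p.2 \in `[0, T] by have /QTE[/pos_tube_itv] := Qp.
split; last first.
  by apply/rowP => i; rewrite mxE; have [_ ->] := rhox i Qp.
have nQ := near_slice pT (QT_near Qp).
apply: (@differentiable_of_partials _ _ _ (fun x => G (x, p.2))).
  apply: filterS nQ => x Qx i; have [dx Gx] := rhox i Qx.
  by apply: DeriveDef; [exact: dx|rewrite Gx].
have /subspace_continuousP/(_ p (or_introl Qp)) c := Gc.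
have cx : (x, p.2) @[x --> p.1] --> within (Q `|` dQ) (nbhs p).
  move=> A hA; have hA' : \forall q \near p, q.2 \in `[0, T] -> A q.
    apply: filterS2 (QT_near Qp) hA => q Qq hq qT; apply: hq; left; exact: Qq.
  exact: near_slice pT hA'.
rewrite /prop_for /continuous_at -surjective_pairing; exact: (cvg_comp _ _ cx c).
Qed.

(** The solution has derivatives in the open domain only, and a gradient that extends
continuously to the boundary: the mean value theorem on the inner normal compares
it with the function touching it from above. *)
Lemma lateral_max_derivative p (k : 'rV[R]_n -> R) : dQ p ->
  differentiable k p.1 -> rho p = k p.1 ->
  (forall q, Qbar q -> q.2 = p.2 -> rho q <= k q.1) ->
  dotv (nueps p) (grad k p.1) <= dotv (nueps p) (G p).
Proof.
move=> dp dk kp hle; set ne := nueps p; rewrite leNgt; apply/negP => lt0.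
have pT : p.2 \in `[0, T] by have /dQTE[/pos_tube_itv] := dp.
have pos : p.2 \in `]0, T] by case: dp.
have [_ _ neS] := hnu dp; rewrite -/ne in neS.
pose A0 := dotv ne (G p); pose B0 := dotv ne (grad k p.1); pose c := (A0 + B0) / 2.
have [Ac cB] : A0 < c /\ c < B0 by rewrite /c /A0 /B0; split; lra.
pose x (s : R) : E := (p.1 - s *: ne, p.2).
have x0 : x 0 = p by rewrite /x scale0r subr0 -surjective_pairing.
have xE s : x s = (p.1 + s *: - ne, p.2) by rewrite /x scalerN.
have [e1 /= e10 he1] := neS.
have xQ s : 0 < s -> s < e1 -> Q (x s).
  move=> s0 se; split=> //=.
  by have [||] := he1 s; [rewrite /ball /= sub0r normrN gtr0_norm|by []|].
have xc : x s @[s --> (0 : R)] --> p.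
  have c1 : p.1 - s *: ne @[s --> (0 : R)] --> p.1.
    rewrite -[X in _ --> X]subr0 -(scale0r ne); apply: cvgB; first exact: cvg_cst.
    by apply: cvgZr_tmp; exact: cvg_id.
  have c2 : (fun _ : R => p.2) s @[s --> (0 : R)] --> p.2 by exact: cvg_cst.
  have c3 : x s @[s --> (0 : R)] --> (p.1, p.2) by exact: cvg_pair_to.
  by rewrite -surjective_pairing in c3.
have [e2 /= e20 he2] : \forall s \near (0 : R), (Q `|` dQ) (x s) -> dotv ne (G (x s)) < c.
  have /subspace_continuousP/(_ p (or_intror dp)) cG := Gc.
  have FF : Filter (within (Q `|` dQ) (nbhs p)) by exact: within_filter.
  have cd : dotv ne (G q) @[q --> within (Q `|` dQ) (nbhs p)] --> A0.
    exact: cvg_dotv (cvg_cst ne) cG.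
  have := @cvgr_lt _ _ _ FF _ _ cd _ Ac; rewrite near_withinE => h.
  exact: xc h.
have := @derive_gt0_right R (fun s => k p.1 - k (p.1 + s *: - ne) - c * s) (B0 - c).
case=> [|||e3 e30 he3].
- have := @is_derive_line _ _ k p.1 (- ne) 0; rewrite scale0r addr0 => /(_ dk) d1.
  have d2 : is_derive (0 : R) 1 (fun s : R => k p.1 - c * s) (- c).
    by apply: is_derive_eq; rewrite /GRing.scale /=; ring.
  have d3 := is_deriveB d2 d1.
  have -> : (fun s : R => k p.1 - k (p.1 + s *: - ne) - c * s) =
    (fun s : R => k p.1 - c * s) - (fun s : R => k (p.1 + s *: - ne)).
    by apply/funext => s; rewrite -[RHS]/(k p.1 - c * s - k (p.1 + s *: - ne)); ring.
  by apply: is_derive_eq d3 _; rewrite dotvNl opprK addrC.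
- by rewrite subr_gt0.
- by rewrite scale0r addr0 mulr0 subrr subr0.
have [s [s0 s1 s2 s3]] : exists s, [/\ 0 < s, s < e1, s < e2 & s < e3].
  have m0 : 0 < Num.min e1 (Num.min e2 e3) by rewrite !lt_min e10 e20 e30.
  exists (Num.min e1 (Num.min e2 e3) / 2); split.
  - by rewrite divr_gt0.
  - by apply: (@lt_le_trans _ _ (Num.min e1 (Num.min e2 e3))); [lra|rewrite ge_min lexx].
  - by apply: (@lt_le_trans _ _ (Num.min e1 (Num.min e2 e3))); [lra|rewrite !ge_min lexx orbT].
  - by apply: (@lt_le_trans _ _ (Num.min e1 (Num.min e2 e3))); [lra|rewrite !ge_min lexx !orbT].
have dr r : r \in `]0, s[ -> is_derive r 1 (fun r => rho (x r)) (- dotv ne (G (x r))).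
  rewrite in_itv /= => /andP[r0 rs]; have Qr := xQ r r0 (lt_trans rs s1).
  have [dr <-] := rho_differentiable Qr.
  have := @is_derive_line _ _ (fun y => rho (y, p.2)) p.1 (- ne) r.
  rewrite -[p.1 + r *: - ne]/((p.1 + r *: - ne, p.2).1) -xE => /(_ dr); rewrite dotvNl.
  by apply: near_eq_is_derive; near=> r'; rewrite xE.
have := @MVT _ _ _ _ _ s0 dr; case=> [|r rs].
  apply/subspace_continuousP => r; rewrite /= in_itv /= => /andP[r0 rs].
  have xQb r' : 0 <= r' -> r' <= s -> Qbar (x r').
    rewrite le_eqVlt => /orP[/eqP<- _|r'0 r's]; first by rewrite x0; exact: dQT_QTbar.
    by apply: QT_QTbar; apply: xQ => //; exact: le_lt_trans s1.
  have /subspace_continuousP/(_ _ (xQb r r0 rs)) cr := rhoc.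
  have cx : x r' @[r' --> within `[0, s] (nbhs r)] --> within Qbar (nbhs (x r)).
    have c1 : x r' @[r' --> within `[0, s] (nbhs r)] --> x r.
      apply: cvg_within_filter.
      have c1 : p.1 - r' *: ne @[r' --> r] --> p.1 - r *: ne.
        by apply: cvgB; [exact: cvg_cst|apply: cvgZr_tmp; exact: cvg_id].
      have c2 : (fun _ : R => p.2) r' @[r' --> r] --> p.2 by exact: cvg_cst.
      exact: cvg_pair_to.
    move=> A hA; have := c1 _ hA; rewrite !near_simpl /= !near_withinE.
    apply: filterS => r' h; rewrite /= in_itv /= => /andP[r'0 r's].
    by apply: (h _ (xQb _ r'0 r's)); rewrite /= in_itv /= r'0.
  exact: (cvg_comp _ _ cx cr).
rewrite subr0 x0 => hM; move: rs; rewrite in_itv /= => /andP[r0 rs].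
have hr : dotv ne (G (x r)) < c.
  apply: he2; first by rewrite /ball /= sub0r normrN gtr0_norm // (lt_trans rs).
  by left; apply: xQ => //; exact: lt_trans s1.
have := hle _ (QT_QTbar (xQ s s0 s1)) erefl; rewrite {2}/x /=.
have := he3 s s0 s3; rewrite scalerN => h3 h4.
have h5 : dotv ne (G (x r)) * s < c * s by rewrite ltr_pM2r.
move: hM h3 h4 h5; rewrite kp; move: (rho (x s)) (k _) (k _) (dotv _ _) => a b1 b2 d.
by rewrite mulNr => *; lra.
Unshelve. all: by end_near. Qed.

Lemma contact_le (a b c d : R) : a <= b -> c = d -> a - b <= c - d.
Proof. by move=> ab ->; lra. Qed.

Lemma contact_heat (a b c d k : R) : 0 <= a - b -> k * (c - d) <= 0 ->
  0 <= (a - k * c) - (b - k * d).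
Proof. by move=> h1 h2; lra. Qed.

Lemma contact_interior (a b c m M : R) : 0 <= a - (b + m * c) -> M * c < m * c ->
  a - b <= M * c -> False.
Proof. by move=> h1 h2 h3; lra. Qed.

Lemma contact_lateral (a c m M : R) : a + m * c <= 0 -> M * c < m * c ->
  - a <= M * c -> False.
Proof. by move=> h1 h2 h3; lra. Qed.

Lemma contact_split (k x y z v w m : R) :
  - k * (x + m * y) + z * (v + m * w) = (- k * x + z * v) + m * (- k * y + z * w).
Proof. by ring. Qed.

Lemma contact_bc (k m V r : R) : k != 0 -> m * V * r = - k * (m * - (k^-1 * V * r)).
Proof. by move=> k0; field. Qed.

Lemma contact_flux (k m a c : R) : k * m * a <= k * m * c ->
  - k * - (m * a) + - k * (m * c) <= 0.
Proof. by move=> h; lra. Qed.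

(** Let m be the maximum of (rho - v) / psi and suppose m > M. Then v + m psi touches
rho from above at a point. Touching at time 0 contradicts the initial condition;
touching in the interior contradicts the heat inequality, by the signs of first
time and second space derivatives at a maximum; touching on the lateral boundary
contradicts the boundary inequality, by [lateral_max_derivative]. The zero order
term of the boundary condition has no sign; dividing by psi is what removes it. *)
Lemma comparison (v psi : E -> R) (M : R) :
  heat_regular v -> heat_regular psi ->
  {within Qbar, continuous v} -> {within Qbar, continuous psi} ->
  (forall p, Qbar p -> 0 < psi p) ->
  (forall p, Qbar p -> p.2 = 0 -> rho p - v p <= M * psi p) ->
  (forall p, Q p -> 0 < heat psi p /\ heat rho p - heat v p <= M * heat psi p) ->
  (forall p b, dQ p -> edge eps b p = 0 ->
    0 < lateral_op b psi p /\ - lateral_op b v p <= M * lateral_op b psi p) ->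
  forall p, Qbar p -> rho p - v p <= M * psi p.
Proof.
move=> rv rpsi vc psic psi0 hinit hint hlat p0 Qp0.
have qc : {within Qbar, continuous (fun p => (rho p - v p) / psi p)}.
  apply/subspace_continuousP => q Qq.
  have FF : Filter (within Qbar (nbhs q)) by exact: within_filter.
  have /subspace_continuousP/(_ q Qq) c1 := rhoc.
  have /subspace_continuousP/(_ q Qq) c2 := vc.
  have /subspace_continuousP/(_ q Qq) c3 := psic.
  by apply: cvgM; [exact: cvgB|apply: cvgV; rewrite ?gt_eqF ?psi0].
have [|p] := compact_EVT_max _ QTbar_compact qc; first by exists p0.
rewrite inE => Qp hmax; set m := (rho p - v p) / psi p in hmax.
have hm q : Qbar q -> rho q - v q <= m * psi q.
  by move=> Qq; rewrite -ler_pdivrMr ?psi0 //; apply: hmax; rewrite inE.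
have mp : rho p - v p = m * psi p by rewrite /m divfK // gt_eqF // psi0.
(* From here on, m is the maximum of the quotient, attained at p. *)
suff mM : m <= M by apply: le_trans (hm _ Qp0) _; rewrite ler_wpM2r // ltW // psi0.
rewrite leNgt; apply/negP => Mm.
pose k q := v q + m * psi q; have rmpsi := heat_regularZ m rpsi; have rk := heat_regularD rv rmpsi.
have kle q : Qbar q -> rho q <= k q by move=> /hm; rewrite /k lerBlDl.
have kp : rho p = k p by rewrite /k -mp addrC subrK.
case: (QTbar_cases Qp) => [p00|Qp'|dp].
- by have := hinit _ Qp p00; rewrite mp ler_pM2r ?psi0 // leNgt Mm.
- have /QTE[pp _] := Qp'; have pT := pos_tube_itv pp.
  have [hp1 hp2] := hint _ Qp'.
  have nQ := near_slice pT (QT_near Qp').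
  have tge : 0 <= pt T rho p - pt T k p.
    have d1 := tderivableP T0 pT (rhot Qp').
    have d2 := heat_regular_is_pt rk pp.
    have d3 := is_tderiveD d1 (is_tderiveZ (a := -1) d2).
    rewrite mulN1r in d3; apply: is_tderive_ge0 d3 _.
      by case: Qp'.
    have QT0 : Q (p.1, p.2) by rewrite -surjective_pairing.
    have nt : \forall s \near p.2, s \in `[0, T] -> Q (p.1, s).
      apply: tn_near => //.
      exact: near_curve (cvg_cst p.1) (QT_near Qp').
    apply: filterS nt => s h sT; rewrite -surjective_pairing !mulN1r.
    by apply: contact_le kp; apply: kle; exact: QT_QTbar (h sT).
  have xle i : pd i (pd i rho) p - pd i (pd i k) p <= 0.
    pose e : 'rV[R]_n := delta_mx 0 i; pose h x := rho (x, p.2) - k (x, p.2).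
    have nP := pos_slice pp.
    have dh : \forall y \near p.1, is_derive y e h (pd i rho (y, p.2) - pd i k (y, p.2)).
      apply: filterS2 nQ nP => y Qy py.
      have [d1 _] := rhox i Qy; have d2 := heat_regular_x rk py.
      have i1 : is_derive y e (fun x => rho (x, p.2)) (pd i rho (y, p.2)).
        exact (DeriveDef d1 erefl).
      have i2 : is_derive y e (fun x => k (x, p.2)) (pd i k (y, p.2)).
        exact (DeriveDef (diff_derivable d2) erefl).
      exact (is_deriveB i1 i2).
    have E1 : \forall y \near p.1, pd i rho (y, p.2) - pd i k (y, p.2) = 'D_e h y.
      by apply: filterS dh => y [].
    have d1 : derivable (fun x => pd i rho (x, p.2)) p.1 e by exact: rhoxx.
    have d2 : derivable (fun x => pd i k (x, p.2)) p.1 e.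
      by apply: diff_derivable; exact: heat_regular_xx.
    have dd : is_derive p.1 e ('D_e h) (pd i (pd i rho) p - pd i (pd i k) p).
      apply: near_eq_is_derive E1 _.
      have i1 : is_derive p.1 e (fun x => pd i rho (x, p.2)) (pd i (pd i rho) p).
        exact (DeriveDef d1 erefl).
      have i2 : is_derive p.1 e (fun x => pd i k (x, p.2)) (pd i (pd i k) p).
        exact (DeriveDef d2 erefl).
      exact (is_deriveB i1 i2).
    rewrite -(@derive_val _ _ _ _ _ _ _ dd); apply: second_derivative_le0.
    + by apply: filterS dh => y [].
    + by case: dd.
    + apply: filterS nQ => y Qy; rewrite /h -surjective_pairing.
      by apply: contact_le kp; exact: kle (QT_QTbar Qy).
  have lle : laplacian rho p - laplacian k p <= 0.
    by rewrite /laplacian -sumrB; apply: sumr_le0 => i _; exact: xle.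
  have hk : heat k p = heat v p + m * heat psi p by rewrite heatD // heatZ.
  have h1 : 0 <= heat rho p - heat k p.
    exact: contact_heat tge (mulr_ge0_le0 (ltW kd0) lle).
  have h2 : M * heat psi p < m * heat psi p by rewrite ltr_pM2r.
  by rewrite hk in h1; exact: contact_interior h1 h2 hp2.
- have /dQTE[pp hp [b b0]] := dp; have [hl1 hl2] := hlat _ b dp b0.
  have [mm mm0 mne] := lateral_normal pp hp b0 (hnu dp).
  have mV := lateral_velocity pp hp b0 mne (hV dp).
  have dk := heat_regular_x rk pp.
  have := lateral_max_derivative dp dk.
  rewrite -surjective_pairing => /(_ kp) h; have {}h := h _.
  have h1 : dotv (nueps p) (xgrad k p) <= dotv (nueps p) (G p).
    by apply: h => q Qq qp; rewrite -qp -surjective_pairing; exact: kle.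
  have BC := rhoBC dp.
  have Lk : lateral_op b k p = lateral_op b v p + m * lateral_op b psi p.
    rewrite /lateral_op /k (gdotC _ (fun q => _)) gdotDl // gdotZl // !(gdotC (edge eps b)).
    exact: contact_split.
  have h2 : lateral_op b k p <= 0.
    have e1 : gdot (edge eps b) k p = - (mm * dotv (nueps p) (xgrad k p)).
      by rewrite /gdot -dotvZl mne dotvNl opprK.
    have e2 : pt T (edge eps b) p * k p = - kd * (mm * dotv (nueps p) (G p)).
      rewrite -mV -kp; move: BC => /eqP; rewrite addr_eq0 => /eqP ->.
      by apply: contact_bc; rewrite gt_eqF.
    rewrite /lateral_op e1 e2.
    have := ler_wpM2l (ltW (mulr_gt0 kd0 mm0)) h1.
    exact: contact_flux.
  have h3 : M * lateral_op b psi p < m * lateral_op b psi p by rewrite ltr_pM2r.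
  by rewrite Lk in h2; exact: contact_lateral h2 h3 hl2.
Qed.

End Comparison.

End FixedThickness.

Let eps0_lt1 : eps0 < 1. Proof. by case/andP: heps0. Qed.

(** * Orders of magnitude in the thickness *)

Definition thin_dom (eps : R) p : Prop :=
  [/\ 0 < eps < eps0, open_tube p & forall b, 0 <= edge eps b p].

Definition order (k : nat) (c : R -> E -> R) : Prop :=
  exists2 C, 0 <= C & forall eps p, thin_dom eps p -> `|c eps p| <= C * eps ^+ k.

Lemma thin_eps eps p : thin_dom eps p -> 0 <= eps <= 1.
Proof. by case=> /andP[e0 e1] _ _; rewrite ltW //= ltW // (lt_trans e1). Qed.

Lemma orderW k k' c : (k' <= k)%N -> order k c -> order k' c.
Proof.
move=> kk [C C0 hC]; exists C => // eps p hp; apply: le_trans (hC _ _ hp) _.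
have /andP[e0 e1] := thin_eps hp.
by rewrite ler_wpM2l //; exact: ler_wiXn2l.
Qed.

Lemma order_eq k c c' : (forall eps p, thin_dom eps p -> c eps p = c' eps p) ->
  order k c -> order k c'.
Proof. by move=> cc [C C0 hC]; exists C => // eps p hp; rewrite -cc //; exact: hC. Qed.

Lemma orderD k c c' : order k c -> order k c' -> order k (fun eps p => c eps p + c' eps p).
Proof.
move=> [C C0 hC] [D D0 hD]; exists (C + D) => [|eps p hp]; first exact: addr_ge0.
by apply: le_trans (ler_normD _ _) _; rewrite mulrDl lerD ?hC ?hD.
Qed.

Lemma orderM k k' c c' : order k c -> order k' c' ->
  order (k + k') (fun eps p => c eps p * c' eps p).
Proof.
move=> [C C0 hC] [D D0 hD]; exists (C * D) => [|eps p hp]; first exact: mulr_ge0.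
rewrite normrM exprD mulrACA; apply: ler_pM => //; [exact: hC|exact: hD].
Qed.

Lemma orderN k c : order k c -> order k (fun eps p => - c eps p).
Proof. by move=> [C C0 hC]; exists C => // eps p hp; rewrite normrN; exact: hC. Qed.

Lemma orderB k c c' : order k c -> order k c' -> order k (fun eps p => c eps p - c' eps p).
Proof. by move=> h h'; apply: orderD => //; exact: orderN. Qed.

Lemma order_smooth f : smooth_tube f -> order 0 (fun=> f).
Proof.
move=> sf; have [C [C0 hC]] := smooth_tube_bounded sf.
exists C => [|eps p [_ op _]]; first exact: ltW.
by rewrite expr0 mulr1 hC.
Qed.

Lemma order_cst a : order 0 (fun _ _ => a).
Proof. exact: order_smooth (smooth_tube_cst a). Qed.

Lemma order_eps : order 1 (fun eps _ => eps).
Proof.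
exists 1 => // eps p hp; have /andP[e0 _] := thin_eps hp.
by rewrite mul1r expr1 ger0_norm.
Qed.

Lemma orderMl k c c' : order 0 c -> order k c' -> order k (fun eps p => c eps p * c' eps p).
Proof. exact: orderM. Qed.

Lemma orderMr k c c' : order k c -> order 0 c' -> order k (fun eps p => c eps p * c' eps p).
Proof. by move=> h h'; have := orderM h h'; rewrite addn0. Qed.

Lemma orderZ k a c : order k c -> order k (fun eps p => a * c eps p).
Proof. exact: orderMl (order_cst a). Qed.

Lemma order_edge b : order 1 (fun eps => edge eps b).
Proof.
have [C [C0 hC]] : exists C : R, 0 < C /\ forall p, open_tube p -> `|gbar true p - gbar false p| <= C.
  apply: smooth_tube_bounded; apply: smooth_tubeD; first exact: smooth_gbar.
  by apply: smooth_tube_eq (smooth_tubeZ (-1) (smooth_gbar false)) => p _; exact: mulN1r.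
exists C => [|eps p hp]; first exact: ltW.
have /andP[e0 _] := thin_eps hp; case: hp => he op hb.
rewrite ger0_norm // expr1; apply: le_trans (edge_le b op hb) _.
by rewrite mulrC ler_wpM2r // (le_trans (ler_norm _)) // hC.
Qed.

Lemma order_sd : order 1 (fun=> sd S).
Proof.
have h : order 1 (fun eps p => eps * gbar true p - edge eps true p).
  apply: orderB; last exact: order_edge.
  exact: orderMr order_eps (order_smooth (smooth_gbar true)).
by apply: order_eq h => eps p _; rewrite /edge /side; ring.
Qed.

Lemma smooth_tubeN f : smooth_tube f -> smooth_tube (fun q => - f q).
Proof. by move=> sf; apply: smooth_tube_eq (smooth_tubeZ (-1) sf) => p _; exact: mulN1r. Qed.

Lemma smooth_gdot f g : smooth_tube f -> smooth_tube g -> smooth_tube (gdot f g).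
Proof.
move=> sf sg; apply: (@smooth_tube_eq (fun q => \sum_i pd i f q * pd i g q)).
  by move=> p _; apply: eq_bigr => i _; rewrite !mxE.
by apply: smooth_tube_sum => i; apply: smooth_tubeM; exact: smooth_tube_pd.
Qed.

Lemma smooth_laplacian f : smooth_tube f -> smooth_tube (laplacian f).
Proof. by move=> sf; apply: smooth_tube_sum => i; do 2 apply: smooth_tube_pd. Qed.

Lemma smooth_heat f : smooth_tube f -> smooth_tube (heat f).
Proof.
move=> sf; apply: smooth_tubeD; first exact: smooth_tube_pt.
by apply: smooth_tubeN; apply: smooth_tubeZ; exact: smooth_laplacian.
Qed.

(** The foot is at distance |d| = O(eps), and the derivative in the normal direction
is bounded on the whole segment. *)
Lemma order_foot f : smooth_tube f -> order 1 (fun _ p => f p - f (foot S p, p.2)).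
Proof.
move=> sf; have [C [C0 hC]] := smooth_tube_bounded (smooth_gdot smooth_tube_sd sf).
have [D D0 hD] := order_sd.
exists (D * C) => [|eps p hp]; first by rewrite mulr_ge0 // ltW.
case: (hp) => _ op _; have hN := open_tube_NTbar op; have hq := STbar_foot hN.
have [_ py _ _] := foot_spec hN.
have rd : `|sd S p| < delta S by case: op.
have in_ray s : s \in `[(0 : R), 1] -> `|s * sd S p| < delta S.
  rewrite in_itv /= => /andP[s0 s1]; apply: le_lt_trans rd.
  by rewrite normrM ger0_norm // ler_piMl.
have := @MVT_line _ _ (fun x => f (x, p.2)) (foot S p) (sd S p *: normal p).
case=> [s s01|s s01].
  rewrite scalerA; exact: (smooth_tube_differentiable sf (open_tube_ray hq (in_ray _ s01))).
rewrite -py -surjective_pairing => ->.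
rewrite dotvZl normrM mulrAC; apply: ler_pM => //; first exact: hD hp.
have os := open_tube_ray hq (in_ray _ s01).
have := hC _ os; rewrite /gdot; have [_ _ _ ->] := foot_spec (open_tube_NTbar os).
by rewrite (normal_ray hq (in_ray _ s01)) scalerA.
Qed.

Lemma gdot_sd_gbar b p : open_tube p -> gdot (sd S) (gbar b) p = 0.
Proof.
move=> op; rewrite /gdot; have [_ _ _ ->] := foot_spec (open_tube_NTbar op).
exact: dotv_normal_gbar.
Qed.

Lemma gdot_sd_invariant f p : smooth_tube f ->
  (forall q, open_tube q -> f q = f (foot S q, q.2)) -> open_tube p -> gdot (sd S) f p = 0.
Proof.
move=> sf hf op; rewrite /gdot; have [_ _ _ ->] := foot_spec (open_tube_NTbar op).
by apply: normal_derive_eq0 => //; exact: smooth_tube_differentiable.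
Qed.

Lemma gdot_sd_sd p : open_tube p -> gdot (sd S) (sd S) p = 1.
Proof.
move=> op; rewrite /gdot; have [_ _ _ ->] := foot_spec (open_tube_NTbar op).
by rewrite dotv_normal //; exact: open_tube_NTbar.
Qed.

Lemma gdot_edgel eps b f p : open_tube p ->
  gdot (edge eps b) f p = side b * (eps * gdot (gbar b) f p - gdot (sd S) f p).
Proof.
move=> op; rewrite /gdot xgrad_edge // dotvZl dotvDl dotvNl dotvZl.
by have [_ _ _ ->] := foot_spec (open_tube_NTbar op).
Qed.

Definition speed : E -> R := pt T (sd S).

Lemma smooth_speed : smooth_tube speed.
Proof. exact: smooth_tube_pt smooth_tube_sd. Qed.

Lemma speed_foot q : open_tube q -> speed q = speed (foot S q, q.2).
Proof.
by move=> oq; rewrite /speed !pt_sd //=; [rewrite foot_foot|exact: open_tube_foot].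
Qed.

Lemma gdot_sd_speed p : open_tube p -> gdot (sd S) speed p = 0.
Proof. exact: gdot_sd_invariant smooth_speed speed_foot. Qed.

Lemma pt_edge eps b p : pos_tube p -> pt T (edge eps b) p = side b * (eps * pt T (gbar b) p - speed p).
Proof.
move=> pp; have op := pos_open pp; have pT := pos_tube_itv pp.
have d1 := heat_regular_is_pt (smooth_heat_regular (smooth_gbar b)) pp.
have d2 := heat_regular_is_pt (smooth_heat_regular smooth_tube_sd) pp.
have d3 := is_tderiveZ (a := side b) (is_tderiveD (is_tderiveZ (a := eps) d1) (is_tderiveZ (a := -1) d2)).
rewrite mulN1r in d3; rewrite -(is_tderiveE T0 pT d3) /pt; congr (tderive _ _ _).
by apply/funext => s; rewrite /edge mulN1r.
Qed.

Lemma smooth_time : smooth_tube (fun p => p.2).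
Proof.
move=> p hp; exists setT, snd; split=> //; first by split=> //; exact: openT.
have ds q : is_diff q (snd : E -> R) snd.
  have sc : continuous (snd : E -> R) by move=> q'; exact: cvg_snd.
  apply: DiffDef; first exact: (@linear_differentiable _ _ _ (snd : {linear E -> R})).
  exact: (@diff_lin _ _ _ (snd : {linear E -> R})).
case=> [q _|k]; first exact: cvg_snd.
split=> [q _|v]; first by case: (ds q).
apply: (@Ck_open_eq _ _ _ _ _ _ (fun=> v.2)) => [|q _|].
- exact: openT.
- by case: (ds q) => d1 d2; rewrite deriveE // d2.
- by apply: Ck_open_cst; exact: openT.
Qed.

(** * Quantities bounded by the data of the limit problem *)

Definition controlled (zeta : E -> R) (N : R) : Prop :=
  [/\ C21 T S zeta,
      forall p, ST T S p -> `|zeta p| <= N /\ `|normal_dt T S zeta p| <= N,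
      forall j p, ST T S p -> `|sD S j zeta p| <= N &
      forall i j p, ST T S p -> `|sD S i (sD S j zeta) p| <= N].

(** The solution of the limit problem, the functions h0 and h1 and a bound for their
norms. *)
Record limit_data := LimitData {
  profile : E -> R; source : bool -> E -> R; data_size : R }.

Record admissible (D : limit_data) : Prop := Admissible {
  size_ge0 : 0 <= data_size D;
  profile_controlled : controlled (profile D) (data_size D);
  source_controlled : forall b, controlled (source D b) (data_size D);
  sourceE : forall b p, ST T S p ->
    source D b p = dotv (sgrad S (gfun b) p) (sgrad S (profile D) p) }.

(** The analogue of [order] for quantities that are linear in the solution of the
limit problem: the constant may depend neither on the data nor on [eps]. *)
Definition data_order (k : nat) (c : R -> limit_data -> E -> R) : Prop :=
  exists2 C, 0 <= C & forall eps D p, thin_dom eps p -> pos_tube p -> admissible D ->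
    `|c eps D p| <= C * data_size D * eps ^+ k.

Lemma data_orderW k k' c : (k' <= k)%N -> data_order k c -> data_order k' c.
Proof.
move=> kk [C C0 hC]; exists C => // eps D p hp pp aD; apply: le_trans (hC _ _ _ hp pp aD) _.
have /andP[e0 e1] := thin_eps hp.
by rewrite ler_wpM2l //; [rewrite mulr_ge0 // size_ge0|exact: ler_wiXn2l].
Qed.

Lemma data_order_eq k c c' :
  (forall eps D p, thin_dom eps p -> pos_tube p -> admissible D -> c eps D p = c' eps D p) ->
  data_order k c -> data_order k c'.
Proof. by move=> cc [C C0 hC]; exists C => // eps D p hp pp aD; rewrite -cc //; exact: hC. Qed.

Lemma data_orderD k c c' : data_order k c -> data_order k c' ->
  data_order k (fun eps D p => c eps D p + c' eps D p).
Proof.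
move=> [C C0 hC] [C' C'0 hC']; exists (C + C') => [|eps D p hp pp aD]; first exact: addr_ge0.
by apply: le_trans (ler_normD _ _) _; rewrite !mulrDl lerD ?hC ?hC'.
Qed.

Lemma data_orderM k k' c c' : order k c -> data_order k' c' ->
  data_order (k + k') (fun eps D p => c eps p * c' eps D p).
Proof.
move=> [C C0 hC] [C' C'0 hC']; exists (C * C') => [|eps D p hp pp aD]; first exact: mulr_ge0.
have -> : C * C' * data_size D * eps ^+ (k + k') = (C * eps ^+ k) * (C' * data_size D * eps ^+ k').
  by rewrite exprD; ring.
by rewrite normrM; apply: ler_pM => //; [exact: hC|exact: hC'].
Qed.

Lemma data_orderMl k c c' : order k c -> data_order 0 c' ->
  data_order k (fun eps D p => c eps p * c' eps D p).
Proof. by move=> h h'; have := data_orderM h h'; rewrite addn0. Qed.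

Lemma data_orderMs k f c : smooth_tube f -> data_order k c ->
  data_order k (fun eps D p => f p * c eps D p).
Proof. by move=> sf; apply: (@data_orderM 0%N k); exact: order_smooth. Qed.

Lemma data_orderZ k a c : data_order k c -> data_order k (fun eps D p => a * c eps D p).
Proof. exact: data_orderMs (smooth_tube_cst a). Qed.

Lemma data_orderN k c : data_order k c -> data_order k (fun eps D p => - c eps D p).
Proof.
move=> /(data_orderZ (-1)); apply: data_order_eq => eps D p _ _ _; exact: mulN1r.
Qed.

Lemma data_orderB k c c' : data_order k c -> data_order k c' ->
  data_order k (fun eps D p => c eps D p - c' eps D p).
Proof. by move=> h h'; apply: data_orderD => //; exact: data_orderN. Qed.

Lemma data_order0 k : data_order k (fun _ _ _ => 0).
Proof. by exists 0 => // eps D p _ _ _; rewrite normr0 !mul0r. Qed.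

Lemma data_order_sum k (I : Type) (r : seq I) (c : I -> R -> limit_data -> E -> R) :
  (forall i, data_order k (c i)) ->
  data_order k (fun eps D p => \sum_(i <- r) c i eps D p).
Proof.
move=> h; elim: r => [|i r IH].
  by apply: data_order_eq (data_order0 k) => eps D p _ _ _; rewrite big_nil.
by apply: data_order_eq (data_orderD (h i) IH) => eps D p _ _ _; rewrite big_cons.
Qed.

(** The functions linear in the data that may be multiplied by smooth coefficients and
put under the heat operator without losing boundedness. *)
Record tame (c : limit_data -> E -> R) : Prop := Tame {
  tame_regular : forall D, admissible D -> heat_regular (c D);
  tame_order : data_order 0 (fun=> c);
  tame_heat : data_order 0 (fun _ D p => heat (c D) p);
  tame_gdot : forall f, smooth_tube f -> data_order 0 (fun _ D p => gdot f (c D) p) }.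

Lemma tameD c c' : tame c -> tame c' -> tame (fun D p => c D p + c' D p).
Proof.
move=> [r o h g] [r' o' h' g']; split=> [D aD|||f sf].
- exact: heat_regularD (r _ aD) (r' _ aD).
- exact: data_orderD.
- by apply: data_order_eq (data_orderD h h') => eps D p _ pp aD; rewrite heatD //; [exact: r|exact: r'].
- apply: data_order_eq (data_orderD (g _ sf) (g' _ sf)) => eps D p _ pp aD.
  by rewrite [RHS]gdotC gdotDl ?(gdotC f) //; [exact: r|exact: r'].
Qed.

Lemma tameM f c : smooth_tube f -> tame c -> tame (fun D p => f p * c D p).
Proof.
move=> sf [r o h g]; have rf := smooth_heat_regular sf; split=> [D aD|||f' sf'].
- exact: heat_regularM rf (r _ aD).
- exact: data_orderMs.
- have h1 := data_orderD (data_orderMs sf h) (data_orderMs (smooth_heat sf) o).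
  apply: data_order_eq (data_orderB h1 (data_orderZ (2 * kd) (g _ sf))) => eps D p _ pp aD.
  by rewrite (heatM rf (r _ aD) pp) [c D p * _]mulrC.
- have h1 := data_orderD (data_orderMs sf (g _ sf')) (data_orderMs (smooth_gdot sf' sf) o).
  apply: data_order_eq h1 => eps D p _ pp aD.
  rewrite [RHS]gdotC (gdotMl _ rf (r _ aD) pp) (gdotC _ f') (gdotC f f').
  by rewrite [c D p * _]mulrC.
Qed.

Lemma heat_cext zeta p : C21 T S zeta -> pos_tube p ->
  heat (cext S zeta) p = cext S (normal_dt T S zeta) p
    + \sum_j heat (foot_coord j) p * cext S (sD S j zeta) p
    - kd * \sum_j \sum_l gdot (foot_coord j) (foot_coord l) p
                         * cext S (sD S l (sD S j zeta)) p.
Proof.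
move=> cz pp; rewrite /heat (cext_laplacian cz pp).
rewrite {1}/pt (is_tderiveE T0 (pos_tube_itv pp) (cext_pt cz pp)).
under [X in _ = _ + X - _]eq_bigr do rewrite /heat mulrBl -mulrA.
rewrite sumrB -mulr_sumr.
move: (cext S _ p) (\sum_j _) (\sum_j _) (\sum_j _) => a b c d; ring.
Qed.

Lemma gdot_cext f zeta p : C21 T S zeta -> pos_tube p ->
  gdot f (cext S zeta) p = \sum_j gdot f (foot_coord j) p * cext S (sD S j zeta) p.
Proof.
move=> cz pp; rewrite /gdot /dotv.
under [RHS]eq_bigr do rewrite mulr_suml.
rewrite exchange_big /=; apply: eq_bigr => i _.
rewrite !xgradE cext_pd // mulr_sumr; apply: eq_bigr => j _.
by rewrite !xgradE mulrA.
Qed.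

(** A choice of one of the functions that make up the data. *)
Definition atom (z : limit_data -> E -> R) : Prop :=
  forall D, admissible D -> controlled (z D) (data_size D).

Lemma atom_bounds z : atom z ->
  [/\ data_order 0 (fun _ D => cext S (z D)),
      data_order 0 (fun _ D => cext S (normal_dt T S (z D))),
      forall j, data_order 0 (fun _ D => cext S (sD S j (z D))) &
      forall i j, data_order 0 (fun _ D => cext S (sD S i (sD S j (z D))))].
Proof.
move=> az; have N1 (D : limit_data) (x : R) : x <= data_size D -> x <= 1 * data_size D * 1.
  by rewrite mul1r mulr1.
by split=> [||j|i j]; exists 1 => // eps D p _ pp aD; apply: N1;
  have [_ h1 h2 h3] := az _ aD; have sp := ST_foot pp; [have [] := h1 _ sp|have [] := h1 _ sp
   |exact: h2|exact: h3].
Qed.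

Lemma tame_cext z : atom z -> tame (fun D => cext S (z D)).
Proof.
move=> az; have [oz ot o1 o2] := atom_bounds az.
have C21z D : admissible D -> C21 T S (z D) by move=> /az[].
split=> [D aD|||f sf] //; first exact: heat_regular_cext (C21z _ aD).
- have h1 := data_order_sum (index_enum 'I_n) (fun j => data_orderMs (smooth_heat (smooth_foot_coord j)) (o1 j)).
  have h2 := data_order_sum (index_enum 'I_n) (fun j => data_order_sum (index_enum 'I_n) (fun l =>
    data_orderMs (smooth_gdot (smooth_foot_coord j) (smooth_foot_coord l)) (o2 l j))).
  apply: data_order_eq (data_orderB (data_orderD ot h1) (data_orderZ kd h2)) => eps D p _ pp aD.
  by rewrite heat_cext //; exact: C21z.
- have h1 := data_order_sum (index_enum 'I_n) (fun j => data_orderMs (smooth_gdot sf (smooth_foot_coord j)) (o1 j)).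
  by apply: data_order_eq h1 => eps D p _ pp aD; rewrite gdot_cext //; exact: C21z.
Qed.

Lemma atom_profile : atom profile.
Proof. move=> D aD; exact: profile_controlled aD. Qed.

Lemma atom_source b : atom (fun D => source D b).
Proof. move=> D aD; exact: source_controlled aD b. Qed.

(** The gradient of the signed distance is the normal, along which a constant
extension does not change. *)
Lemma gdot_sd_cext zeta p : C21 T S zeta -> pos_tube p -> gdot (sd S) (cext S zeta) p = 0.
Proof.
move=> cz pp; have op := pos_open pp; rewrite /gdot; have [_ _ _ ->] := foot_spec (open_tube_NTbar op).
apply: normal_derive_eq0 => // [q oq|]; first by rewrite cext_foot.
exact: heat_regular_x (heat_regular_cext cz) _ pp.
Qed.

(** This is how identities that hold on the surface are used at the points of the thin
domain. *)
Definition foot_close (c : limit_data -> E -> R) : Prop :=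
  data_order 1 (fun _ D p => c D p - c D (foot S p, p.2)).

Lemma foot_closeD c c' : foot_close c -> foot_close c' -> foot_close (fun D p => c D p + c' D p).
Proof.
move=> h h'; apply: data_order_eq (data_orderD h h') => eps D p _ _ _.
by rewrite opprD addrACA.
Qed.

Lemma foot_close_sum (I : Type) (r : seq I) (c : I -> limit_data -> E -> R) :
  (forall i, foot_close (c i)) -> foot_close (fun D p => \sum_(i <- r) c i D p).
Proof.
move=> h; apply: data_order_eq (data_order_sum r h) => eps D p _ _ _.
by rewrite sumrB.
Qed.

(** Only the smooth coefficient changes between a point and its foot; no modulus of
continuity of the data enters. *)
Lemma foot_closeM f c : smooth_tube f -> data_order 0 (fun _ D => cext S (c D)) ->
  foot_close (fun D p => f p * cext S (c D) p).
Proof.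
move=> sf o; apply: data_order_eq (data_orderMl (order_foot sf) o) => eps D p _ pp _.
by rewrite cext_foot ?mulrBl //; exact: pos_open.
Qed.

Lemma foot_closeZ a c : foot_close c -> foot_close (fun D p => a * c D p).
Proof.
move=> h; apply: data_order_eq (data_orderZ a h) => eps D p _ _ _.
by rewrite mulrBr.
Qed.

Lemma pos_tube_foot p : pos_tube p -> pos_tube (foot S p, p.2).
Proof. by move=> /ST_foot /ST_pos_tube. Qed.

Lemma foot_close_eq c c' : (forall D p, pos_tube p -> admissible D -> c D p = c' D p) ->
  foot_close c -> foot_close c'.
Proof.
move=> cc; apply: data_order_eq => eps D p _ pp aD.
by rewrite !cc //; exact: pos_tube_foot.
Qed.

Lemma foot_close_heat z : atom z -> foot_close (fun D => heat (cext S (z D))).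
Proof.
move=> az; have [oz ot o1 o2] := atom_bounds az.
have C21z D : admissible D -> C21 T S (z D) by move=> /az[].
have h0 := foot_closeM (smooth_tube_cst 1) ot.
have h1 := foot_close_sum (index_enum 'I_n) (fun j => foot_closeM (smooth_heat (smooth_foot_coord j)) (o1 j)).
have h2 := foot_close_sum (index_enum 'I_n) (fun j => foot_close_sum (index_enum 'I_n) (fun l =>
    foot_closeM (smooth_gdot (smooth_foot_coord j) (smooth_foot_coord l)) (o2 l j))).
apply: foot_close_eq (foot_closeD (foot_closeD h0 h1) (foot_closeZ (- kd) h2)) => D p pp aD.
by rewrite heat_cext ?mul1r ?mulNr //; exact: C21z.
Qed.

Lemma foot_close_gdot f z : smooth_tube f -> atom z -> foot_close (fun D => gdot f (cext S (z D))).
Proof.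
move=> sf az; have [oz ot o1 o2] := atom_bounds az.
have C21z D : admissible D -> C21 T S (z D) by move=> /az[].
have h1 := foot_close_sum (index_enum 'I_n) (fun j => foot_closeM (smooth_gdot sf (smooth_foot_coord j)) (o1 j)).
by apply: foot_close_eq h1 => D p pp aD; rewrite gdot_cext //; exact: C21z.
Qed.

(** * The approximate solution in the interior *)

Definition inv_gap : E -> R := cext S (fun y => (2 * (g1 y - g0 y))^-1).

Lemma smooth_inv_gap : smooth_tube inv_gap.
Proof.
apply: smooth_tube_cext => y hy.
have [U1 [F1 [Uy1 C1 E1]]] := hg1 hy; have [U0 [F0 [Uy0 C0 E0]]] := hg0 hy.
have [op1 y1] := Uy1; have [op0 y0] := Uy0.
pose F q := 2 * (F1 q + (-1) * F0 q).
have oI : open (U1 `&` U0) by exact: openI.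
have CF k : Ck_open k (U1 `&` U0) F.
  have c1 : Ck_open k (U1 `&` U0) F1 by apply: Ck_open_sub (C1 k) => q [].
  have c0 : Ck_open k (U1 `&` U0) F0 by apply: Ck_open_sub (C0 k) => q [].
  exact (Ck_openM oI (Ck_open_cst oI k (2 : R)) (Ck_openD oI c1 (Ck_openM oI (Ck_open_cst oI k (-1 : R)) c0))).
have FE q : STbar T S q -> (U1 `&` U0) q -> F q = 2 * (g1 q - g0 q).
  by move=> sq [u1 u0]; rewrite /F E1 // E0 // mulN1r.
have Fy : 0 < F y by rewrite FE //; apply: mulr_gt0 => //; exact: lt_le_trans gmin0 (hgmin hy).
pose U := (U1 `&` U0) `&` [set q | 0 < F q]°.
have oU : open U by apply: openI => //; exact: open_interior.
have UF q : U q -> F q != 0 by move=> [_ /interior_subset /lt0r_neq0].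
exists U, (fun q => (F q)^-1); split=> [|k|q sq [uq _]].
- split=> //; split=> //; exact: cvgr_gt _ (CF 0%N y (conj y1 y0)) _ Fy.
- by apply: (Ck_openV oU UF); apply: Ck_open_sub (CF k) => q [].
- by rewrite FE.
Qed.

Lemma inv_gapE p : open_tube p -> 2 * inv_gap p * (gbar true p - gbar false p) = 1.
Proof.
move=> op; have := lt_le_trans gmin0 (gap_ge op).
rewrite /inv_gap /gbar /cext /gfun => /lt0r_neq0.
move: (g1 _ - g0 _) => a a0; field; exact: a0.
Qed.

Definition shift b p : R :=
  kd^-1 * kd^-1 * (gbar b p * (speed p * speed p)) + (- kd^-1) * pt T (gbar b) p.

Lemma smooth_shift b : smooth_tube (shift b).
Proof.
have sg := smooth_gbar b; have sw := smooth_speed.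
apply: smooth_tubeD; apply: smooth_tubeZ; last exact: smooth_tube_pt.
by apply: smooth_tubeM => //; exact: smooth_tubeM.
Qed.

(** The factor that balances the normal velocity of the lateral boundary at order one. *)
Definition lead p : R := 1 + kd^-1 * (sd S p * speed p).

Lemma smooth_sd_speed : smooth_tube (fun q => sd S q * speed q).
Proof. exact: smooth_tubeM smooth_tube_sd smooth_speed. Qed.

Lemma smooth_lead : smooth_tube lead.
Proof.
by apply: smooth_tubeD; [exact: smooth_tube_cst|apply: smooth_tubeZ; exact: smooth_sd_speed].
Qed.

(** The product q Hi; [shift] is the coefficient of the limit solution in Hi. *)
Definition corrector b (D : limit_data) p : R :=
  inv_gap p * (cext S (source D b) p + shift b p * cext S (profile D) p).

Lemma tame_corrector b : tame (corrector b).
Proof.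
apply: tameM smooth_inv_gap _; apply: tameD; first exact: tame_cext (@atom_source b).
exact: tameM (smooth_shift b) (tame_cext atom_profile).
Qed.

(** The square of the opposite [edge] has the slope 2 eps g on the side [b], and
neither value nor slope on the other side. *)
Definition layer eps b (D : limit_data) p : R :=
  side b * (corrector b D p * (edge eps (~~ b) p * edge eps (~~ b) p)).

Definition ansatz eps (D : limit_data) p : R :=
  lead p * cext S (profile D) p + (layer eps true D p + layer eps false D p).

Lemma heat_regular_edge2 eps b : heat_regular (fun p => edge eps b p * edge eps b p).
Proof. by apply: heat_regularM; apply: smooth_heat_regular; exact: smooth_edge. Qed.

Lemma heat_regular_layer eps b D : admissible D -> heat_regular (layer eps b D).
Proof.
move=> aD; apply: heat_regularZ; apply: heat_regularM (heat_regular_edge2 _ _).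
exact: tame_regular (tame_corrector b) _ aD.
Qed.

Lemma heat_regular_lead D : admissible D ->
  heat_regular (fun p => lead p * cext S (profile D) p).
Proof. by move=> aD; exact: tame_regular (tameM smooth_lead (tame_cext atom_profile)) _ aD. Qed.

Lemma heat_regular_ansatz eps D : admissible D -> heat_regular (ansatz eps D).
Proof.
move=> aD; apply: heat_regularD; first exact: heat_regular_lead.
by apply: heat_regularD; exact: heat_regular_layer.
Qed.

Lemma gdotMr f g h p : heat_regular g -> heat_regular h -> pos_tube p ->
  gdot f (fun q => g q * h q) p = g p * gdot f h p + h p * gdot f g p.
Proof. by move=> rg rh pp; rewrite gdotC gdotMl // !(gdotC f). Qed.

Lemma gdotDr f g h p : heat_regular g -> heat_regular h -> pos_tube p ->
  gdot f (fun q => g q + h q) p = gdot f g p + gdot f h p.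
Proof. by move=> rg rh pp; rewrite gdotC gdotDl // !(gdotC f). Qed.

Lemma gdotZr a f g p : heat_regular g -> pos_tube p ->
  gdot f (fun q => a * g q) p = a * gdot f g p.
Proof. by move=> rg pp; rewrite gdotC gdotZl // (gdotC f). Qed.

Lemma gdot_edge_edge eps b p : open_tube p ->
  gdot (edge eps b) (edge eps b) p = 1 + eps * eps * gdot (gbar b) (gbar b) p.
Proof. by move=> op; rewrite gdot_edge // expr2. Qed.

Lemma gdot_edge_opposite eps b p : open_tube p ->
  gdot (edge eps b) (edge eps (~~ b)) p = - (1 + eps * eps * gdot (gbar b) (gbar (~~ b)) p).
Proof.
move=> op; rewrite gdot_edgel // ![gdot _ (edge _ _) _]gdotC !gdot_edgel // gdot_sd_sd //.
rewrite gdot_sd_gbar // [gdot (gbar (~~ b)) (sd S) p]gdotC gdot_sd_gbar //.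
rewrite (gdotC (gbar (~~ b))).
by case: b; move: (gdot _ _ _) => x; rewrite /side /=; ring.
Qed.

Lemma heat_edge eps b p : pos_tube p ->
  heat (edge eps b) p = side b * (eps * heat (gbar b) p - heat (sd S) p).
Proof.
move=> pp; have rg := smooth_heat_regular (smooth_gbar b); have rd := smooth_heat_regular smooth_tube_sd.
rewrite -mulN1r -(heatZ eps rg pp) -(heatZ (-1) rd pp).
have r1 := heat_regularZ eps rg; have r2 := heat_regularZ (-1) rd.
rewrite -(heatD r1 r2 pp) -(heatZ (side b) (heat_regularD r1 r2) pp); congr (heat _ p).
by apply/funext => q; rewrite mulN1r.
Qed.

Lemma gdot_edge2 f eps b p : heat_regular f -> pos_tube p ->
  gdot f (fun q => edge eps b q * edge eps b q) p = 2 * edge eps b p * gdot (edge eps b) f p.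
Proof.
move=> rf pp; have re := smooth_heat_regular (smooth_edge eps b).
rewrite (gdotMr _ re re pp) (gdotC f).
by move: (edge _ _ _) (gdot _ _ _) => x y; ring.
Qed.

Lemma layer_identity (e eps s k c hc hg hd Z gc dc : R) :
  c * (e * (s * (eps * hg - hd)) + e * (s * (eps * hg - hd)) - 2 * k * (1 + eps * eps * Z))
    + e * e * hc - 2 * k * (2 * e * (s * (eps * gc - dc))) + 2 * k * c
  = e * (e * hc) + (2 * s) * (eps * (e * (hg * c))) - (2 * s) * (e * (hd * c))
    - (2 * k) * (eps * (eps * (Z * c)))
    - (4 * k * s) * (eps * (e * gc)) + (4 * k * s) * (e * dc).
Proof. by ring. Qed.

(** The function [edge] is O(eps) and its gradient has length 1 up to O(eps^2), so the
Laplacian of its square is 2 at leading order. *)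
Lemma heat_layer b c : tame c ->
  data_order 1 (fun eps D p =>
    heat (fun q => c D q * (edge eps b q * edge eps b q)) p + 2 * kd * c D p).
Proof.
move=> tc; have [rc co ch cg] := tc; have oe := order_edge b; have oeps := order_eps.
have t1 := data_orderM oe (data_orderMl oe ch).
have t2 := data_orderM oeps (data_orderMl oe (data_orderMs (smooth_heat (smooth_gbar b)) co)).
have t3 := data_orderMl oe (data_orderMs (smooth_heat smooth_tube_sd) co).
have t4 := data_orderM oeps (data_orderMl oeps (data_orderMs (smooth_gdot (smooth_gbar b) (smooth_gbar b)) co)).
have t5 := data_orderM oeps (data_orderMl oe (cg _ (smooth_gbar b))).
have t6 := data_orderMl oe (cg _ smooth_tube_sd).
have W c' : data_order (1 + 1) c' -> data_order 1 c' by exact: data_orderW.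
have s12 := data_orderD (W _ t1) (data_orderZ (2 * side b) (W _ t2)).
have s13 := data_orderB s12 (data_orderZ (2 * side b) t3).
have s14 := data_orderB s13 (data_orderZ (2 * kd) (W _ t4)).
have s15 := data_orderB s14 (data_orderZ (4 * kd * side b) (W _ t5)).
apply: data_order_eq (data_orderD s15 (data_orderZ (4 * kd * side b) t6)) => eps D p _ pp aD.
have re := smooth_heat_regular (smooth_edge eps b); have rD := rc _ aD.
have op := pos_open pp.
rewrite (heatM rD (heat_regular_edge2 eps b) pp) (heatM re re pp) (gdot_edge2 _ _ rD pp).
rewrite gdot_edge_edge // gdot_edgel // heat_edge //.
exact/esym/layer_identity.
Qed.

Lemma lead_identity (d w k hw hd e he gw : R) : k != 0 ->
  (1 + k^-1 * (d * w)) * he + e * (k^-1 * (d * hw + w * hd - 2 * k * 0))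
    - 2 * k * (k^-1 * (d * gw + w * 0)) - (he + k^-1 * (w * hd) * e)
  = d * (k^-1 * (w * he)) + d * (k^-1 * (hw * e)) - 2 * (d * gw).
Proof. by move=> k0; field. Qed.

Hypothesis kd0 : 0 < kd.

Lemma gdot_lead f p : heat_regular f -> pos_tube p ->
  gdot lead f p = kd^-1 * (sd S p * gdot speed f p + speed p * gdot (sd S) f p).
Proof.
move=> rf pp; have rd := smooth_heat_regular smooth_tube_sd.
have rw := smooth_heat_regular smooth_speed; have rdw := heat_regularM rd rw.
rewrite (gdotDl _ (heat_regular_cst 1) (heat_regularZ kd^-1 rdw) pp).
rewrite (gdotZl _ _ rdw pp) (gdotMl _ rd rw pp).
by rewrite /gdot xgrad_cst /dotv big1 ?add0r // => i _; rewrite mxE mul0r.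
Qed.

Lemma heat_lead p : pos_tube p -> heat lead p =
  kd^-1 * (sd S p * heat speed p + speed p * heat (sd S) p - 2 * kd * 0).
Proof.
move=> pp; have rd := smooth_heat_regular smooth_tube_sd.
have rw := smooth_heat_regular smooth_speed; have rdw := heat_regularM rd rw.
rewrite (heatD (heat_regular_cst 1) (heat_regularZ kd^-1 rdw) pp) heat_cst // add0r.
by rewrite (heatZ _ rdw pp) (heatM rd rw pp) gdot_sd_speed //; exact: pos_open.
Qed.

(** In the interior the factor [lead] contributes only the terms where the signed
distance itself is differentiated, because d is O(eps) and its gradient is
orthogonal to those of w and of the limit solution. *)
Lemma heat_lead_profile : data_order 1 (fun _ D p =>
  heat (fun q => lead q * cext S (profile D) q) p
  - (heat (cext S (profile D)) p + kd^-1 * (speed p * heat (sd S) p) * cext S (profile D) p)).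
Proof.
have [rc co ch cg] := tame_cext atom_profile.
have sw := smooth_speed; have odd := order_sd.
have t1 := data_orderMl odd (data_orderZ kd^-1 (data_orderMs sw ch)).
have t2 := data_orderMl odd (data_orderZ kd^-1 (data_orderMs (smooth_heat sw) co)).
have t3 := data_orderZ 2 (data_orderMl odd (cg _ sw)).
apply: data_order_eq (data_orderB (data_orderD t1 t2) t3) => eps D p _ pp aD.
have rl := smooth_heat_regular smooth_lead; have rD := rc _ aD.
rewrite (heatM rl rD pp) (gdot_lead rD pp) heat_lead // gdot_sd_cext //; last by case: (profile_controlled aD).
exact/esym/lead_identity/lt0r_neq0.
Qed.

(** The part of [heat ansatz] of order one, after the terms quadratic in the velocity
have cancelled. *)
Definition main_term (D : limit_data) p : R :=
  heat (cext S (profile D)) p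
  + (2 * inv_gap p * (pt T (gbar true) p - pt T (gbar false) p)
     - speed p * laplacian (sd S) p) * cext S (profile D) p
  - 2 * kd * inv_gap p * (cext S (source D true) p - cext S (source D false) p).

(** The two occurrences of the square of the velocity, one from [lead] and one from
[shift], cancel because of [2 * q * g = 1]. *)
Lemma main_identity (k q g1' g0' w G1 G0 L e h1' h0' : R) : k != 0 -> 2 * q * (g1' - g0') = 1 ->
  k^-1 * (w * (w - k * L)) * e
   - 2 * k * (q * (h1' + (k^-1 * k^-1 * (g1' * (w * w)) + - k^-1 * G1) * e))
   + 2 * k * (q * (h0' + (k^-1 * k^-1 * (g0' * (w * w)) + - k^-1 * G0) * e))
  = (2 * q * (G1 - G0) - w * L) * e - 2 * k * q * (h1' - h0').
Proof.
move=> k0 qg.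
have -> : k^-1 * (w * (w - k * L)) * e
   - 2 * k * (q * (h1' + (k^-1 * k^-1 * (g1' * (w * w)) + - k^-1 * G1) * e))
   + 2 * k * (q * (h0' + (k^-1 * k^-1 * (g0' * (w * w)) + - k^-1 * G0) * e))
  = (2 * q * (G1 - G0) - w * L) * e - 2 * k * q * (h1' - h0')
    + (1 - 2 * q * (g1' - g0')) * (w * w * e * k^-1) by field.
by rewrite qg subrr mul0r addr0.
Qed.

Lemma heat_ansatz_main : data_order 1 (fun eps D p => heat (ansatz eps D) p - main_term D p).
Proof.
have t b := data_orderZ (side b) (heat_layer (~~ b) (tame_corrector b)).
apply: data_order_eq (data_orderD heat_lead_profile (data_orderD (t true) (t false))) => eps D p _ pp aD.
have rl b := heat_regular_layer eps b aD.
have rc b := tame_regular (tame_corrector b) aD.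
rewrite [in RHS](heatD (heat_regular_lead aD) (heat_regularD (rl true) (rl false)) pp).
rewrite [in RHS](heatD (rl true) (rl false) pp).
have hl b : heat (layer eps b D) p = side b *
    heat (fun q => corrector b D q * (edge eps (~~ b) q * edge eps (~~ b) q)) p.
  exact: heatZ (heat_regularM (rc b) (heat_regular_edge2 _ _)) pp.
rewrite !hl.
have := main_identity (speed p) (pt T (gbar true) p) (pt T (gbar false) p)
  (laplacian (sd S) p) (cext S (profile D) p) (cext S (source D true) p) (cext S (source D false) p)
  (lt0r_neq0 kd0) (inv_gapE (pos_open pp)).
have -> : heat (sd S) p = speed p - kd * laplacian (sd S) p by [].
rewrite /main_term -/(shift true p) -/(shift false p) -/(corrector true D p) -/(corrector false D p).
rewrite [side true]/side [side false]/side.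
move: (heat (fun q => lead q * _) p) => x1; move: (heat (cext S _) p) => x2.
move: (heat (fun q => corrector true D q * _) p) => x3; move: (heat (fun q => corrector _ D q * _) p) => x4.
move: (corrector true D p) (corrector false D p) (cext S _ p) (cext S _ p) (cext S _ p) => c1 c0 a1 a2 a3.
move: (kd^-1 * _) (2 * inv_gap p * _ - _) (2 * kd * inv_gap p) => y1 y2 y3.
move: kd => k; move=> h; lra.
Qed.

(** * The leading term on the surface *)

Definition position (j : 'I_n) (p : E) : R := p.1 0 j.

Lemma pd_position i j p : pd i (position j) p = (i == j)%:R.
Proof.
have d : differentiable (fun x : 'rV[R]_n => x) p.1 by [].
have dd : derivable (fun x : 'rV[R]_n => x) p.1 (delta_mx 0 i) by exact/diff_derivable.
have := derive_mx dd.
rewrite derive_id => /matrixP/(_ 0 j); rewrite !mxE eqxx /= eq_sym => ->.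
by [].
Qed.

Lemma heat_regular_position j : heat_regular (position j).
Proof.
split=> [p _|p i _|p _]; first exact: differentiable_coord.
- by under eq_fun do rewrite pd_position; exact: differentiable_cst.
- by apply/cvg_ex; exists 0; exact: is_tderive_cst.
Qed.

Lemma heat_position j p : pos_tube p -> heat (position j) p = 0.
Proof.
move=> pp; rewrite /heat /pt (is_tderiveE T0 (pos_tube_itv pp) (is_tderive_cst _ _ _)).
rewrite /laplacian big1 ?mulr0 ?subr0 // => i _.
have -> : pd i (position j) = fun=> (i == j)%:R by apply/funext => q; exact: pd_position.
by rewrite -xgradE xgrad_cst mxE.
Qed.

(** The foot is x - d grad d. *)
Lemma foot_coordE j p : open_tube p ->
  foot_coord j p = position j p + (-1) * (sd S p * pd j (sd S) p).
Proof.
move=> op; have [_ h _ _] := foot_spec (open_tube_NTbar op).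
rewrite /position [in RHS]h !mxE -normalE // mulN1r.
by rewrite /foot_coord addrK.
Qed.

Section FootCoordinates.
Variables (j : 'I_n) (p : E).
Hypothesis (pp : pos_tube p) (p0 : sd S p = 0).

Let rd := smooth_heat_regular smooth_tube_sd.
Let rdj := smooth_heat_regular (smooth_tube_pd smooth_tube_sd j).
Let rddj := heat_regularM rd rdj.
Let op := pos_open pp.

Let gdot_sd_normal : gdot (sd S) (pd j (sd S)) p = 0.
Proof.
rewrite /gdot; have [_ _ _ ->] := foot_spec (open_tube_NTbar op).
exact: dotv_normal_xgrad_normal.
Qed.

(** On the surface d vanishes, so that in x - d grad d only the derivatives of the
factor d remain. *)
Lemma heat_foot_coord : heat (foot_coord j) p = - (normal p 0 j * heat (sd S) p).
Proof.
have E1 q : pos_tube q -> position j q + (-1) * (sd S q * pd j (sd S) q) = foot_coord j q.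
  by move=> /pos_open oq; rewrite foot_coordE.
have rp := heat_regular_position j; have rN := heat_regularZ (-1) rddj.
rewrite -(heat_eq E1 (heat_regularD rp rN) pp) (heatD rp rN pp) heat_position //.
rewrite (heatZ _ rddj pp) (heatM rd rdj pp) gdot_sd_normal p0 normalE //.
by rewrite mul0r !mulr0 subr0 !add0r mulN1r.
Qed.

Lemma pd_foot_coord i :
  pd i (foot_coord j) p = (i == j)%:R - normal p 0 j * normal p 0 i.
Proof.
have E1 q : pos_tube q -> position j q + (-1) * (sd S q * pd j (sd S) q) = foot_coord j q.
  by move=> /pos_open oq; rewrite foot_coordE.
have rp := heat_regular_position j; have rN := heat_regularZ (-1) rddj.
rewrite -(pd_eq i E1 pp) (pdD rp rN _ pp) pd_position.
rewrite (pdM (heat_regular_cst (-1)) rddj _ pp) (pdM rd rdj _ pp) p0 !normalE //.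
have -> : pd i (fun=> -1) p = 0 by rewrite -xgradE xgrad_cst mxE.
by rewrite !mul0r ?mulr0 !addr0 add0r mulN1r.
Qed.

End FootCoordinates.

Lemma dotv_normal_sD zeta p : ST T S p -> sdiff S zeta p ->
  \sum_j normal p 0 j * sD S j zeta p = 0.
Proof. by move=> /ST_STbar sp dz; rewrite -nu_normal //; exact: dotv_nu_sD. Qed.

(** The first order terms are multiples of the derivative in the normal direction,
which vanishes, and the second order terms are contracted with the projection to
the tangent space. *)
Lemma heat_cext_surface zeta p : C21 T S zeta -> ST T S p ->
  heat (cext S zeta) p = normal_dt T S zeta p - kd * \sum_i sD S i (sD S i zeta) p.
Proof.
move=> cz sp; have pp := ST_pos_tube sp; have [op p0 fp] := STbar_tube (ST_STbar sp).
rewrite (heat_cext cz pp) !(cext_STbar _ (ST_STbar sp)).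
under eq_bigr do rewrite (heat_foot_coord _ pp p0) (cext_STbar _ (ST_STbar sp)) mulNr mulrAC.
have dn : \sum_j normal p 0 j * sD S j zeta p = 0 by apply: dotv_normal_sD => //; exact: (C21_sdiff cz sp).
rewrite sumrN -mulr_suml dn mul0r oppr0 addr0.
congr (_ - _ * _).
have E1 j : \sum_l gdot (foot_coord j) (foot_coord l) p * cext S (sD S l (sD S j zeta)) p
    = \sum_i pd i (foot_coord j) p * pd i (cext S (sD S j zeta)) p.
  under [RHS]eq_bigr do rewrite (cext_pd2 cz) // mulr_sumr.
  rewrite exchange_big /=; apply: eq_bigr => l _; rewrite /gdot /dotv mulr_suml.
  by apply: eq_bigr => i _; rewrite !xgradE mulrA.
under eq_bigr do rewrite E1.
apply: eq_bigr => j _.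
have dz := C21_sdiff2 cz j sp.
under eq_bigr do rewrite (pd_foot_coord _ pp p0) -(sD_pd _ (ST_STbar sp) dz) mulrBl -mulrA.
rewrite sumrB -mulr_sumr dotv_normal_sD // mulr0 subr0.
rewrite (bigD1 j) //= eqxx mul1r big1 ?addr0 // => i /negbTE ->.
by rewrite mul0r.
Qed.

(** Along a normal trajectory the extended thickness changes only through its time
derivative, since its gradient is tangential. *)
Lemma normal_dt_gap_mul zeta p : normal_derivable T S zeta p -> ST T S p ->
  normal_dt T S (fun q => (g1 q - g0 q) * zeta q) p =
  (g1 p - g0 p) * normal_dt T S zeta p
  + (pt T (gbar true) p - pt T (gbar false) p) * zeta p.
Proof.
move=> dz sp; have hp := ST_STbar sp; have [op _ _] := STbar_tube hp.
have pT := pos_tube_itv (ST_pos_tube sp); have [GY Yp] := labelP hp.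
have dg b : is_tderive T (fun s => gbar b (Phinu S (label S p, s), s)) p.2 (pt T (gbar b) p).
  have := smooth_tube_chain (smooth_gbar b) op Yp (Phinu_ode hS GY pT).
  rewrite /= Yp -surjective_pairing dotvZl.
  by rewrite (nu_normal hp) (dotv_normal_gbar b op) mulr0 add0r.
have dgap : is_tderive T (fun s => gbar true (Phinu S (label S p, s), s)
    + (-1) *: gbar false (Phinu S (label S p, s), s)) p.2 (pt T (gbar true) p + (-1) *: pt T (gbar false) p).
  exact: is_tderiveD (dg true) (is_tderiveZ (a := -1) (dg false)).
have dM := is_tderiveM dgap (tderivableP T0 pT dz).
have E1 (s : R) : s \in `[0, T] -> (gbar true (Phinu S (label S p, s), s)
    + (-1) *: gbar false (Phinu S (label S p, s), s)) * zeta (Phinu S (label S p, s), s)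
   = along_normal S (fun q => (g1 q - g0 q) * zeta q) p s.
  move=> sT; have sq : STbar T S (Phinu S (label S p, s), s) by split => //=; exact: Phinu_Gam.
  by rewrite /gbar !cext_STbar // scaleN1r.
have E3 := @filterS _ _ (tn_filter T p.2) _ _ E1 (tn_itv T p.2).
have EL : (pt T (gbar true) p + (-1) *: pt T (gbar false) p) * along_normal S zeta p p.2
     + (gbar true (Phinu S (label S p, p.2), p.2) +
        (-1) *: gbar false (Phinu S (label S p, p.2), p.2)) * tderive T (along_normal S zeta p) p.2
   = (g1 p - g0 p) * normal_dt T S zeta p + (pt T (gbar true) p - pt T (gbar false) p) * zeta p.
  by rewrite /along_normal Yp -surjective_pairing /gbar !(cext_STbar _ hp) !scaleN1r addrC.
apply: (is_tderiveE T0 pT); rewrite -EL.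
by apply: is_tderive_near dM; [exact: E1|exact: E3].
Qed.

Lemma sdiff_gap b p : STbar T S p -> sdiff S (gfun b) p.
Proof. by move=> /STbar_tube[op _ _]; exact: smooth_tube_differentiable (smooth_gbar b) _ op. Qed.

Lemma meancurvE p : ST T S p -> meancurv S p = - laplacian (sd S) p.
Proof.
move=> sp; have hp := ST_STbar sp; have [op _ _] := STbar_tube hp.
have pp := ST_pos_tube sp; rewrite /meancurv /sdiv; congr (- _); apply: eq_bigr => i _.
have E1 q : pos_tube q -> pd i (sd S) q = cext S (fun q => nu S q 0 i) q.
  by move=> /pos_open oq; rewrite -normalE.
rewrite sD_pd // ?(pd_eq i E1) //.
apply: (differentiable_slice_eq E1 pp).
exact: smooth_tube_differentiable (smooth_tube_pd smooth_tube_sd i) _ op.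
Qed.

Lemma sdivE zeta p : C21 T S zeta -> ST T S p ->
  sdiv S (fun q => (g1 q - g0 q) *: sgrad S zeta q) p =
  (g1 p - g0 p) * (\sum_i sD S i (sD S i zeta) p)
  + (dotv (sgrad S g1 p) (sgrad S zeta p) - dotv (sgrad S g0 p) (sgrad S zeta p)).
Proof.
move=> cz sp; have hp := ST_STbar sp; have [op _ _] := STbar_tube hp.
rewrite /sdiv /dotv -sumrB mulr_sumr -big_split /=; apply: eq_bigr => i _.
rewrite !mxE.
pose gap q := gbar true q + (-1) * gbar false q.
have sg : smooth_tube gap by apply: smooth_tubeD; [exact: smooth_gbar|apply: smooth_tubeZ; exact: smooth_gbar].
have dg := smooth_tube_differentiable sg op.
have dz := C21_sdiff2 cz i sp.
have dM := differentiableM dg dz.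
have E1 : (fun q => ((g1 q - g0 q) *: sgrad S zeta q) 0 i) = fun q => (g1 q - g0 q) * sD S i zeta q.
  by apply/funext => q; rewrite !mxE.
have E2 : cext S (fun q => (g1 q - g0 q) * sD S i zeta q) = fun q => gap q * cext S (sD S i zeta) q.
  by apply/funext => q; rewrite /gap mulN1r.
have dS : sdiff S (fun q => (g1 q - g0 q) * sD S i zeta q) p by rewrite /sdiff E2; exact: dM.
rewrite E1 (sD_pd _ hp dS) E2 (pd_sliceM _ dg dz) -(sD_pd _ hp dz) (cext_STbar _ hp).
have -> : pd i gap p = sD S i g1 p - sD S i g0 p.
  have pp := ST_pos_tube sp; have r b := smooth_heat_regular (smooth_gbar b).
  rewrite (pdD (r true) (heat_regularZ (-1) (r false)) _ pp).
  rewrite (pdM (heat_regular_cst (-1)) (r false) _ pp).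
  have -> : pd i (fun=> -1) p = 0 by rewrite -xgradE xgrad_cst mxE.
  rewrite (sD_pd _ hp (@sdiff_gap true _ hp)) (sD_pd _ hp (@sdiff_gap false _ hp)).
  by rewrite mulr0 addr0 mulN1r.
have -> : gap p = g1 p - g0 p by rewrite /gap /gbar !cext_STbar // mulN1r.
move: (sD S i _ p) (sD S i _ p) (sD S i _ p) (sD S i _ p) => a b c d; ring.
Qed.

(** The limit equation, multiplied by 2 q. *)
Lemma limit_identity (k q g e n1 G w L hp h0' f d2 : R) : 2 * q * g = 1 ->
  (g * n1 + G * e) - g * (- w) * (- L) * e - k * (g * d2 + (hp - h0')) = g * f ->
  (n1 - k * d2) + (2 * q * G - w * L) * e - 2 * k * q * (hp - h0') = f.
Proof.
move=> qg h.
have -> : (n1 - k * d2) + (2 * q * G - w * L) * e - 2 * k * q * (hp - h0')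
  = 2 * q * ((g * n1 + G * e) - g * (- w) * (- L) * e - k * (g * d2 + (hp - h0')))
    + (1 - 2 * q * g) * (n1 - k * d2 - w * L * e) by ring.
by rewrite h qg subrr mul0r addr0 mulrA qg mul1r.
Qed.

(** On the surface the leading term is the left hand side of the limit equation
divided by g: the velocity is - w, and the mean curvature is minus the Laplacian
of the signed distance. *)
Lemma main_term_surface D f p : admissible D -> ST T S p ->
  normal_dt T S (fun q => (g1 q - g0 q) * profile D q) p
    - (g1 p - g0 p) * VGam S p * meancurv S p * profile D p
    - kd * sdiv S (fun q => (g1 q - g0 q) *: sgrad S (profile D) q) p
    = (g1 p - g0 p) * f p ->
  main_term D p = f p.
Proof.
move=> aD sp; have hp := ST_STbar sp; have [op p0 fp] := STbar_tube hp.
have [cz _ _ _] := profile_controlled aD; have pp := ST_pos_tube sp.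
have dn : normal_derivable T S (profile D) p by have [_ [h _] _ _] := cz; exact: h.
rewrite (normal_dt_gap_mul dn sp) meancurvE // (sdivE cz sp).
have -> : VGam S p = - speed p by rewrite /speed pt_sd // fp opprK -surjective_pairing.
move=> h; have := limit_identity (q := inv_gap p) _ h; rewrite /main_term.
rewrite (heat_cext_surface cz sp) !(cext_STbar _ hp) !(sourceE aD _ sp); apply.
by have := inv_gapE op; rewrite /gbar !(cext_STbar _ hp).
Qed.

Lemma foot_close_main : foot_close main_term.
Proof.
have [oz _ _ _] := atom_bounds atom_profile.
have os b : data_order 0 (fun _ D => cext S (source D b)) by have [] := atom_bounds (@atom_source b).
have sp b := smooth_tube_pt (smooth_gbar b).
have sm1 : smooth_tube (fun p => 2 * inv_gap p * (pt T (gbar true) p + (-1) * pt T (gbar false) p)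
     + (-1) * (speed p * laplacian (sd S) p)).
  apply: smooth_tubeD; last first.
    by apply: smooth_tubeZ; apply: smooth_tubeM smooth_speed (smooth_laplacian smooth_tube_sd).
  apply: smooth_tubeM; first exact: smooth_tubeZ smooth_inv_gap.
  by apply: smooth_tubeD => //; exact: smooth_tubeZ.
have sm2 : smooth_tube (fun p => 2 * kd * inv_gap p) by apply: smooth_tubeZ; exact: smooth_inv_gap.
have h := foot_closeD (foot_closeD (foot_close_heat atom_profile) (foot_closeM sm1 oz))
  (foot_closeD (foot_closeZ (-1) (foot_closeM sm2 (os true))) (foot_closeM sm2 (os false))).
apply: foot_close_eq h => D p pp aD; rewrite /main_term.
move: (heat _ p) (pt _ _ p) (pt _ _ p) (inv_gap p) (speed p) (laplacian _ p) (cext S _ p) (cext S _ p) (cext S _ p).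
by move=> *; ring.
Qed.

(** Pass from the point to its foot, where the leading term is f. *)
Lemma heat_ansatz : exists2 C, 0 <= C & forall eps D f p, thin_dom eps p -> pos_tube p ->
  admissible D ->
  (forall p, ST T S p ->
    normal_dt T S (fun q => (g1 q - g0 q) * profile D q) p
    - (g1 p - g0 p) * VGam S p * meancurv S p * profile D p
    - kd * sdiv S (fun q => (g1 q - g0 q) *: sgrad S (profile D) q) p
    = (g1 p - g0 p) * f p) ->
  `|heat (ansatz eps D) p - cext S f p| <= C * data_size D * eps.
Proof.
have [C C0 hC] := data_orderD heat_ansatz_main foot_close_main.
exists C => // eps D f p hp pp aD hf.
have := hC _ _ _ hp pp aD; rewrite expr1 addrA subrK.
by rewrite (main_term_surface aD (ST_foot pp) (hf _ (ST_foot pp))).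
Qed.

(** * The approximate solution on the lateral boundary *)

(** With c = q H the relation [2 * q * g = 1] turns the slope 2 eps g c of the quadratic
term into eps H; then the terms of order one cancel, and of those of order [eps]
only h - X remains. *)
Lemma lateral_identity (k eps s q g gb w e h X Y G J K Z : R) : k != 0 ->
  s = 1 \/ s = -1 -> 2 * q * g = 1 ->
  let c := q * (h + (k^-1 * k^-1 * (gb * (w * w)) + - k^-1 * G) * e) in
  let l := 1 + k^-1 * (eps * gb * w) in
  let e' := eps * g in
  - k * (l * (s * (eps * X - 0)) + e * (k^-1 * (eps * gb * (s * (eps * Y - 0)) + w * (s * (eps * 0 - 1))))
     + s * (c * (2 * e' * (- (1 + eps * eps * Z))) + e' * e' * (s * (eps * J - K))))
  + s * (eps * G - w) * (l * e + s * (c * (e' * e')))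
  = s * k * eps * (h - X) + eps * eps *
    (- s * (gb * (w * X)) - s * (gb * (Y * e)) - k * (g * (g * (eps * J - K)))
     + 2 * k * s * (eps * (g * (Z * c))) + s * k^-1 * (G * (gb * (w * e)))
     + (eps * G - w) * (g * (g * c))).
Proof.
move=> k0 ss qg c l e'.
pose H := h + (k^-1 * k^-1 * (gb * (w * w)) + - k^-1 * G) * e.
have gc : 2 * g * c = H by rewrite /c -/H; transitivity (2 * q * g * H); [ring|rewrite qg mul1r].
have -> : - k * (l * (s * (eps * X - 0)) + e * (k^-1 * (eps * gb * (s * (eps * Y - 0)) + w * (s * (eps * 0 - 1))))
     + s * (c * (2 * e' * (- (1 + eps * eps * Z))) + e' * e' * (s * (eps * J - K))))
  + s * (eps * G - w) * (l * e + s * (c * (e' * e')))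
  = s * k * eps * ((2 * g * c) - H) + s * k * eps * (h - X) + eps * eps *
    (- s * (gb * (w * X)) - s * (gb * (Y * e)) - k * (g * (g * (eps * J - K)))
     + 2 * k * s * (eps * (g * (Z * c))) + s * k^-1 * (G * (gb * (w * e)))
     + (eps * G - w) * (g * (g * c))).
  rewrite /H /l /e'; clear H gc; move: c => c; case: ss => ->; field; exact: k0.
by rewrite gc subrr mulr0 add0r.
Qed.

Lemma gdot_edge_sd eps b p : open_tube p ->
  gdot (edge eps b) (sd S) p = side b * (eps * 0 - 1).
Proof. by move=> op; rewrite gdot_edgel // gdot_sd_sd // gdotC gdot_sd_gbar. Qed.

Lemma gdot_edge_speed eps b p : open_tube p ->
  gdot (edge eps b) speed p = side b * (eps * gdot (gbar b) speed p - 0).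
Proof. by move=> op; rewrite gdot_edgel // gdot_sd_speed. Qed.

Lemma sd_lateral eps b p : edge eps b p = 0 -> sd S p = eps * gbar b p.
Proof.
move=> h; have := congr1 ( *%R (side b)) h.
rewrite /edge mulrA side2 mul1r mulr0 => /eqP; rewrite subr_eq0 => /eqP ->.
by [].
Qed.

Definition gap p : R := gbar true p + (-1) * gbar false p.

Lemma smooth_gap : smooth_tube gap.
Proof. by apply: smooth_tubeD; [|apply: smooth_tubeZ]; exact: smooth_gbar. Qed.

Lemma edge_opposite_lateral eps b p : edge eps b p = 0 -> edge eps (~~ b) p = eps * gap p.
Proof.
move=> h; have := edge_add eps p; rewrite /gap mulN1r.
by case: b h => /= ->; rewrite ?add0r ?addr0.
Qed.

Lemma ansatzE eps b D q : ansatz eps D q =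
  lead q * cext S (profile D) q + (layer eps b D q + layer eps (~~ b) D q).
Proof. by rewrite /ansatz; case: b => //=; rewrite [layer eps false D q + _]addrC. Qed.

Lemma gdot_edge_layer eps b D p : admissible D -> pos_tube p -> open_tube p ->
  gdot (edge eps b) (layer eps b D) p = side b *
    (corrector b D p * (2 * edge eps (~~ b) p * gdot (edge eps b) (edge eps (~~ b)) p)
     + edge eps (~~ b) p * edge eps (~~ b) p * gdot (edge eps b) (corrector b D) p).
Proof.
move=> aD pp op; have rc := tame_regular (tame_corrector b) aD.
have re := smooth_heat_regular (smooth_edge eps (~~ b)).
have r2 := heat_regular_edge2 eps (~~ b).
rewrite (gdotZr _ _ (heat_regularM rc r2) pp) (gdotMr _ rc r2 pp) (gdotMr _ re re pp).
congr (_ * (_ * _ + _)); by rewrite -mulrA mulr_natl mulr2n.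
Qed.

Lemma gdot_edge_layer_opposite eps b D p : admissible D -> pos_tube p ->
  edge eps b p = 0 -> gdot (edge eps b) (layer eps (~~ b) D) p = 0.
Proof.
move=> aD pp e0; have rc := tame_regular (tame_corrector (~~ b)) aD.
have re := smooth_heat_regular (smooth_edge eps (~~ ~~ b)).
have r2 := heat_regular_edge2 eps (~~ ~~ b).
rewrite (gdotZr _ _ (heat_regularM rc r2) pp) (gdotMr _ rc r2 pp) (gdotMr _ re re pp).
by rewrite negbK e0 !(mul0r, mulr0) ?addr0 ?mulr0.
Qed.

Definition lateral_remainder b eps D p : R :=
  - side b * (gbar b p * (speed p * gdot (gbar b) (cext S (profile D)) p))
  - side b * (gbar b p * (gdot (gbar b) speed p * cext S (profile D) p))
  - kd * (gap p * (gap p * (eps * gdot (gbar b) (corrector b D) p - gdot (sd S) (corrector b D) p)))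
  + 2 * kd * side b * (eps * (gap p * (gdot (gbar b) (gbar (~~ b)) p * corrector b D p)))
  + side b * kd^-1 * (pt T (gbar b) p * (gbar b p * (speed p * cext S (profile D) p)))
  + (eps * pt T (gbar b) p - speed p) * (gap p * (gap p * corrector b D p)).

Lemma lateral_ansatzE eps b D p : admissible D -> pos_tube p -> edge eps b p = 0 ->
  lateral_op eps b (ansatz eps D) p =
  side b * kd * eps * (cext S (source D b) p - gdot (gbar b) (cext S (profile D)) p)
  + eps * eps * lateral_remainder b eps D p.
Proof.
move=> aD pp e0; have op := pos_open pp; have [cz _ _ _] := profile_controlled aD.
have rz := heat_regular_cext cz; have rl := smooth_heat_regular smooth_lead.
have re := smooth_heat_regular (smooth_edge eps b).
have ry b' := heat_regular_layer eps b' aD.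
have -> : ansatz eps D = fun q => lead q * cext S (profile D) q + (layer eps b D q + layer eps (~~ b) D q).
  by apply/funext => q; exact: ansatzE.
rewrite /lateral_op (gdotDr _ (heat_regular_lead aD) (heat_regularD (ry b) (ry (~~ b))) pp).
rewrite (gdotDr _ (ry b) (ry (~~ b)) pp) gdot_edge_layer_opposite // addr0.
rewrite (gdotMr _ rl rz pp) gdot_edge_layer // gdot_edge_opposite //.
rewrite [gdot _ lead _]gdotC (gdot_lead re pp) ![gdot _ (edge _ _) _]gdotC.
rewrite gdot_edge_speed // gdot_edge_sd // !(gdot_edgel _ _ _ op) gdot_sd_cext //.
have ly : layer eps (~~ b) D p = 0 by rewrite /layer negbK e0 !mulr0.
have lb : layer eps b D p = side b * (corrector b D p * (edge eps (~~ b) p * edge eps (~~ b) p)) by [].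
rewrite pt_edge // ly lb addr0.
have qg : 2 * inv_gap p * gap p = 1 by rewrite /gap mulN1r; exact: inv_gapE.
have ss : side b = 1 \/ side b = -1 by case: (b); [left|right].
rewrite {1 2}/lead (sd_lateral e0) (edge_opposite_lateral e0).
exact: (lateral_identity eps (gbar b p) (speed p) _ _ _ _ _ _ _ _ (lt0r_neq0 kd0) ss qg).
Qed.

Lemma order_lateral_remainder b : data_order 0 (lateral_remainder b).
Proof.
have [rz oz hz gz] := tame_cext atom_profile; have [rc oc hc gc] := tame_corrector b.
have sg := smooth_gbar b; have sw := smooth_speed; have sG := smooth_tube_pt sg.
have sp := smooth_gap; have oe : order 0 (fun eps (_ : E) => eps) by apply: orderW order_eps.
have t1 := data_orderZ (- side b) (data_orderMs sg (data_orderMs sw (gz _ sg))).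
have t2 := data_orderZ (side b) (data_orderMs sg (data_orderMs (smooth_gdot sg sw) oz)).
have t3 := data_orderZ kd (data_orderMs sp (data_orderMs sp
  (data_orderB (data_orderMl oe (gc _ sg)) (gc _ smooth_tube_sd)))).
have t4 := data_orderZ (2 * kd * side b) (data_orderMl oe (data_orderMs sp
  (data_orderMs (smooth_gdot sg (smooth_gbar (~~ b))) oc))).
have t5 := data_orderZ (side b * kd^-1) (data_orderMs sG (data_orderMs sg (data_orderMs sw oz))).
have t6 := data_orderMl (orderB (orderMl oe (order_smooth sG)) (order_smooth sw))
  (data_orderMs sp (data_orderMs sp oc)).
exact: (data_orderD (data_orderD (data_orderD (data_orderB (data_orderB t1 t2) t3) t4) t5) t6).
Qed.

(** The two sides agree on the surface by the definition of h0 and h1, and vary by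
O(eps) between a point and its foot. *)
Lemma order_source_flux b : data_order 1 (fun _ D p =>
  cext S (source D b) p - gdot (gbar b) (cext S (profile D)) p).
Proof.
apply: data_order_eq (data_orderN (foot_close_gdot (smooth_gbar b) atom_profile)) => eps D p _ pp aD.
have [cz _ _ _] := profile_controlled aD; have sp := ST_foot pp.
have -> : gdot (gbar b) (cext S (profile D)) (foot S p, p.2) = cext S (source D b) p.
  rewrite /cext (sourceE aD _ sp) /gdot; apply: eq_bigr => i _; rewrite !xgradE !mxE.
  rewrite (sD_pd _ (ST_STbar sp) (C21_sdiff cz sp)).
  by rewrite (sD_pd _ (ST_STbar sp) (@sdiff_gap b _ (ST_STbar sp))).
by rewrite opprB.
Qed.

(** [lateral_ansatzE] leaves eps times a quantity that is O(eps) by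
[order_source_flux], and eps^2 times a bounded one. *)
Lemma lateral_ansatz b : exists2 C, 0 <= C & forall eps D p, thin_dom eps p -> pos_tube p ->
  admissible D -> edge eps b p = 0 ->
  `|lateral_op eps b (ansatz eps D) p| <= C * data_size D * (eps * eps).
Proof.
have h := data_orderD
  (data_orderM order_eps (data_orderZ (side b * kd) (order_source_flux b)))
  (data_orderM order_eps (data_orderMl order_eps (order_lateral_remainder b))).
have [C C0 hC] := h; exists C => // eps D p hp pp aD e0.
have := hC _ _ _ hp pp aD; rewrite lateral_ansatzE // -expr2; congr (`|_| <= _).
move: (cext _ _ _ - _) (lateral_remainder _ _ _ _) (side b) => x y s; ring.
Qed.

(** * The barrier *)

Section Barrier.
Variable (lam K : R).

(** The summand [lead] is d w / k up to the constant 1. *)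
Definition barrier_exponent eps p : R := lead p + (- K) * (edge eps true p * edge eps false p).

Definition barrier eps p : R := expR (lam * p.2 + barrier_exponent eps p).

(** As a polynomial in [eps] with smooth coefficients, the exponent has derivatives
that are bounded uniformly in [eps]. *)
Lemma barrier_exponentE eps p : barrier_exponent eps p =
  (lead p + K * (sd S p * sd S p))
  + (eps * ((- K) * (sd S p * (gbar true p + gbar false p)))
     + (eps * eps) * (K * (gbar true p * gbar false p))).
Proof. by rewrite /barrier_exponent /edge /side; move: (lead p) => l; ring. Qed.
End Barrier.

Section QuadraticFamily.
Variables F0 F1 F2 : E -> R.
Hypothesis (s0 : smooth_tube F0) (s1 : smooth_tube F1) (s2 : smooth_tube F2).

Definition eps_family eps q : R := F0 q + (eps * F1 q + (eps * eps) * F2 q).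

Lemma eps_family_bounded : exists2 C, 0 <= C & forall eps p, thin_dom eps p -> pos_tube p ->
  [/\ `|eps_family eps p| <= C, `|heat (eps_family eps) p| <= C & gdot (eps_family eps) (eps_family eps) p <= C].
Proof.
have [[r0 r1] r2] := (smooth_heat_regular s0, smooth_heat_regular s1, smooth_heat_regular s2).
have oe : order 0 (fun eps (_ : E) => eps) by apply: orderW order_eps.
have oee := orderMl oe oe.
have F f0 f1 f2 : smooth_tube f0 -> smooth_tube f1 -> smooth_tube f2 ->
    order 0 (fun eps p => f0 p + (eps * f1 p + eps * eps * f2 p)).
  move=> h0 h1 h2; apply: orderD (order_smooth h0) _.
  by apply: orderD; apply: orderMl => //; exact: order_smooth.
have [C C0 hC] := F _ _ _ s0 s1 s2.
have [C' C'0 hC'] := F _ _ _ (smooth_heat s0) (smooth_heat s1) (smooth_heat s2).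
have h i := F _ _ _ (smooth_tube_pd s0 i) (smooth_tube_pd s1 i) (smooth_tube_pd s2 i).
have hsum (r : seq 'I_n) : order 0 (fun eps p => \sum_(i <- r)
   (pd i F0 p + (eps * pd i F1 p + eps * eps * pd i F2 p))
   * (pd i F0 p + (eps * pd i F1 p + eps * eps * pd i F2 p))).
  elim: r => [|i r IH]; first by apply: order_eq (order_cst 0) => eps p _; rewrite big_nil.
  by apply: order_eq (orderD (orderMl (h i) (h i)) IH) => eps p _; rewrite big_cons.
have [C2 C20 hC2] := hsum (index_enum 'I_n).
exists (C + C' + C2); first by rewrite !addr_ge0.
move=> eps p hp pp.
have rz1 := heat_regularZ eps r1; have rz2 := heat_regularZ (eps * eps) r2.
have rz := heat_regularD rz1 rz2.
have := hC _ _ hp; have := hC' _ _ hp; have := hC2 _ _ hp; rewrite !expr0 !mulr1 => b2 b1 b0.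
have eh : heat (eps_family eps) p = heat F0 p + (eps * heat F1 p + eps * eps * heat F2 p).
  by rewrite (heatD r0 rz pp) (heatD rz1 rz2 pp) (heatZ _ r1 pp) (heatZ _ r2 pp).
have eg : gdot (eps_family eps) (eps_family eps) p = \sum_i
   (pd i F0 p + (eps * pd i F1 p + eps * eps * pd i F2 p))
   * (pd i F0 p + (eps * pd i F1 p + eps * eps * pd i F2 p)).
  rewrite /gdot; apply: eq_bigr => i _; rewrite !xgradE.
  have ez a f : heat_regular f -> pd i (fun q => a * f q) p = a * pd i f p.
    move=> rf; rewrite (pdM (heat_regular_cst a) rf _ pp).
    by rewrite -[pd i (fun=> a) p]xgradE xgrad_cst mxE mulr0 addr0.
  by rewrite (pdD r0 rz _ pp) (pdD rz1 rz2 _ pp) !ez.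
rewrite eh eg; split.
- by apply: le_trans b0 _; rewrite -addrA lerDl addr_ge0.
- by apply: le_trans b1 _; rewrite addrAC lerDr addr_ge0.
- by apply: le_trans (ler_norm _) (le_trans b2 _); rewrite lerDr addr_ge0.
Qed.

End QuadraticFamily.

Lemma heat_regular_exponent K eps : heat_regular (barrier_exponent K eps).
Proof.
have r := smooth_heat_regular (smooth_edge eps _).
apply: heat_regularD; first exact: smooth_heat_regular smooth_lead.
by apply: heat_regularZ; exact: heat_regularM (r true) (r false).
Qed.

Lemma barrier_exponent_bounded K : exists2 C, 0 <= C &
  forall eps p, thin_dom eps p -> `|barrier_exponent K eps p| <= C.
Proof.
have oe := orderW (leq0n 1) (order_edge true); have oe' := orderW (leq0n 1) (order_edge false).
have [C C0 hC] := orderD (order_smooth smooth_lead) (orderZ (- K) (orderMl oe oe')).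
by exists C => // eps p hp; have := hC _ _ hp; rewrite mulr1.
Qed.

Lemma barrier_exponent_heat K : exists2 C, 0 <= C & forall eps p, thin_dom eps p -> pos_tube p ->
  - C <= heat (barrier_exponent K eps) p
         - kd * gdot (barrier_exponent K eps) (barrier_exponent K eps) p.
Proof.
have sd2 := smooth_tubeM smooth_tube_sd smooth_tube_sd.
have s0 := smooth_tubeD smooth_lead (smooth_tubeZ K sd2).
have s1 := smooth_tubeZ (- K) (smooth_tubeM smooth_tube_sd (smooth_tubeD (smooth_gbar true) (smooth_gbar false))).
have s2 := smooth_tubeZ K (smooth_tubeM (smooth_gbar true) (smooth_gbar false)).
have [C C0 hC] := eps_family_bounded s0 s1 s2.
exists (C + kd * C) => [|eps p hp pp]; first by rewrite addr_ge0 // mulr_ge0 // ltW.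
have -> : barrier_exponent K eps = eps_family (fun q => lead q + K * (sd S q * sd S q))
    (fun q => (- K) * (sd S q * (gbar true q + gbar false q))) (fun q => K * (gbar true q * gbar false q)) eps.
  by apply/funext => q; exact: barrier_exponentE.
have [_ b1 b2] := hC _ _ hp pp.
rewrite opprD lerB //; first by have := b1; rewrite ler_norml => /andP[].
by rewrite ler_pM2l.
Qed.

Lemma barrier_operators lam K eps p : pos_tube p ->
  heat (barrier lam K eps) p = barrier lam K eps p *
   (lam + (heat (barrier_exponent K eps) p
           - kd * gdot (barrier_exponent K eps) (barrier_exponent K eps) p)) /\
  (forall b, lateral_op eps b (barrier lam K eps) p = barrier lam K eps p *
     (- kd * gdot (edge eps b) (barrier_exponent K eps) p + pt T (edge eps b) p)).
Proof.
move=> pp; have rt := smooth_heat_regular smooth_time; have rlt := heat_regularZ lam rt.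
have rb := heat_regular_exponent K eps; have rx := heat_regularD rlt rb.
have xt : xgrad (fun q => lam * q.2) p = 0 by exact (xgrad_cst (lam * p.2) p).
have gx f : gdot f (fun q => lam * q.2 + barrier_exponent K eps q) p = gdot f (barrier_exponent K eps) p.
  by rewrite /gdot (xgradD rlt rb pp) xt add0r.
have ht : heat (fun q => lam * q.2) p = lam.
  rewrite (heatZ lam rt pp) /heat /laplacian big1 ?mulr0 ?subr0 => [|i _]; last first.
    have -> : pd i (fun q : E => q.2) = fun=> 0 by apply/funext => q; rewrite -xgradE [xgrad _ _](xgrad_cst q.2 q) mxE.
    by rewrite -xgradE xgrad_cst mxE.
  by rewrite /pt (is_tderiveE T0 (pos_tube_itv pp) (is_tderive_id T p.2)) mulr1.
split.
  rewrite (heat_exp rx pp) (heatD rlt rb pp) ht gx gdotC gx.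
  by rewrite /barrier -[lam + _ - _]addrA.
move=> b; rewrite /lateral_op {1}/gdot (xgrad_exp rx pp) dotvZr -[dotv _ _]/(gdot _ _ p) gx.
rewrite -/(barrier lam K eps p); move: (barrier _ _ _ _) (gdot _ _ _) (pt _ _ _) kd => x y z k; ring.
Qed.

Lemma gbar_gbar_ge0 b p : 0 <= gdot (gbar b) (gbar b) p.
Proof. exact: dotv_ge0. Qed.

Lemma lateral_barrier_identity (k eps s K gb w Y Z G e' : R) : k != 0 -> s = 1 \/ s = -1 ->
  - k * (k^-1 * (eps * gb * (s * (eps * Y - 0)) + w * (s * (eps * 0 - 1)))
         + (- K) * (e' * (1 + eps * eps * Z))) + s * (eps * G - w)
  = k * K * e' * (1 + eps * eps * Z) + eps * (s * (G - eps * (gb * Y))).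
Proof. by move=> k0 [] ->; field. Qed.

Lemma lateral_barrier_bound (eps c a g Q y : R) : 0 <= eps -> c + 1 <= a * g * Q -> - c <= y ->
  eps <= a * (eps * g) * Q + eps * y.
Proof.
move=> e0 h h'; have -> : a * (eps * g) * Q + eps * y = eps * (a * g * Q + y) by ring.
apply: ler_peMr => //; apply: le_trans (lerD h h').
by rewrite addrAC subrr add0r.
Qed.

Lemma gdot_edge_exponent K eps b p : pos_tube p -> edge eps b p = 0 ->
  gdot (edge eps b) (barrier_exponent K eps) p =
  gdot (edge eps b) lead p + (- K) * (edge eps (~~ b) p * (1 + eps * eps * gdot (gbar b) (gbar b) p)).
Proof.
move=> pp e0; have op := pos_open pp; have r b' := smooth_heat_regular (smooth_edge eps b').
have rl := smooth_heat_regular smooth_lead; have rM := heat_regularM (r true) (r false).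
rewrite (gdotDr _ rl (heat_regularZ (- K) rM) pp) (gdotZr _ _ rM pp) (gdotMr _ (r true) (r false) pp).
by case: b e0 => e0; rewrite e0 gdot_edge_edge // mul0r ?add0r ?addr0.
Qed.

(** On the lateral boundary - k grad e . grad (- K e0 e1) equals k K eps g at leading
order, so a K of the size of 1 / (k min g) dominates the remaining terms, which are
O(eps). *)
Lemma barrier_lateral : exists K : R, forall lam eps b p, thin_dom eps p -> pos_tube p ->
  edge eps b p = 0 -> eps * barrier lam K eps p <= lateral_op eps b (barrier lam K eps) p.
Proof.
have oe : order 0 (fun eps (_ : E) => eps) by apply: orderW order_eps.
have h b := orderB (order_smooth (smooth_tube_pt (smooth_gbar b))) (orderMl oe
  (order_smooth (smooth_tubeM (smooth_gbar b) (smooth_gdot (smooth_gbar b) smooth_speed)))).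
have [C1 C10 hC1] := h true; have [C0 C00 hC0] := h false.
have kg : 0 < kd * gmin by exact: mulr_gt0.
have hC b eps p (hp : thin_dom eps p) : `|side b * (pt T (gbar b) p - eps * (gbar b p * gdot (gbar b) speed p))| <= C1 + C0.
  have s1 : `|side b| = 1 by rewrite /side; case: b; rewrite ?normrN normr1.
  rewrite normrM s1 mul1r; case: (b).
    by have := hC1 _ _ hp; rewrite expr0 mulr1 => /le_trans; apply; rewrite lerDl.
  by have := hC0 _ _ hp; rewrite expr0 mulr1 => /le_trans; apply; rewrite lerDr.
set K := (C1 + C0 + 1) / (kd * gmin).
have K0 : 0 <= K by apply: divr_ge0; [rewrite !addr_ge0|exact: ltW].
exists K => lam eps b p hp pp e0.
have /andP[e_ge0 _] := thin_eps hp; have op := pos_open pp.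
have re := smooth_heat_regular (smooth_edge eps b).
have [_ ->] := barrier_operators lam K eps pp.
rewrite mulrC; apply: ler_wpM2l; first exact: expR_ge0.
rewrite gdot_edge_exponent // [gdot _ lead _]gdotC (gdot_lead re pp) ![gdot _ (edge _ _) _]gdotC.
rewrite gdot_edge_speed // gdot_edge_sd // pt_edge // (sd_lateral e0) (edge_opposite_lateral e0).
have ss : side b = 1 \/ side b = -1 by case: (b); [left|right].
rewrite (lateral_barrier_identity _ _ _ _ _ _ _ _ (lt0r_neq0 kd0) ss).
have hb := hC b _ _ hp; have Z0 := gbar_gbar_ge0 b p.
have gg : gmin <= gap p by rewrite /gap mulN1r; exact: gap_ge.
have h1 : C1 + C0 + 1 <= kd * K * gap p.
  have -> : kd * K * gap p = (C1 + C0 + 1) * (gap p / gmin).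
    by rewrite /K; field; rewrite !lt0r_neq0.
  by rewrite ler_peMr ?addr_ge0 // ler_pdivlMr // mul1r.
have h2 : C1 + C0 + 1 <= kd * K * gap p * (1 + eps * eps * gdot (gbar b) (gbar b) p).
  apply: le_trans h1 _; apply: ler_peMr.
    by apply: mulr_ge0; [apply: mulr_ge0 => //; exact: ltW|exact: le_trans (ltW gmin0) gg].
  by rewrite lerDl mulr_ge0 // mulr_ge0.
have h3 : - (C1 + C0) <= side b * (pt T (gbar b) p - eps * (gbar b p * gdot (gbar b) speed p)).
  by have := hb; rewrite ler_norml => /andP[].
exact: lateral_barrier_bound e_ge0 h2 h3.
Qed.

(** The heat operator divided by the barrier is lam plus a bounded function. *)
Lemma barrier_heat K : exists2 lam : R, 0 <= lam & forall eps p, thin_dom eps p -> pos_tube p ->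
  barrier lam K eps p <= heat (barrier lam K eps) p.
Proof.
have [C C0 hC] := barrier_exponent_heat K; exists (C + 1) => [|eps p hp pp]; first by rewrite addr_ge0.
have [-> _] := barrier_operators (C + 1) K eps pp.
apply: ler_peMr; first exact: expR_ge0.
have := hC _ _ hp pp; move: (_ - _) => x h.
by rewrite addrAC lerDr -lerBlDl sub0r.
Qed.

Lemma barrier_bounds lam K : 0 <= lam -> exists m m' : R, 0 < m /\ forall eps p, thin_dom eps p ->
  m <= barrier lam K eps p <= m'.
Proof.
move=> lam0; have [C C0 hC] := barrier_exponent_bounded K.
exists (expR (- C)), (expR (lam * T + C)); split=> [|eps p hp]; first exact: expR_gt0.
have := hC _ _ hp; rewrite ler_norml => /andP[h1 h2].
have /andP[t0 tT] : 0 <= p.2 <= T by case: hp => _ [+ _] _; rewrite in_itv.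
rewrite /barrier !ler_expR; apply/andP; split.
  by rewrite -[- C]add0r lerD // mulr_ge0.
by rewrite lerD // ler_wpM2l.
Qed.

(** * Continuity up to the initial time *)

Lemma cext_near h p : {within STbar T S, continuous h} -> open_tube p ->
  cext S h q @[q --> within open_tube (nbhs p)] --> cext S h p.
Proof.
move=> /subspace_continuousP hc op; have := hc _ (STbar_foot (open_tube_NTbar op)) => c.
have FF : Filter (within open_tube (nbhs p)) by exact: within_filter.
have c2 : q.2 @[q --> within open_tube (nbhs p)] --> p.2.
  by apply: cvg_within_filter; exact: cvg_snd.
have c3 : (foot S q, q.2) @[q --> within open_tube (nbhs p)] -->
    within (STbar T S) (nbhs (foot S p, p.2)).
  have := cvg_pair_to (cvg_foot op) c2 => cq A /cq; rewrite !near_simpl /= !near_withinE.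
  by apply: filterS => q hA oq; apply: hA => //; exact: STbar_foot (open_tube_NTbar oq).
exact: (cvg_comp _ _ c3 c).
Qed.

Lemma within_QTbar eps f : 0 < eps < eps0 ->
  (forall p, open_tube p -> f q @[q --> within open_tube (nbhs p)] --> f p) ->
  {within QTbar T S g0 g1 eps, continuous f}.
Proof.
move=> he hf; apply/subspace_continuousP => p /(QTbarE he)[op _].
apply: cvg_trans (hf _ op); move=> A; rewrite !near_simpl /= !near_withinE.
by apply: filterS => q hA /(QTbarE he)[oq _]; exact: hA.
Qed.

Lemma QTbar_thin eps p : 0 < eps < eps0 -> QTbar T S g0 g1 eps p -> thin_dom eps p.
Proof. by move=> he /(QTbarE he)[op hb]; split. Qed.

Lemma barrier_continuous lam K eps : 0 < eps < eps0 ->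
  {within QTbar T S g0 g1 eps, continuous (barrier lam K eps)}.
Proof.
move=> he; apply: within_QTbar => // p op.
have sx : smooth_tube (fun q => lam * q.2 + barrier_exponent K eps q).
  apply: smooth_tubeD; first by apply: smooth_tubeZ; exact: smooth_time.
  apply: smooth_tubeD; first exact: smooth_lead.
  by apply: smooth_tubeZ; apply: smooth_tubeM; exact: smooth_edge.
exact: (continuous_cvg _ (@continuous_expR R _) (smooth_tube_near sx op)).
Qed.

Lemma ansatz_continuous eps D : 0 < eps < eps0 ->
  {within STbar T S, continuous (profile D)} ->
  (forall b, {within STbar T S, continuous (source D b)}) ->
  {within QTbar T S g0 g1 eps, continuous (ansatz eps D)}.
Proof.
move=> he pc sc; apply: within_QTbar => // p op.
have FF : Filter (within open_tube (nbhs p)) by exact: within_filter.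
have sm f : smooth_tube f -> f q @[q --> within open_tube (nbhs p)] --> f p.
  by move=> sf; exact (smooth_tube_near sf op).
have cp := cext_near pc op.
have cc b : corrector b D q @[q --> within open_tube (nbhs p)] --> corrector b D p.
  apply: cvgM; first exact: sm smooth_inv_gap.
  apply: cvgD; first exact: cext_near (sc b) op.
  by apply: cvgM cp; exact: sm (smooth_shift b).
have cl b : layer eps b D q @[q --> within open_tube (nbhs p)] --> layer eps b D p.
  apply: cvgM; first exact: cvg_cst.
  apply: cvgM; first exact: cc.
  exact: sm (smooth_tubeM (smooth_edge eps (~~ b)) (smooth_edge eps (~~ b))).
apply: cvgD; first by apply: cvgM cp; exact: sm smooth_lead.
exact: cvgD (cl true) (cl false).
Qed.

(** This needs only the suprema of the data, hence holds at the initial time as well. *)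
Lemma ansatz_profile : exists2 C, 0 <= C & forall eps D N p, thin_dom eps p -> 0 <= N ->
  (forall q, STbar T S q -> `|profile D q| <= N) ->
  (forall b q, STbar T S q -> `|source D b q| <= N) ->
  `|ansatz eps D p - cext S (profile D) p| <= C * N * eps.
Proof.
pose e2 b : R -> E -> R := fun eps p => edge eps (~~ b) p * edge eps (~~ b) p.
pose c2 b : R -> E -> R := fun eps p => e2 b eps p * (side b * inv_gap p).
pose c1 : R -> E -> R := fun eps p => kd^-1 * (sd S p * speed p)
  + (c2 true eps p * shift true p + c2 false eps p * shift false p).
have oe b : order 1 (e2 b) by apply: orderMr (order_edge _) _; exact: orderW (order_edge _).
have o2 b : order 1 (c2 b).
  exact: orderMr (oe b) (order_smooth (smooth_tubeZ (side b) smooth_inv_gap)).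
have o3 b : order 1 (fun eps p => c2 b eps p * shift b p).
  exact: orderMr (o2 b) (order_smooth (smooth_shift b)).
have o1 : order 1 c1.
  apply: orderD (orderD (o3 true) (o3 false)); apply: orderZ.
  exact: orderMr order_sd (order_smooth smooth_speed).
have [C1 C10 hC1] := o1; have [C2 C20 hC2] := o2 true; have [C3 C30 hC3] := o2 false.
exists (C1 + (C2 + C3)) => [|eps D N p hp N0 hprof hsrc]; first by rewrite !addr_ge0.
have sq : STbar T S (foot S p, p.2) by case: hp => _ op _; exact: STbar_foot (open_tube_NTbar op).
have -> : ansatz eps D p - cext S (profile D) p = c1 eps p * cext S (profile D) p
    + (c2 true eps p * cext S (source D true) p + c2 false eps p * cext S (source D false) p).
  rewrite /ansatz /layer /corrector /lead /c1 /c2 /e2.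
  move: (edge eps (~~ true) p) (edge eps (~~ false) p) (side true) (side false) => x1 x2 x3 x4.
  move: (inv_gap p) (shift true p) (shift false p) (kd^-1 * _) => x5 x6 x7 x8.
  by move: (cext S _ p) (cext S _ p) (cext S _ p) => x9 x10 x11; ring.
have h1 := hC1 _ _ hp; have h2 := hC2 _ _ hp; have h3 := hC3 _ _ hp; rewrite expr1 in h1 h2 h3.
have M x y C : 0 <= C -> `|x| <= C * eps -> `|y| <= N -> `|x * y| <= C * N * eps.
  by move=> C0 hx hy; rewrite normrM mulrAC; apply: ler_pM.
have -> : (C1 + (C2 + C3)) * N * eps = C1 * N * eps + (C2 * N * eps + C3 * N * eps) by ring.
apply: le_trans (ler_normD _ _) (lerD _ (le_trans (ler_normD _ _) (lerD _ _))).
- by apply: M => //; exact: hprof.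
- by apply: M => //; exact: hsrc.
- by apply: M => //; exact: hsrc.
Qed.

(** No differentiability is needed, by [limN], so that the identity can be used under
a further derivative. *)
Lemma pdN i f : pd i (fun q => - f q) = fun q => - pd i f q.
Proof.
apply/funext => p; rewrite /pd /derive -limN.
apply: (congr1 (fun F : R -> R => lim (F @ 0^'))); apply/funext => h /=.
by rewrite -opprD scalerN.
Qed.

Lemma pderivableN i f p : pderivable i f p -> pderivable i (fun q => - f q) p.
Proof. exact: derivableN. Qed.

Lemma tderivableN (f : R -> R) t : t \in `[0, T] -> tderivable T f t ->
  is_tderive T (fun s => - f s) t (- tderive T f t).
Proof.
move=> tT /(tderivableP T0 tT) h; have := is_tderiveZ (a := -1) h.
by rewrite mulN1r; under eq_fun do rewrite mulN1r.
Qed.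

Lemma thin_solutionN eps nueps Veps rho0 feps rho :
  0 < eps < eps0 ->
  thin_solution T S g0 g1 eps kd nueps Veps rho0 feps rho ->
  thin_solution T S g0 g1 eps kd nueps Veps (fun x => - rho0 x) (fun p => - feps p) (fun p => - rho p).
Proof.
move=> he [rc [dt ct] d2 [G [dG cG bG]] pde ini].
have QT_itv p : QT T S g0 g1 eps p -> p.2 \in `[0, T] by move=> /(QTE he)[pp _]; exact: pos_tube_itv.
have ptN p : QT T S g0 g1 eps p -> pt T (fun q => - rho q) p = - pt T rho p.
  by move=> hp; rewrite /pt (is_tderiveE T0 (QT_itv _ hp) (tderivableN (QT_itv _ hp) (dt _ hp))).
split.
- by move=> p; apply: cvgN; exact: rc.
- split=> [p hp|]; first by apply/cvg_ex; exists (- pt T rho p); exact: tderivableN (QT_itv _ hp) (dt _ hp).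
  apply: (@subspace_eq_continuous _ _ _ (fun q => - pt T rho q)) => [p|p].
    by rewrite inE => hp; exact (esym (ptN _ hp)).
  by apply: cvgN; exact: ct.
- move=> i j; rewrite !pdN; have [h1 h2] := d2 i j; split=> [p hp|p].
    by apply: pderivableN; exact: h1.
  by apply: cvgN; exact: h2.
- exists (fun q => - G q); split=> [i p hp|p|p hp].
  + by have [h1 h2] := dG i p hp; rewrite pdN mxE h2; split=> //; exact: pderivableN.
  + by apply: cvgN; exact: cG.
  + by rewrite dotvNr mulrN -opprD bG // oppr0.
- move=> p hp; have -> : laplacian (fun q => - rho q) p = - laplacian rho p.
    by rewrite /laplacian -sumrN; apply: eq_bigr => i _; rewrite (pdN i rho) pdN.
  by rewrite (ptN _ hp) -(pde _ hp) opprB mulrN opprK addrC.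
- by move=> x hx; rewrite ini.
Qed.

(** * The stability estimate *)

(** The comparison function is (B / m) psi, with m a lower bound of the barrier psi:
it and its heat operator are at least B, and its boundary operator is at least B eps. *)
Lemma barrier_comparison : exists2 c : R, 0 <= c &
  forall eps nueps Veps rho0 feps rho v (B : R), 0 < eps < eps0 -> 0 <= B ->
  (forall p, dQT T S g0 g1 eps p ->
     unit_outward_normal (Omega S g0 g1 eps p.2) (boundary (Omega S g0 g1 eps p.2)) p.1 (nueps p)) ->
  (forall p, dQT T S g0 g1 eps p ->
     normal_velocity T (fun t => boundary (Omega S g0 g1 eps t)) p (nueps p) (Veps p)) ->
  thin_solution T S g0 g1 eps kd nueps Veps rho0 feps rho ->
  heat_regular v -> {within QTbar T S g0 g1 eps, continuous v} ->
  (forall p, QTbar T S g0 g1 eps p -> p.2 = 0 -> rho p - v p <= B) ->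
  (forall p, QT T S g0 g1 eps p -> feps p - heat v p <= B) ->
  (forall p b, dQT T S g0 g1 eps p -> edge eps b p = 0 -> - lateral_op eps b v p <= B * eps) ->
  forall p, QTbar T S g0 g1 eps p -> rho p - v p <= c * B.
Proof.
have [K hK] := barrier_lateral; have [lam lam0 hlam] := barrier_heat K.
have [m [m' [m0 hm]]] := barrier_bounds K lam0.
have m'0 : 0 <= Num.max 0 m' by rewrite le_max lexx.
(* The sign of m' is not known: it bounds the barrier at points of the thin domains, of
   which none is at hand here. *)
exists (Num.max 0 m' / m) => [|eps ne Ve rho0 feps rho v B he B0 hne hVe sol rv cv ini int lat p hp].
  by rewrite divr_ge0 // ltW.
have [rc [dt ct] d2 [G [dG cG bG]] pde _] := sol.
have psi_gt0 q : QTbar T S g0 g1 eps q -> 0 < barrier lam K eps q by move=> _; exact: expR_gt0.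
have rpsi : heat_regular (barrier lam K eps).
  apply: heat_regular_exp; apply: heat_regularD; last exact: heat_regular_exponent.
  by apply: heat_regularZ; exact: smooth_heat_regular smooth_time.
have e0 : 0 < eps by case/andP: he.
have Bm : 0 <= B / m by rewrite divr_ge0 // ltW.
have dom x : m <= x -> B <= B / m * x.
  by move=> mx; apply: le_trans (ler_wpM2l Bm mx); rewrite divfK // gt_eqF.
have C := comparison he kd0 hne hVe rc dt (fun i q hq => (d2 i i).1 q hq) dG cG bG rv rpsi cv
  (@barrier_continuous lam K eps he) psi_gt0.
apply: le_trans (C (B / m) _ _ _ p hp) _.
- move=> q hq q0; apply: le_trans (ini q hq q0) (dom _ _).
  by have /andP[] := hm _ _ (QTbar_thin he hq).
- move=> q hq; have hb := QTbar_thin he (QT_QTbar he hq); have [pq _] := (QTE he q).1 hq.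
  have h1 := hlam _ _ hb pq; have /andP[h2 _] := hm _ _ hb.
  split; first exact: lt_le_trans (expR_gt0 _) h1.
  by rewrite [heat rho q](pde _ hq); apply: le_trans (int _ hq) (dom _ (le_trans h2 h1)).
- move=> q b hq qe; have hb := QTbar_thin he (dQT_QTbar he hq); have [pq _ _] := (dQTE he q).1 hq.
  have h1 := hK lam _ _ _ hb pq qe; have /andP[h2 _] := hm _ _ hb.
  split; first by apply: lt_le_trans h1; rewrite mulr_gt0 // expR_gt0.
  apply: le_trans (lat _ _ hq qe) _; apply: le_trans (ler_wpM2l Bm h1).
  by rewrite mulrCA [B * eps]mulrC; apply: ler_wpM2l; [exact: ltW|exact: dom h2].
- have /andP[_ h] := hm _ _ (QTbar_thin he hp).
  have -> : Num.max 0 m' / m * B = B / m * Num.max 0 m' by ring.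
  by apply: ler_wpM2l => //; rewrite le_max h orbT.
Qed.

Lemma lateral_opZ eps b a f p : heat_regular f -> pos_tube p ->
  lateral_op eps b (fun q => a * f q) p = a * lateral_op eps b f p.
Proof.
move=> rf pp; rewrite /lateral_op (gdotZr _ _ rf pp).
by move: (gdot _ _ _) (pt _ _ _) kd => x y k; ring.
Qed.

(** Apply [barrier_comparison] to rho and the ansatz, and to their negatives. *)
Lemma main_estimate : exists2 c : R, 0 <= c &
  forall eps nueps Veps rho0 feps f rho D (e0 ef : R), 0 < eps < eps0 -> 0 <= e0 -> 0 <= ef ->
  (forall p, dQT T S g0 g1 eps p ->
     unit_outward_normal (Omega S g0 g1 eps p.2) (boundary (Omega S g0 g1 eps p.2)) p.1 (nueps p)) ->
  (forall p, dQT T S g0 g1 eps p ->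
     normal_velocity T (fun t => boundary (Omega S g0 g1 eps t)) p (nueps p) (Veps p)) ->
  thin_solution T S g0 g1 eps kd nueps Veps rho0 feps rho ->
  admissible D ->
  (forall p, ST T S p ->
    normal_dt T S (fun q => (g1 q - g0 q) * profile D q) p
    - (g1 p - g0 p) * VGam S p * meancurv S p * profile D p
    - kd * sdiv S (fun q => (g1 q - g0 q) *: sgrad S (profile D) q) p
    = (g1 p - g0 p) * f p) ->
  {within STbar T S, continuous (profile D)} ->
  (forall b, {within STbar T S, continuous (source D b)}) ->
  (forall q, STbar T S q -> `|profile D q| <= data_size D) ->
  (forall b q, STbar T S q -> `|source D b q| <= data_size D) ->
  (forall p, QTbar T S g0 g1 eps p -> p.2 = 0 -> `|rho p - cext S (profile D) p| <= e0) ->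
  (forall p, QT T S g0 g1 eps p -> `|feps p - cext S f p| <= ef) ->
  forall p, QTbar T S g0 g1 eps p ->
    `|rho p - cext S (profile D) p| <= c * (e0 + ef + eps * data_size D).
Proof.
have [c c_ge0 hc] := barrier_comparison; have [C1 C10 hint] := heat_ansatz.
have [C2 C20 hlat] := lateral_ansatz true; have [C3 C30 hlat'] := lateral_ansatz false.
have [C4 C40 hprof] := ansatz_profile.
pose C := C1 + C2 + C3 + C4 + 1.
have [lC1 lC2 lC3 lC4] : [/\ C1 <= C, C2 <= C, C3 <= C & C4 <= C].
  by rewrite /C; move: C10 C20 C30 C40 => h1 h2 h3 h4; split; lra.
have C_ge0 : 0 <= C by exact: le_trans lC1.
have C_ge1 : 1 <= C by rewrite /C lerDr !addr_ge0.
exists (c * C + C) => [|eps ne Ve rho0 feps f rho D e0 ef he e00 ef0 hne hVe sol aD pde cp cs bp bs ini ferr].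
  by apply: addr_ge0 => //; exact: mulr_ge0.
set N := data_size D in bp bs *; have N0 : 0 <= N by exact: size_ge0.
have e_gt0 : 0 < eps by case/andP: he.
pose B := e0 + ef + C * (eps * N).
have eN : 0 <= eps * N by rewrite mulr_ge0 // ltW.
have B0 : 0 <= B by apply: addr_ge0; [exact: addr_ge0|exact: mulr_ge0].
have rv := heat_regular_ansatz eps aD; have cv := ansatz_continuous he cp cs.
have near q : QTbar T S g0 g1 eps q -> `|ansatz eps D q - cext S (profile D) q| <= C * (eps * N).
  move=> /(QTbar_thin he) hq; apply: le_trans (hprof _ _ _ _ hq N0 bp bs) _.
  by rewrite -mulrA [N * _]mulrC ler_wpM2r // mulr_ge0 // ltW.
have ini' q : QTbar T S g0 g1 eps q -> q.2 = 0 -> `|rho q - ansatz eps D q| <= B.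
  move=> hq q0; have := ini _ hq q0; have := near _ hq.
  rewrite [`|ansatz _ _ _ - _|]distrC => h1 h2.
  have -> : rho q - ansatz eps D q = (rho q - cext S (profile D) q) + (cext S (profile D) q - ansatz eps D q).
    by rewrite addrA subrK.
  apply: le_trans (ler_normD _ _) _; rewrite /B -addrA lerD //.
  by rewrite (le_trans h1) // lerDr.
have int' q : QT T S g0 g1 eps q -> `|feps q - heat (ansatz eps D) q| <= B.
  move=> hq; have hb := QTbar_thin he (QT_QTbar he hq); have [pq _] := (QTE he q).1 hq.
  have := hint _ _ _ _ hb pq aD pde; rewrite distrC => h1.
  have -> : feps q - heat (ansatz eps D) q = (feps q - cext S f q) + (cext S f q - heat (ansatz eps D) q).
    by rewrite addrA subrK.
  apply: le_trans (ler_normD _ _) _; rewrite /B [e0 + ef]addrC -addrA lerD ?ferr //.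
  by rewrite (le_trans h1) // ler_wpDl // -mulrA [_ * eps]mulrC ler_wpM2r.
have lat' q b : dQT T S g0 g1 eps q -> edge eps b q = 0 -> `|lateral_op eps b (ansatz eps D) q| <= B * eps.
  move=> hq qe; have hb := QTbar_thin he (dQT_QTbar he hq); have [pq _ _] := (dQTE he q).1 hq.
  have h : `|lateral_op eps b (ansatz eps D) q| <= C * N * (eps * eps).
    have ee : 0 <= eps * eps by rewrite mulr_ge0 // ltW.
    case: b qe => qe; [apply: le_trans (hlat _ _ _ hb pq aD qe) _|apply: le_trans (hlat' _ _ _ hb pq aD qe) _];
    by rewrite ler_wpM2r // ler_wpM2r.
  apply: le_trans h _; rewrite mulrA; apply: ler_wpM2r; first exact: ltW.
  rewrite /B -mulrA [N * _]mulrC.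
  by rewrite lerDr addr_ge0.
have up q : QTbar T S g0 g1 eps q -> rho q - ansatz eps D q <= c * B.
  apply: (hc _ _ _ _ _ _ _ _ he B0 hne hVe sol rv cv) => [r hr r0|r hr|r b hr re].
  - exact: le_trans (ler_norm _) (ini' _ hr r0).
  - exact: le_trans (ler_norm _) (int' _ hr).
  - by apply: le_trans (ler_norm _) _; rewrite normrN; exact: lat'.
have low q : QTbar T S g0 g1 eps q -> - (rho q - ansatz eps D q) <= c * B.
  move=> hq; have -> : - (rho q - ansatz eps D q) = - rho q - (-1) * ansatz eps D q.
    by rewrite opprB mulN1r opprK addrC.
  have cv' : {within QTbar T S g0 g1 eps, continuous (fun q => (-1) * ansatz eps D q)}.
    by move=> r; apply: cvgM; [exact: cvg_cst|exact: cv].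
  apply: (hc _ _ _ _ _ _ _ _ he B0 hne hVe (thin_solutionN he sol) (heat_regularZ (-1) rv) cv') => // [r hr r0|r hr|r b hr re].
  - rewrite mulN1r opprK addrC -opprB; apply: le_trans (ler_norm _) _; rewrite normrN.
    exact: ini'.
  - have [pr _] := (QTE he r).1 hr; rewrite (heatZ _ rv pr) mulN1r opprK addrC -opprB.
    by apply: le_trans (ler_norm _) _; rewrite normrN; exact: int'.
  - have [pr _ _] := (dQTE he r).1 hr; rewrite (lateral_opZ _ _ _ rv pr) mulN1r opprK.
    by apply: le_trans (ler_norm _) _; exact: lat'.
move=> p hp; have h1 : `|rho p - ansatz eps D p| <= c * B.
  by rewrite ler_norml up // andbT lerNl low.
have -> : rho p - cext S (profile D) p = (rho p - ansatz eps D p) + (ansatz eps D p - cext S (profile D) p).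
  by rewrite addrA subrK.
apply: le_trans (ler_normD _ _) _; apply: le_trans (lerD h1 (near _ hp)) _.
have hB : B <= C * (e0 + ef + eps * N).
  by rewrite /B mulrDr lerD2r; apply: ler_peMl => //; exact: addr_ge0.
rewrite [leRHS]mulrDl; apply: lerD; first by rewrite -mulrA ler_wpM2l.
by apply: ler_wpM2l; [exact: C_ge0|rewrite lerDr addr_ge0].
Qed.
Lemma QTbar_foot eps p : 0 < eps < eps0 -> QTbar T S g0 g1 eps p -> STbar T S (foot S p, p.2).
Proof. by move=> he /(QTbarE he)[op _]; exact: STbar_foot (open_tube_NTbar op). Qed.

End Tube.

(** * Supremum norms and initial values *)

Section SupremumNorm.
Variables (R : realType) (X : Type).
Implicit Types (A : set X) (f : X -> R).

Lemma supnorm_ub A f x : A x -> (`|f x|%:E <= supnorm A f)%E.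
Proof. by move=> Ax; apply: ereal_sup_ubound; exists x. Qed.

Lemma supnorm_ge0 A f : A !=set0 -> (0 <= supnorm A f)%E.
Proof. by case=> x Ax; apply: le_trans (supnorm_ub f Ax); rewrite lee_fin. Qed.

Lemma supnorm_le A f (c : \bar R) : (forall x, A x -> (`|f x|%:E <= c)%E) ->
  (supnorm A f <= c)%E.
Proof. by move=> h; apply: ge_ereal_sup => _ [x Ax <-]; exact: h. Qed.

Lemma supnorm_fin A f (N : R) x : (supnorm A f <= N%:E)%E -> A x -> `|f x| <= N.
Proof. by move=> h Ax; rewrite -lee_fin; exact: le_trans (supnorm_ub f Ax) h. Qed.

Lemma lee_sum_term (I : finType) (F : I -> \bar R) i : (forall j, 0 <= F j)%E ->
  (F i <= \sum_j F j)%E.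
Proof. by move=> h; rewrite (bigD1 i) //= leeDl // sume_ge0. Qed.

Lemma fin_of_lty (x : \bar R) : (0 <= x)%E -> (x < +oo)%E -> exists2 r : R, 0 <= r & x = r%:E.
Proof.
by case: x => [r||] //=; rewrite lee_fin => r0 _; exists r.
Qed.

End SupremumNorm.

(** All summands of the norm are nonnegative, so each of them is bounded by it. *)
Lemma C21norm_controlled (R : realType) n (T : R) (S : surface_data R n) zeta (N : R) :
  ST T S !=set0 -> C21 T S zeta -> (C21norm T S zeta <= N%:E)%E -> controlled T S zeta N.
Proof.
move=> ne cz; rewrite /C21norm => h.
have p0 (f : 'rV[R]_n * R -> R) := supnorm_ge0 f ne.
have s1 : (0 <= \sum_(i < n) supnorm (ST T S) (sD S i zeta))%E by rewrite sume_ge0.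
have s2 : (0 <= \sum_(i < n) \sum_(j < n) supnorm (ST T S) (sD S i (sD S j zeta)))%E.
  by apply: sume_ge0 => i _; rewrite sume_ge0.
have h4 := le_trans (leeDr _ (adde_ge0 (adde_ge0 (p0 _) (p0 _)) s1)) h.
have h3 := le_trans (leeDl _ s2) h.
have h2 := le_trans (leeDl _ s1) h3.
split=> // [p sp|j p sp|i j p sp].
- split; first exact: supnorm_fin (le_trans (leeDl _ (p0 _)) h2) sp.
  exact: supnorm_fin (le_trans (leeDr _ (p0 _)) h2) sp.
- have h5 := le_trans (leeDr _ (adde_ge0 (p0 _) (p0 _))) h3.
  exact: supnorm_fin (le_trans (lee_sum_term j (fun k => p0 _)) h5) sp.
- have h5 := le_trans (lee_sum_term i (fun k => sume_ge0 (fun l _ => p0 _) _)) h4.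
  exact: supnorm_fin (le_trans (lee_sum_term j (fun k => p0 _)) h5) sp.
Qed.

(** The initial condition is imposed in the open domain and passes to its closure by
continuity. *)
Lemma initial_values (R : realType) n (A : set ('rV[R]_n)) (B : set ('rV[R]_n * R)%type)
    (rho : 'rV[R]_n * R -> R) (rho0 : 'rV[R]_n -> R) :
  (forall x, closure A x -> B (x, 0)) -> {within B, continuous rho} ->
  {within closure A, continuous rho0} -> (forall x, A x -> rho (x, 0) = rho0 x) ->
  forall x, closure A x -> rho (x, 0) = rho0 x.
Proof.
move=> AB /subspace_continuousP rc /subspace_continuousP r0c e x cx.
have PF : ProperFilter (within A (nbhs x)) by exact: within_nbhs_proper.
have c1 : rho0 y @[y --> within A (nbhs x)] --> rho0 x.
  apply: cvg_trans (r0c _ cx) => D; rewrite !near_simpl /= !near_withinE.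
  by apply: filterS => y h Ay; apply: h; exact: subset_closure.
have c2 : rho (y, 0) @[y --> within A (nbhs x)] --> rho (x, 0).
  have c3 : (y, 0 : R) @[y --> within A (nbhs x)] --> within B (nbhs (x, 0 : R)).
    have FF : Filter (within A (nbhs x)) by exact: within_filter.
    have cy : y @[y --> within A (nbhs x)] --> x by apply: cvg_within_filter; exact: cvg_id.
    have cz : (fun=> 0 : R) y @[y --> within A (nbhs x)] --> (0 : R) by exact: cvg_cst.
    have := cvg_pair_to cy cz => cq D /cq; rewrite !near_simpl /= !near_withinE.
    by apply: filterS => y h Ay; apply: h => //; apply: AB; exact: subset_closure.
  exact: (cvg_comp _ _ c3 (rc _ (AB _ cx))).
have c4 : rho (y, 0) @[y --> within A (nbhs x)] --> rho0 x.
  apply: cvg_trans c1; apply: near_eq_cvg; rewrite near_withinE.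
  by apply: nearW => y Ay; rewrite e.
exact: (cvg_unique _ c2 c4).
Qed.

(** * The convergence estimate *)

Lemma mule_lty_fin (R : realType) (r : R) (x : \bar R) : 0 < r -> (0 <= x)%E ->
  (r%:E * x < +oo)%E -> (x < +oo)%E.
Proof. by move=> r0; case: x => [s||] //= _; rewrite ?ltry // gt0_muley. Qed.

Lemma adde_lty_fin (R : realType) (x y : \bar R) : (0 <= x)%E -> (0 <= y)%E ->
  (x + y < +oo)%E -> (x < +oo)%E /\ (y < +oo)%E.
Proof.
by move=> x0 y0 h; split; apply: le_lt_trans h; [exact: leeDl|exact: leeDr].
Qed.

Lemma C21norm_ge0 (R : realType) n (T : R) (S : surface_data R n) zeta :
  ST T S !=set0 -> (0 <= C21norm T S zeta)%E.
Proof.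
move=> ne; have p0 (f : 'rV[R]_n * R -> R) := supnorm_ge0 f ne.
by rewrite !adde_ge0 // sume_ge0 // => i _; rewrite sume_ge0.
Qed.

Theorem theorem1p2 (R : realType) (n : nat) (hn : (2 <= n)%N)
    (T : R) (hT : 0 < T)
    (S : surface_data R n) (hS : moving_surface T S)
    (g0 g1 : 'rV[R]_n * R -> R)
    (hg0 : smooth_on (STbar T S) g0) (hg1 : smooth_on (STbar T S) g1)
    (hg : exists c : R, 0 < c /\ forall p, STbar T S p -> c <= g1 p - g0 p)
    (eps0 : R) (heps0 : 0 < eps0 < 1)
    (hdelta : forall (eps : R) p, 0 < eps < eps0 -> STbar T S p ->
       eps * `|g0 p| <= delta S /\ eps * `|g1 p| <= delta S)
    (kd : R) (hkd : 0 < kd) :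
  exists cT : R, 0 < cT /\
  forall (eps : R) (heps : 0 < eps < eps0)
    (nueps : 'rV[R]_n * R -> 'rV[R]_n) (Veps : 'rV[R]_n * R -> R)
    (rho0 : 'rV[R]_n -> R) (feps : 'rV[R]_n * R -> R)
    (eta0 : 'rV[R]_n -> R) (f : 'rV[R]_n * R -> R)
    (rho eta h0 h1 : 'rV[R]_n * R -> R),
  let Om := Omega S g0 g1 eps in
  let Q := QT T S g0 g1 eps in
  let dQ := dQT T S g0 g1 eps in
  let Qbar := QTbar T S g0 g1 eps in
  (forall p, dQ p ->
     unit_outward_normal (Om p.2) (boundary (Om p.2)) p.1 (nueps p)) ->
  (forall p, dQ p ->
     normal_velocity T (fun t => boundary (Om t)) p (nueps p) (Veps p)) ->
  {within closure (Om 0), continuous rho0} ->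
  {within Q, continuous feps} ->
  {within Gam S 0, continuous eta0} ->
  {within ST T S, continuous f} ->
  thin_solution T S g0 g1 eps kd nueps Veps rho0 feps rho ->
  limit_solution T S g0 g1 kd eta0 f eta ->
  (forall p, ST T S p -> h0 p = dotv (sgrad S g0 p) (sgrad S eta p)) ->
  (forall p, ST T S p -> h1 p = dotv (sgrad S g1 p) (sgrad S eta p)) ->
  {within STbar T S, continuous h0} -> C21 T S h0 ->
  {within STbar T S, continuous h1} -> C21 T S h1 ->
  let rho0_err := supnorm (closure (Om 0))
    (fun x => rho0 x - eta0 (foot S (x, 0))) in
  let f_err := supnorm Q (fun p => feps p - cext S f p) in
  let eta0_norm := supnorm (Gam S 0) eta0 in
  let h0_init := supnorm (Gam S 0) (fun y => h0 (y, 0)) in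
  let h1_init := supnorm (Gam S 0) (fun y => h1 (y, 0)) in
  let rhs := (cT%:E * (rho0_err + f_err)
    + (eps * cT)%:E * (eta0_norm + C21norm T S eta)
    + (eps * cT)%:E * ((h0_init + C21norm T S h0)
                       + (h1_init + C21norm T S h1)))%E in
  (rhs < +oo)%E ->
  (supnorm Qbar (fun p => rho p - cext S eta p)%R <= rhs)%E.
Proof.
have [gmin [gmin0 hgmin]] := hg.
have [c c_ge0 main] := main_estimate hT hS hg0 hg1 gmin0 hgmin heps0 hdelta hkd.
have cT0 : 0 < c + 1 by rewrite ltr_wpDl.
exists (c + 1); split=> // eps heps nueps Veps rho0 feps eta0 f rho eta h0 h1 Om Q dQ Qbar
  hnu hV rho0c fepsc eta0c fc sol lim h0E h1E h0c h0C h1c h1C e0 ef Neta0 Nh0 Nh1 rhs rhs_fin.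
have [etac etaC pde ini] := lim; have e_gt0 : 0 < eps by case/andP: heps.
have I0 : 0 \in `[0, T] by rewrite in_itv /= lexx ltW.
have IT : T \in `[0, T] by rewrite in_itv /= lexx ltW.
have ne0 : Gam S 0 !=set0 by have [] := Gam_closed_connected hS I0.
(* Suprema over the empty set are - oo, so the norms are nonnegative only because the
   sets are inhabited. *)
have neOm t : t \in `[0, T] -> Om t !=set0.
  move=> tT; have [[y Gy] _ _] := Gam_closed_connected hS tT.
  pose r := eps * ((g0 (y, t) + g1 (y, t)) / 2).
  have g01 : g0 (y, t) < g1 (y, t) by rewrite -subr_gt0 (lt_le_trans gmin0) // hgmin.
  exists (y + r *: nu S (y, t)), y, r; split=> //.
  by have [h2 h3] := midf_lt g01; rewrite /r !ltr_pM2l // h2 h3.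
have neST : ST T S !=set0.
  have [[y Gy] _ _] := Gam_closed_connected hS IT.
  by exists (y, T); split=> //=; rewrite in_itv /= hT lexx.
have neQ : Q !=set0.
  by have [x Ox] := neOm _ IT; exists (x, T); split=> //=; rewrite in_itv /= hT lexx.
have neC : closure (Om 0) !=set0.
  by have [x Ox] := neOm _ I0; exists x; exact: subset_closure.
have e0_ge0 : (0 <= e0)%E by exact: supnorm_ge0.
have ef_ge0 : (0 <= ef)%E by exact: supnorm_ge0.
have N_ge0 : [/\ (0 <= Neta0)%E, (0 <= Nh0)%E & (0 <= Nh1)%E] by split; exact: supnorm_ge0.
have [Neta0_ge0 Nh0_ge0 Nh1_ge0] := N_ge0.
have C_ge0 z : (0 <= C21norm T S z)%E by exact: C21norm_ge0.
have ec0 : 0 < eps * (c + 1) by exact: mulr_gt0.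
have ecE : (0 <= (eps * (c + 1))%:E)%E by rewrite lee_fin ltW.
have cE : (0 <= (c + 1)%:E)%E by rewrite lee_fin ltW.
(* As the right hand side is finite, every norm in it is a real number. *)
have [a1 a2] := adde_lty_fin (adde_ge0 (mule_ge0 cE (adde_ge0 e0_ge0 ef_ge0))
    (mule_ge0 ecE (adde_ge0 Neta0_ge0 (C_ge0 eta))))
  (mule_ge0 ecE (adde_ge0 (adde_ge0 Nh0_ge0 (C_ge0 h0)) (adde_ge0 Nh1_ge0 (C_ge0 h1)))) rhs_fin.
have [a3 a4] := adde_lty_fin (mule_ge0 cE (adde_ge0 e0_ge0 ef_ge0))
  (mule_ge0 ecE (adde_ge0 Neta0_ge0 (C_ge0 eta))) a1.
have [/(fin_of_lty e0_ge0)[A1 A1_ge0 E1] /(fin_of_lty ef_ge0)[A2 A2_ge0 E2]] :=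
  adde_lty_fin e0_ge0 ef_ge0 (mule_lty_fin cT0 (adde_ge0 e0_ge0 ef_ge0) a3).
have [/(fin_of_lty Neta0_ge0)[A3 A3_ge0 E3] /(fin_of_lty (C_ge0 eta))[A4 A4_ge0 E4]] :=
  adde_lty_fin Neta0_ge0 (C_ge0 eta) (mule_lty_fin ec0 (adde_ge0 Neta0_ge0 (C_ge0 eta)) a4).
have [a5 a6] := adde_lty_fin (adde_ge0 Nh0_ge0 (C_ge0 h0)) (adde_ge0 Nh1_ge0 (C_ge0 h1))
  (mule_lty_fin ec0 (adde_ge0 (adde_ge0 Nh0_ge0 (C_ge0 h0)) (adde_ge0 Nh1_ge0 (C_ge0 h1))) a2).
have [/(fin_of_lty Nh0_ge0)[A5 A5_ge0 E5] /(fin_of_lty (C_ge0 h0))[A6 A6_ge0 E6]] :=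
  adde_lty_fin Nh0_ge0 (C_ge0 h0) a5.
have [/(fin_of_lty Nh1_ge0)[A7 A7_ge0 E7] /(fin_of_lty (C_ge0 h1))[A8 A8_ge0 E8]] :=
  adde_lty_fin Nh1_ge0 (C_ge0 h1) a6.
pose N := (A3 + A4) + ((A5 + A6) + (A7 + A8)).
have [l3 l4] : A3 <= N /\ A4 <= N.
  by split; apply: ler_wpDr; rewrite ?addr_ge0 ?lerDl ?lerDr.
have [l5 l6] : A5 <= N /\ A6 <= N.
  by split; apply: ler_wpDl; rewrite ?addr_ge0 //; apply: ler_wpDr; rewrite ?addr_ge0 ?lerDl ?lerDr.
have [l7 l8] : A7 <= N /\ A8 <= N.
  by split; apply: ler_wpDl; rewrite ?addr_ge0 //; apply: ler_wpDl; rewrite ?addr_ge0 ?lerDl ?lerDr.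
have N0 : 0 <= N by exact: le_trans l3.
pose h b := if b then h1 else h0.
pose D := LimitData eta h N.
have ctrl z (A : R) : C21 T S z -> C21norm T S z = A%:E -> A <= N -> controlled T S z N.
  by move=> cz zA AN; apply: C21norm_controlled => //; rewrite zA lee_fin.
have ceta : controlled T S eta N by exact: ctrl etaC E4 l4.
have ch b : controlled T S (h b) N by case: b; [exact: ctrl h1C E8 l8|exact: ctrl h0C E6 l6].
have aD : admissible T S g0 g1 D.
  by split=> //= [[] p sp]; [exact: h1E|exact: h0E].
have split_time z (A : R) : controlled T S z N -> A <= N ->
    (forall y, Gam S 0 y -> `|z (y, 0)| <= A) -> forall q, STbar T S q -> `|z q| <= N.
  move=> [_ hz _ _] AN z0 [y t] [/= tT Gy]; move: (tT); rewrite in_itv /= => /andP[t0 tT'].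
  move: t0; rewrite le_eqVlt => /orP[/eqP t0|t0].
    by rewrite -t0 in Gy *; apply: le_trans (z0 _ Gy) AN.
  by have [] := hz (y, t); first by split=> //=; rewrite in_itv /= t0.
have beta : forall q, STbar T S q -> `|eta q| <= N.
  apply: (split_time eta A3 ceta l3) => y Gy; rewrite (ini _ Gy).
  by apply: (@supnorm_fin _ _ (Gam S 0) eta0 A3) => //; rewrite -E3.
have bh b : forall q, STbar T S q -> `|h b q| <= N.
  case: b.
    apply: (split_time h1 A7 (ch true) l7) => y Gy.
    by apply: (@supnorm_fin _ _ (Gam S 0) (fun y => h1 (y, 0)) A7) => //; rewrite -E7.
  apply: (split_time h0 A5 (ch false) l5) => y Gy.
  by apply: (@supnorm_fin _ _ (Gam S 0) (fun y => h0 (y, 0)) A5) => //; rewrite -E5.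
have start p : Qbar p -> p.2 = 0 -> `|rho p - cext S eta p| <= A1.
  case: p => x t hp t0; have Gx := QTbar_foot hT hS hg0 hg1 gmin0 hgmin hdelta heps hp.
  case: hp => /= tT cx; rewrite /= in t0; rewrite {t}t0 in tT cx Gx *.
  have -> : rho (x, 0) = rho0 x.
    by apply: (initial_values _ (thin_continuous sol) rho0c (thin_init sol)).
  rewrite /cext /= (ini _ Gx.2).
  by apply: (@supnorm_fin _ _ (closure (Om 0)) (fun x => rho0 x - eta0 (foot S (x, 0))) A1) => //; rewrite -E1.
have ferr p : Q p -> `|feps p - cext S f p| <= A2.
  by move=> hp; apply: (@supnorm_fin _ _ Q (fun p => feps p - cext S f p) A2) => //; rewrite -E2.
have ce : {within STbar T S, continuous (profile D)} by exact: etac.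
have chh b : {within STbar T S, continuous (source D b)} by case: b.
have est := main eps nueps Veps rho0 feps f rho D A1 A2 heps A1_ge0 A2_ge0 hnu hV sol aD pde ce chh beta bh start ferr.
have rhsE : rhs = ((c + 1) * (A1 + A2) + eps * (c + 1) * (A3 + A4)
    + eps * (c + 1) * (A5 + A6 + (A7 + A8)))%:E.
  by rewrite /rhs E1 E2 E3 E4 E5 E6 E7 E8.
apply: supnorm_le => p hp; rewrite rhsE lee_fin.
apply: le_trans (est p hp) _.
have -> : (c + 1) * (A1 + A2) + eps * (c + 1) * (A3 + A4) + eps * (c + 1) * (A5 + A6 + (A7 + A8))
  = (c + 1) * (A1 + A2 + eps * N) by rewrite /N; ring.
apply: ler_wpM2r; last by rewrite lerDl.
by rewrite !addr_ge0 // mulr_ge0 // ltW.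
Qed.
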